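(* Let $m\ge3$ be a fixed integer, $\beta\in(0,1)$, $h=\rho N^{-\alpha}$ with $\rho>0$, $\alpha\ge1/4$, and let $(J_{ij})_{i<j}$ be i.i.d. with a symmetric distribution, variance one and finite sixth moment. Let $$\boldsymbol W:=\bigl(L_N^{\ell},\,3\le\ell\le m;\;P_N^{\ell'},\,1\le\ell'\le m;\;Q_N\bigr),$$ a $(2m-1)$-dimensional random vector with mean $0$ and (diagonal) covariance matrix $\Sigma=\mathbb{E}\,\boldsymbol W\boldsymbol W^T$. Then there is a constant $C$ depending only on $m$, $\beta$, $\rho$ and the distribution of $J_{12}$ such that for every three times differentiable function $f:\mathbb{R}^{2m-1}\to\mathbb{R}$ (and all $N$), $$\bigl|\mathbb{E}f(\boldsymbol W)-\mathbb{E}f(\Sigma^{1/2}\boldsymbol Z)\bigr|\le C\bigl(|f|_2N^{-1/2}+|f|_3N^{-1/4}\bigr),$$ where $\boldsymbol Z$ is a standard normal vector in $\mathbb{R}^{2m-1}$.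
   Context: Let $\omega_{ij}:=\tanh(\beta J_{ij}/\sqrt N)$ for edges $e=(i,j)$, $i<j$, of the complete graph $K_N$ on $\{1,\dots,N\}$; for an edge set $\Gamma$ put $\omega(\Gamma):=\prod_{e\in\Gamma}\omega_e$; let $\zeta_N^2:=\mathbb{E}\omega_{12}^2$ and $\hat h:=\tanh h$. A loop of length $\ell\ge3$ is a simple cycle with $\ell$ edges in $K_N$, and a path of length $\ell'\ge1$ is a simple (self-avoiding, unoriented) path with $\ell'$ edges in $K_N$. Define $$Q_N:=\sum_{e}(\omega_e^2-\zeta_N^2),\quad L_N^{\ell}:=\sum_{\text{loops }\gamma,\,|\gamma|=\ell}\omega(\gamma)\ (\ell\ge3),\quad P_N^{\ell'}:=\hat h^2\sum_{\text{paths }p,\,|p|=\ell'}\omega(p)\ (\ell'\ge1).$$ Norms: $|f|_2:=\sup_{i,j}\|\partial_{x_ix_j}f\|_\infty$, $|f|_3:=\sup_{i,j,k}\|\partial_{x_ix_jx_k}f\|_\infty$. *)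

(* Defs.v *)
From HB Require Import structures.
From mathcomp Require Import all_boot all_order all_algebra.
From mathcomp Require Import all_classical all_reals all_analysis.

Set Implicit Arguments.
Unset Strict Implicit.
Unset Printing Implicit Defensive.

Import Order.TTheory GRing.Theory Num.Theory.
Import numFieldNormedType.Exports.

Local Open Scope classical_set_scope.
Local Open Scope ring_scope.

Definition tanh {R : realType} (x : R) : R :=
  (expR x - expR (- x)) / (expR x + expR (- x)).

Section Probability.
Context {d : measure_display} {T : measurableType d} {R : realType}.
Variable P : probability T R.

(* Only the members of the family X whose index lies in D are considered. *)
Definition mutually_independent (I : eqType) (D : {pred I}) (X : I -> T -> R) :=
  forall (s : seq I) (A : I -> set R), uniq s -> {subset s <= D} ->
    (forall i, measurable (A i)) ->
    P (\bigcap_(i in [set` s]) (X i @^-1` A i)) =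
    (\prod_(i <- s) P (X i @^-1` A i)%classic)%E.

Definition has_law (X : {RV P >-> R}) (mu : set R -> \bar R) :=
  forall A : set R, measurable A -> distribution P X A = mu A.

Definition second_moment_mx (n : nat) (W : T -> 'cV[R]_n) : 'M[R]_n :=
  \matrix_(k, l) fine 'E_P[fun w => W w k 0 * W w l 0].

Definition std_normal_vector (n : nat) (Z : 'I_n -> {RV P >-> R}) :=
  mutually_independent xpredT (fun k => Z k : T -> R) /\
  forall k, has_law (Z k) (normal_prob 0 1).

End Probability.

Definition symmetric_law {R : realType} (mu : set R -> \bar R) :=
  forall A : set R, measurable A -> mu (-%R @^-1` A) = mu A.

Definition is_psd {R : realType} {n : nat} (S : 'M[R]_n) :=
  S^T = S /\ forall x : 'cV[R]_n, 0 <= (x^T *m S *m x) 0 0.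

(* A positive semidefinite matrix has exactly one positive semidefinite square
   root; the default value 0 is only taken when A is not such a matrix. *)
Definition sqrt_mx {R : realType} {n : nat} (A : 'M[R]_n) : 'M[R]_n :=
  xget 0 [set S | is_psd S /\ S *m S = A].

Section Smooth.
Context {R : realType} {n : nat}.
Implicit Types f : 'cV[R]_n -> R.

Definition partial (i : 'I_n) f : 'cV[R]_n -> R :=
  fun x => 'D_(delta_mx i 0) f x.

(* Frechet differentiability of order k: in finite dimension the derivative is
   differentiable iff its coordinates, the partial derivatives, are. *)
Fixpoint times_differentiable (k : nat) f : Prop :=
  if k is k'.+1 then
    (forall x, differentiable f x) /\
    (forall i, times_differentiable k' (partial i f))
  else True.

Definition norm2 f : \bar R :=
  ereal_sup [set y | exists i j x, y = `|partial j (partial i f) x|%:E].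

Definition norm3 f : \bar R :=
  ereal_sup [set y | exists i j k x,
    y = `|partial k (partial j (partial i f)) x|%:E].

End Smooth.

(* The vertices 1, ..., N are shifted to 0, ..., N - 1, and an edge is the pair
   (i, j) of its endpoints with i < j. *)
Section CompleteGraph.
Variable N : nat.

Definition edge : predArgType := ('I_N * 'I_N)%type.

Definition is_edge (e : edge) : bool := (e.1 < e.2)%N.

Definition mk_edge (u v : 'I_N) : edge := if (u < v)%N then (u, v) else (v, u).

(* [zip] drops the unmatched last vertex of p. *)
Definition path_edges (p : seq 'I_N) : {set edge} :=
  [set e in [seq mk_edge u.1 u.2 | u <- zip p (behead p)]].

Definition loop_edges (p : seq 'I_N) : {set edge} :=
  [set e in [seq mk_edge u.1 u.2 | u <- zip p (rot 1 p)]].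

(* Paths and loops are identified with their edge sets, so that the choice of
   an orientation, and of a starting point for loops, is forgotten. *)
Definition is_path (l : nat) (G : {set edge}) : bool :=
  [exists p : l.+1.-tuple 'I_N, uniq p && (G == path_edges p)].

Definition is_loop (l : nat) (G : {set edge}) : bool :=
  [exists p : l.-tuple 'I_N, uniq p && (G == loop_edges p)].

End CompleteGraph.

Section SpinGlass.
Context {d : measure_display} {T : measurableType d} {R : realType}.
Variables (P : probability T R) (J : nat -> nat -> {RV P >-> R}).
Variables (beta h : R) (N : nat).

Definition omega (i j : nat) : T -> R :=
  fun w => tanh (beta * J i j w / Num.sqrt N%:R).

Definition omega_set (G : {set edge N}) : T -> R :=
  fun w => \prod_(e in G) omega e.1 e.2 w.

(* [omega 0 1] is the edge joining the first two vertices. *)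
Definition zeta2 : R := fine 'E_P[fun w => omega 0 1 w ^+ 2].

Definition Qstat : T -> R :=
  fun w => \sum_(e : edge N | is_edge e) (omega e.1 e.2 w ^+ 2 - zeta2).

Definition Lstat (l : nat) : T -> R :=
  fun w => \sum_(G : {set edge N} | is_loop l G) omega_set G w.

Definition Pstat (l : nat) : T -> R :=
  fun w => tanh h ^+ 2 * \sum_(G : {set edge N} | is_path l G) omega_set G w.

(* The coordinates are, in this order, L^3, ..., L^m, P^1, ..., P^m, Q. *)
Definition Wvec (m : nat) (w : T) : 'cV[R]_(2 * m).-1 :=
  \col_k (if (k < m - 2)%N then Lstat (k + 3) w
          else if (k < (m - 2) + m)%N then Pstat (k - (m - 2)).+1 w
          else Qstat w).

End SpinGlass.

(* Main.v *)
Require Import Defs.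
From HB Require Import structures.
From mathcomp Require Import all_boot all_order all_algebra.
From mathcomp Require Import all_classical all_reals all_analysis.
From mathcomp Require Import measurable_realfun ring lra zify.

Import Order.TTheory GRing.Theory Num.Theory.
Import numFieldNormedType.Exports.

Local Open Scope classical_set_scope.
Local Open Scope ring_scope.

Set Implicit Arguments.
Unset Strict Implicit.
Unset Printing Implicit Defensive.

(** The statistics are polynomials in the independent couplings of the edges, and
    the proof combines Stein's method, an enumeration of graphs, and Gaussian
    interpolation.

    Write x_e = sqrt N omega_e. These variables are independent and symmetric,
    and since |tanh t| <= |t| their moments up to order six are bounded uniformly
    in N. A loop or path statistic is kappa times the sum, over the graphs G of
    some family, of the product of the x_e with e in G. All graphs of the family
    have the same numbers n of vertices and l of edges, and kappa^2 = O(N^-n):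
    for loops n = l, and for paths n = l + 1, the missing factor 1/N being
    supplied by tanh h ^ 4. The statistic Q is 1/N times the sum of the centred
    squares of the x_e.

    Stein's method. For each i one has l_i W_i = sum_e y_i(e) s_i(e), where
    y_i(e) depends on x_e alone and is centred, and s_i(e) depends on the other
    variables. Expanding g at the vector W deprived of x_e gives
    E W_i g(W) = sum_j E(W_i W_j) E d_j g(W) up to two errors (leave_one_out).
    The first is M2 times the mean fluctuation of
    T_ij = sum_e E(y_i y_j)(e) s_i(e) s_j(e); the second is M3 times a sum of
    third absolute moments of the s_i(e).

    Counting. The variance of T_ij is a sum over quadruples of graphs. A
    quadruple contributes only if each edge is covered at least twice; then so
    is each vertex, whence at most n_i + n_j vertices. In the extremal case no
    vertex is met three times, and connectedness forces the graphs to coincide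
    in pairs, the two pairs being edge-disjoint (rigid_quadruple): the covariance
    vanishes. So only N^(n_i + n_j - 1) quadruples matter, Var T_ij = O(1/N)
    (variance_pinned_sum, loc_variance), and the first error is O(N^(-1/2)). In
    the same way sum_e E s_i(e)^4 = O(N^-2) (fourth_moment_star), because both
    ends of e are covered four times, and the second error is O(1/N). Covers with
    an edge of multiplicity one also show that the W_i are uncorrelated.

    Interpolation. Along sin t W + cos t Sigma^(1/2) Z the derivative of the
    expectation of f is a difference of two terms. Gaussian integration by parts
    for Z and the approximate identity for W turn them into the same second-order
    expression, so the derivative is bounded by the error of the latter
    (smart_path_bound). Integrating over a quarter circle gives the theorem, with
    1/N in place of the larger N^(-1/4). *)

(** * Real-valued expectations *)

Lemma eq_ler {R : realType} (x y : R) : x = y -> x <= y.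
Proof. by move=> ->. Qed.

Section Expectation.
Context {d : measure_display} {T : measurableType d} {R : realType}.
Variable P : probability T R.
Implicit Types X Y : T -> R.

Definition integ X := P.-integrable setT (EFin \o X).
(** A real number, so that linear identities need no finiteness conditions;
    Ex_expectation links it to the extended expectation. *)
Definition Ex X : R := \int[P]_w X w.

Lemma integ_meas X : integ X -> measurable_fun setT X.
Proof. by move/(measurable_int P)/measurable_EFinP. Qed.

Lemma integ_dom X Y : measurable_fun setT X -> integ Y ->
  (forall w, `|X w| <= Y w) -> integ X.
Proof.
move=> mX iY XY; apply: le_integrable iY => //.
  exact/measurable_EFinP.
by move=> w _ /=; rewrite lee_fin (le_trans (XY w))// ler_norm.
Qed.

Lemma integ_cst c : integ (fun=> c).
Proof. exact: finite_measure_integrable_cst. Qed.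

Lemma integ_bdd M X : measurable_fun setT X -> (forall w, `|X w| <= M) ->
  integ X.
Proof. by move=> mX XM; exact: integ_dom mX (integ_cst M) XM. Qed.

Lemma integD X Y : integ X -> integ Y -> integ (fun w => X w + Y w).
Proof. by move=> iX iY; have := integrableD measurableT iX iY. Qed.

Lemma integZ c X : integ X -> integ (fun w => c * X w).
Proof. by move=> iX; have := integrableZl measurableT c iX. Qed.

Lemma integB X Y : integ X -> integ Y -> integ (fun w => X w - Y w).
Proof. by move=> iX iY; have := integrableB measurableT iX iY. Qed.

Lemma integ_norm X : integ X -> integ (fun w => `|X w|).
Proof. by move=> iX; have := integrable_norm iX. Qed.

Lemma integ_sum I (s : seq I) (Q : pred I) (F : I -> T -> R) :
  (forall i, integ (F i)) -> integ (fun w => \sum_(i <- s | Q i) F i w).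
Proof.
move=> iF; elim: s => [|a s ih].
  by under [X in integ X]eq_fun do rewrite big_nil; exact: integ_cst.
under [X in integ X]eq_fun do rewrite big_cons.
by case: (Q a) => //; exact: integD.
Qed.

Lemma Ex_cst c : Ex (fun=> c) = c.
Proof. by rewrite /Ex Rintegral_cst//= probability_setT mulr1. Qed.

Lemma ExD X Y : integ X -> integ Y ->
  Ex (fun w => X w + Y w) = Ex X + Ex Y.
Proof. by move=> iX iY; rewrite /Ex RintegralD. Qed.

Lemma ExB X Y : integ X -> integ Y ->
  Ex (fun w => X w - Y w) = Ex X - Ex Y.
Proof. by move=> iX iY; rewrite /Ex RintegralB. Qed.

Lemma ExZ c X : integ X -> Ex (fun w => c * X w) = c * Ex X.
Proof. by move=> iX; rewrite /Ex RintegralZl. Qed.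

Lemma Ex_sum I (s : seq I) (Q : pred I) (F : I -> T -> R) :
  (forall i, integ (F i)) ->
  Ex (fun w => \sum_(i <- s | Q i) F i w) = \sum_(i <- s | Q i) Ex (F i).
Proof.
move=> iF; elim: s => [|a s ih].
  rewrite big_nil -[RHS](Ex_cst 0); congr Ex.
  by apply/funext => w; rewrite big_nil.
rewrite big_cons -ih; case: ifPn => Qa.
  rewrite -ExD//; last exact: integ_sum.
  by congr Ex; apply/funext => w; rewrite big_cons Qa.
by congr Ex; apply/funext => w; rewrite big_cons (negbTE Qa).
Qed.

Lemma Ex_lincomb n (a : 'I_n -> R) (F : 'I_n -> T -> R) :
  (forall j, integ (F j)) -> integ (fun w => \sum_j a j * F j w) /\
  Ex (fun w => \sum_j a j * F j w) = \sum_j a j * Ex (F j).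
Proof.
move=> iF; split; first by apply: integ_sum => j; exact: integZ.
by rewrite Ex_sum; [apply: eq_bigr => j _; rewrite ExZ|move=> j; exact: integZ].
Qed.

Lemma Ex_le X Y : integ X -> integ Y -> (forall w, X w <= Y w) -> Ex X <= Ex Y.
Proof. by move=> iX iY XY; exact: le_Rintegral. Qed.

Lemma Ex_ge0 X : (forall w, 0 <= X w) -> 0 <= Ex X.
Proof. by move=> X0; exact: Rintegral_ge0. Qed.

Lemma Ex_norm X : integ X -> `|Ex X| <= Ex (fun w => `|X w|).
Proof. by move=> iX; exact: le_normr_Rintegral. Qed.

Lemma Ex_norm_le X Y : integ X -> integ Y -> (forall w, `|X w| <= Y w) ->
  `|Ex X| <= Ex Y.
Proof.
move=> iX iY XY; apply: (le_trans (Ex_norm iX)).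
by apply: Ex_le => //; exact: integ_norm.
Qed.

Lemma Ex_expectation X : integ X -> ('E_P[X] = (Ex X)%:E)%E.
Proof.
move=> iX; rewrite unlock /Ex /Rintegral fineK//.
exact: integrable_fin_num.
Qed.

End Expectation.

(** * Independence of a sigma-algebra and a random variable *)

Section IndependentOfSigmaAlgebra.
Context {d : measure_display} {T : measurableType d} {R : realType}.
Variables (P : probability T R) (G : set (set T)) (Y : {mfun T >-> R}).
Hypotheses (Gm : G `<=` measurable) (GI : setI_closed G) (GT : G setT).
Hypothesis indGY : forall B A, G B -> measurable A ->
  P (B `&` Y @^-1` A) = (P B * P (Y @^-1` A))%E.

Let T0 := g_sigma_algebraType G.

(** The identity, onto the space that carries only the events generated by G. *)
Let coarse : T -> T0 := fun w => w.

Let measurable_coarse : measurable_fun setT coarse.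
Proof.
move=> _ B mB; rewrite setTI.
exact: (smallest_sub (@sigma_algebra_measurable _ T) Gm).
Qed.

HB.instance Definition _ :=
  @isMeasurableFun.Build _ _ _ _ coarse measurable_coarse.

Let graph : T -> T0 * R := fun w => (coarse w, Y w).

Let measurable_graph : measurable_fun setT graph.
Proof. exact: measurable_fun_pair. Qed.

HB.instance Definition _ :=
  @isMeasurableFun.Build _ _ _ _ graph measurable_graph.

Let indep_measurable (B : set T0) (A : set R) : measurable B -> measurable A ->
  P (B `&` Y @^-1` A) = (P B * P (Y @^-1` A))%E.
Proof.
move=> mB mA.
have mYA : measurable (Y @^-1` A) by rewrite -[X in measurable X]setTI; exact: measurable_funP.
have r0 : 0 <= fine (P (Y @^-1` A)) by exact: fine_ge0.
pose m2 : {measure set T -> \bar R} := mscale (NngNum r0) P.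
have fA : P (Y @^-1` A) \is a fin_num by exact: fin_num_measure.
rewrite muleC -[P (Y @^-1` A)]fineK//.
apply: (@g_sigma_algebra_measure_unique _ _ _ G Gm (fun=> setT) _ _
   (mrestr P mYA) m2) => //.
- by rewrite bigcup_const//; exists 0%N.
- move=> C GC; rewrite /= /mrestr /m2 /= /mscale /= indGY//.
  by rewrite muleC fineK.
- move=> k; rewrite /= /mrestr.
  by rewrite (le_lt_trans (probability_le1 _ _))// ?ltry// setTI.
Qed.

(** The pair (w, Y w) has a product law: independence says so on the rectangles
    with a first side in the pi-system G, and these determine the law. *)
Lemma indep_fubini (F : T0 * R -> R) :
  measurable_fun setT F -> integ P (fun w => F (w, Y w)) ->
  (\int[P]_w (F (w, Y w))%:E =
   \int[P]_w \int[distribution P Y]_y (F (w, y))%:E)%E.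
Proof.
move=> mF iF.
have mF' : measurable_fun setT (EFin \o F) by exact/measurable_EFinP.
pose P0 := distribution P coarse; pose law := distribution P Y.
have jointE A : measurable A ->
    distribution P graph A = (P0 \x law)%E A.
  move=> mA; apply/esym; apply: product_measure_unique mA => B C mB mC.
  rewrite -[RHS]/(P (coarse @^-1` B) * P (Y @^-1` C))%E -indep_measurable//.
rewrite -[LHS](@integral_distribution _ _ _ _ _ P graph (EFin \o F))//.
rewrite (@eq_measure_integral _ _ _ _ (P0 \x law)%E); last first.
  by move=> A mA _; exact: jointE.
have iF0 : (P0 \x law)%E.-integrable setT (EFin \o F).
  apply/integrableP; split => //.
  have -> : (\int[P0 \x law]_z `|(EFin \o F) z| =
             \int[distribution P graph]_z `|(EFin \o F) z|)%E.
    by apply: eq_measure_integral => A mA _; apply/esym; exact: jointE.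
  rewrite ge0_integral_distribution//; last exact: measurableT_comp.
  by case/integrableP: iF.
rewrite -integral12_prod_meas1//.
rewrite (@integral_distribution _ _ _ _ _ P coarse (fun w => \int[law]_y (F (w, y))%:E)%E)//.
  exact: measurable_fubini_F iF0.
have := integrable_fubini_F iF0.
case/integrableP => m1 i1; apply/integrableP; split.
  exact: measurableT_comp.
move: i1; rewrite ge0_integral_distribution//.
exact: measurableT_comp.
Qed.

Lemma indep_Ex_mul (u : R -> R) (V : T0 -> R) a b :
  measurable_fun setT u -> (forall y, `|u y| <= a) ->
  measurable_fun setT V -> (forall w, `|V w| <= b) ->
  Ex P (fun w => u (Y w) * V w) = Ex P (fun w => u (Y w)) * Ex P V.
Proof.
move=> mu ua mV Vb.
have mV' : measurable_fun (setT : set T) V.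
  exact: (measurableT_comp mV measurable_coarse).
have muY : measurable_fun setT (fun w => u (Y w)) by exact: measurableT_comp.
rewrite [LHS]/Ex /Rintegral.
rewrite (indep_fubini (F := fun z => u z.2 * V z.1)); last 2 first.
- apply: measurable_funM; first exact: measurableT_comp.
  exact: measurableT_comp.
- apply: (@integ_bdd _ _ _ _ (a * b)); first exact: measurable_funM.
  by move=> w; rewrite normrM ler_pM.
have iu : (distribution P Y).-integrable setT (EFin \o u).
  exact: (@integ_bdd _ _ _ (distribution P Y) a).
have inner w : (\int[distribution P Y]_y (u y * V w)%:E =
                (Ex P (fun w => u (Y w)) * V w)%:E)%E.
  under eq_integral do rewrite mulrC EFinM.
  rewrite integralZl// muleC [RHS]EFinM; congr (_ * _)%E.
  rewrite (@integral_distribution _ _ _ _ _ P Y (EFin \o u))//.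
  - rewrite /Ex /Rintegral fineK//; apply: integrable_fin_num => //.
    exact: (@integ_bdd _ _ _ P a).
  - exact/measurable_EFinP.
  - exact: (@integ_bdd _ _ _ P a).
under eq_integral do rewrite /= inner.
by rewrite -ExZ//; exact: (@integ_bdd _ _ _ P b).
Qed.

End IndependentOfSigmaAlgebra.

(** * Mutually independent families *)

Section MutualIndependence.
Context {d : measure_display} {T : measurableType d} {R : realType}.
Variables (P : probability T R) (I : eqType) (D : {pred I}).
Variable X : I -> {mfun T >-> R}.
Hypothesis indX : mutually_independent P D (fun i => X i : T -> R).

(** The pi-system of the cylinders that constrain members of X other than X k;
    it generates everything that these members determine. *)
Definition cyl (k : I) : set (set T) :=
  [set B | exists s : seq I, exists A : I -> set R,
    [/\ uniq s, forall i, i \in s -> (i \in D) && (i != k),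
        forall i, measurable (A i) &
        B = \bigcap_(i in [set` s]) (X i @^-1` A i)]].

Lemma cyl_measurable k : cyl k `<=` measurable.
Proof.
move=> B [s [A [_ _ mA ->]]]; apply: fin_bigcap_measurable => // i _.
by rewrite -[X in measurable X]setTI; exact: measurable_funP.
Qed.

Lemma cyl_setT k : cyl k setT.
Proof.
exists [::], (fun=> setT); split => //.
by apply/seteqP; split => // w _ i.
Qed.

Lemma cyl_setI k : setI_closed (cyl k).
Proof.
move=> _ _ [s [A [us sD mA ->]]] [s' [A' [us' sD' mA' ->]]].
(* A coordinate constrained by only one of the cylinders gets setT from the other. *)
exists (undup (s ++ s')),
  (fun i => (if i \in s then A i else setT) `&` (if i \in s' then A' i else setT)).
split.
- exact: undup_uniq.
- by move=> i; rewrite mem_undup mem_cat => /orP[/sD|/sD'].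
- by move=> i; apply: measurableI; case: ifP.
- apply/seteqP; split => w /=.
    move=> [h h'] i /=; rewrite mem_undup mem_cat => _; split.
      by case: ifPn => //= si; exact: h.
    by case: ifPn => //= si; exact: h'.
  move=> h; split => i /= si.
    by have := h i; rewrite /= mem_undup mem_cat si => -[].
  by have := h i; rewrite /= mem_undup mem_cat si orbT => -[].
Qed.

Lemma cyl_indep k B A : k \in D -> cyl k B -> measurable A ->
  P (B `&` X k @^-1` A) = (P B * P (X k @^-1` A))%E.
Proof.
move=> kD [s [F [us sD mF ->]]] mA.
have ks : k \notin s by apply/negP => /sD /andP[_]; rewrite eqxx.
pose F' i := if i == k then A else F i.
have mF' i : measurable (F' i) by rewrite /F'; case: ifP.
have eqF i : i \in s -> F' i = F i.
  by move=> si; rewrite /F'; case: eqP => // ik; move: ks; rewrite -ik si.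
have := @indX (k :: s) F' _ _ mF'.
have F'k : F' k = A by rewrite /F' eqxx.
rewrite /= ks us big_cons F'k.
have -> : \bigcap_(i in [set` k :: s]) (X i @^-1` F' i) =
          \bigcap_(i in [set` s]) (X i @^-1` F i) `&` X k @^-1` A.
  apply/seteqP; split => w /=.
    move=> h; split => [i si|].
      by have := h i; rewrite /= in_cons (si : i \in s) orbT (eqF _ si) => /(_ isT).
    by have := h k; rewrite /= mem_head F'k => /(_ isT).
  move=> [h hk] i /=; rewrite in_cons => /orP[/eqP ->|si].
    by rewrite F'k.
  by rewrite (eqF _ si); exact: h.
move=> ->//; last first.
  by move=> i; rewrite in_cons => /orP[/eqP->//|/sD/andP[]].
have := @indX s F us _ mF; move=> -> //; last by move=> i /sD/andP[].
rewrite muleC; congr (_ * _)%E.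
by rewrite big_seq [RHS]big_seq; apply: eq_bigr => i /eqF ->.
Qed.

Lemma measurable_cyl k i : i \in D -> i != k ->
  measurable_fun setT (X i : g_sigma_algebraType (cyl k) -> R).
Proof.
move=> iD ik _ A mA; rewrite setTI; apply: sub_sigma_algebra.
exists [:: i], (fun=> A); split => //.
  by move=> j; rewrite inE => /eqP ->; rewrite iD.
apply/seteqP; split => w /=.
  by move=> h j /=; rewrite inE => /eqP ->.
by move=> /(_ i); rewrite /= inE eqxx => /(_ isT).
Qed.

Lemma Ex_indep_mul k (u : R -> R) (V : T -> R) a b : k \in D ->
  measurable_fun setT u -> (forall y, `|u y| <= a) ->
  measurable_fun setT (V : g_sigma_algebraType (cyl k) -> R) ->
  (forall w, `|V w| <= b) ->
  Ex P (fun w => u (X k w) * V w) = Ex P (fun w => u (X k w)) * Ex P V.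
Proof.
move=> kD; apply: (indep_Ex_mul (@cyl_measurable k) (@cyl_setI k) (cyl_setT k)).
by move=> B A; exact: cyl_indep.
Qed.

(** Induction on s: the product over the tail is measurable for the cylinders
    that avoid the head. *)
Lemma Ex_indep_prod (s : seq I) (u : I -> R -> R) (a : I -> R) :
  uniq s -> {subset s <= D} ->
  (forall i, measurable_fun setT (u i)) -> (forall i y, `|u i y| <= a i) ->
  Ex P (fun w => \prod_(i <- s) u i (X i w)) =
  \prod_(i <- s) Ex P (fun w => u i (X i w)).
Proof.
move=> + + mu ua; elim: s => [_ _|k s ih /=/andP[ks us] sD].
  by under [X in Ex P X]eq_fun do rewrite big_nil; rewrite Ex_cst big_nil.
under [X in Ex P X]eq_fun do rewrite big_cons.
rewrite big_cons -ih//; last by move=> i si; apply: sD; rewrite in_cons si orbT.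
apply: (@Ex_indep_mul k (u k) (fun w => \prod_(i <- s) u i (X i w)) (a k)
  (\prod_(i <- s) a i)) => //.
- by apply: sD; rewrite mem_head.
- under [X in measurable_fun _ X]eq_fun do rewrite big_seq.
  have sk : forall i, i \in s -> measurable_fun setT
       (fun w : g_sigma_algebraType (cyl k) => u i (X i w)).
    move=> i si; apply: (measurableT_comp (mu i)); apply: measurable_cyl.
      by apply: sD; rewrite in_cons si orbT.
    by apply: contraNneq ks => <-.
  suff H r : {subset r <= s} -> measurable_fun setT
      (fun w : g_sigma_algebraType (cyl k) =>
         \prod_(i <- r | i \in s) u i (X i w)) by exact: H.
  elim: r => [_|j r ihr jrs].
    under [X in measurable_fun _ X]eq_fun do rewrite big_nil.
    exact: measurable_cst.
  have js : j \in s by apply: jrs; rewrite mem_head.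
  under [X in measurable_fun _ X]eq_fun do rewrite big_cons js.
  apply: measurable_funM; first exact: sk.
  by apply: ihr => i ir; apply: jrs; rewrite in_cons ir orbT.
- move=> w; rewrite normr_prod; apply: ler_prod => i _.
  by rewrite normr_ge0 ua.
Qed.

End MutualIndependence.

(** * Continuous functions of finitely many measurable functions *)

(** An open set of column vectors is a countable union of boxes with rational
    centre and radius, and the preimage of a box is a finite intersection of
    preimages of intervals. *)
Lemma measurable_continuous_cV {R : realType} {d0 : measure_display}
    {T0 : measurableType d0} (n : nat) (f : 'cV[R]_n -> R)
    (V : 'I_n -> T0 -> R) : continuous f ->
  (forall k, measurable_fun setT (V k)) ->
  measurable_fun setT (fun w => f (\col_k V k w)).
Proof.
move=> cf mV; apply: (@measurability _ _ _ _ _ _ (@RGenOInfty.G R)).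
  exact: RGenOInfty.measurableE.
move=> _ [_ [x ->] <-]; rewrite setTI.
pose U := f @^-1` `]x, +oo[%classic.
have oU : open U by apply: open_comp => // z _; exact: cf.
pose box (q : 'cV[rat]_n) (r : rat) : set T0 :=
  \bigcap_(k in [set: 'I_n])
    V k @^-1` `](ratr (q k 0) - ratr r : R), (ratr (q k 0) + ratr r : R)[%classic.
pose good : set ('cV[rat]_n * rat) :=
  [set qr : 'cV[rat]_n * rat | [set y : 'cV[R]_n | forall k, `|y k 0 - ratr (qr.1 k 0)| < ratr qr.2]
     `<=` U].
have -> : (fun w => f (\col_k V k w)) @^-1` `]x, +oo[%classic =
    \bigcup_(qr in good) box qr.1 qr.2.
  apply/seteqP; split => w /=.
    move=> Uw; have : nbhs (\col_k V k w) U by apply: open_nbhs_nbhs.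
    move=> /nbhs_ballP[e /= e0 eU].
    have /rat_in_itvoo[r] : 0 < e / 2 by rewrite divr_gt0.
    rewrite in_itv /= => /andP[r0 re].
    have /choice[q qP] : forall k : 'I_n, exists q : rat,
        ratr q \in `](V k w - ratr r), (V k w + ratr r)[.
      move=> k; suff /rat_in_itvoo[q qk] : V k w - ratr r < V k w + ratr r by exists q.
      by rewrite ltrD2l gtrN.
    exists (\col_k q k, r) => /=.
      move=> y /= hy; apply: eU; split => // i j; rewrite (ord1 j) !mxE.
      rewrite /ball /= /ball_ /=.
      have := hy i; rewrite !mxE => yi; have := qP i; rewrite in_itv /= => qi.
      rewrite ltr_norml; move: yi; rewrite ltr_norml => /andP[y1 y2].
      by move/andP: qi => [q1 q2]; apply/andP; split; lra.
    move=> k _ /=; rewrite !mxE in_itv /=.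
    by have := qP k; rewrite in_itv /= => /andP[q1 q2]; apply/andP; split; lra.
  move=> [[q r] /= gqr bw]; apply: gqr => k; rewrite mxE.
  have := bw k Logic.I; rewrite /= in_itv /= => /andP[b1 b2].
  by rewrite ltr_norml; apply/andP; split; lra.
rewrite bigcup_mkcond; apply: countable_bigcupT_measurable => [|[q r]].
  exact: countableP.
case: ifP => // _.
apply: fin_bigcap_measurable; first exact: finite_finset.
by move=> k _; rewrite -[X in measurable X]setTI; exact: mV.
Qed.

(** * Taylor estimates along segments and arcs *)

Section Calculus.
Context {R : realType} {n : nat}.
Implicit Types (f : 'cV[R]_n -> R) (x y u v : 'cV[R]_n).

Lemma diff_partial f x v : differentiable f x ->
  'd f x v = \sum_i v i 0 * partial i f x.
Proof.
move=> df.
have {1}-> : v = \sum_i v i 0 *: delta_mx i 0.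
  rewrite [LHS]matrix_sum_delta; apply: eq_bigr => i _.
  by rewrite big_ord1.
rewrite linear_sum; apply: eq_bigr => i _.
by rewrite linearZ /= /partial deriveE.
Qed.

(** This form of the chain rule covers both the segments of the Taylor estimates
    and the arc sin t u + cos t v of the Gaussian interpolation. *)
Lemma is_derive_curve f (a b : R -> R) (a' b' t : R) u v :
  differentiable f (a t *: u + b t *: v) ->
  is_derive t 1 a a' -> is_derive t 1 b b' ->
  is_derive t 1 (fun s => f (a s *: u + b s *: v))
    (\sum_i (a' * u i 0 + b' * v i 0) * partial i f (a t *: u + b t *: v)).
Proof.
move=> df da db.
have dfa : differentiable a t by apply/derivable1_diffP; case: da.
have dfb : differentiable b t by apply/derivable1_diffP; case: db.
have dau : differentiable (fun s => a s *: u) t by exact: differentiableZl.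
have dbv : differentiable (fun s => b s *: v) t by exact: differentiableZl.
have dg : differentiable ((fun s => a s *: u) + (fun s => b s *: v)) t.
  exact: differentiableD.
have dfg : differentiable (f \o ((fun s => a s *: u) + (fun s => b s *: v))) t.
  exact: differentiable_comp.
apply: DeriveDef; first by apply: diff_derivable; exact: dfg.
rewrite (_ : (fun s => _) = f \o ((fun s => a s *: u) + (fun s => b s *: v)))//.
rewrite deriveE; last exact: dfg.
rewrite diff_comp; [|exact: dg|exact: df].
rewrite [LHS]diff_partial; last exact: df.
apply: eq_bigr => i _; congr (_ * _).
have Ea : 'd (fun s => a s *: u) t 1 = 'd a t 1 *: u.
  exact: (f_equal (fun h => h 1) (diffZl u dfa)).
have Eb : 'd (fun s => b s *: v) t 1 = 'd b t 1 *: v.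
  exact: (f_equal (fun h => h 1) (diffZl v dfb)).
have Ed : 'd ((fun s => a s *: u) + (fun s => b s *: v)) t 1 =
    'd (fun s => a s *: u) t 1 + 'd (fun s => b s *: v) t 1.
  exact: (f_equal (fun h => h 1) (diffD dau dbv)).
have Ea' : 'd a t 1 = a' by case: da => _ <-; rewrite deriveE.
have Eb' : 'd b t 1 = b' by case: db => _ <-; rewrite deriveE.
rewrite (etrans Ed (f_equal2 +%R Ea Eb)) Ea' Eb'.
by rewrite !mxE.
Qed.

Lemma MVT_curve f (a b a' b' : R -> R) (s t : R) u v : s <= t ->
  (forall x, differentiable f x) ->
  (forall r : R, is_derive r 1 a (a' r)) ->
  (forall r : R, is_derive r 1 b (b' r)) ->
  exists2 c, c \in `[s, t] &
    f (a t *: u + b t *: v) - f (a s *: u + b s *: v) =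
    (\sum_i (a' c * u i 0 + b' c * v i 0) * partial i f (a c *: u + b c *: v))
      * (t - s).
Proof.
move=> st df da db.
pose g r := f (a r *: u + b r *: v).
have dg (r : R) : is_derive r 1 g (\sum_i (a' r * u i 0 + b' r * v i 0) *
    partial i f (a r *: u + b r *: v)).
  exact: is_derive_curve.
apply: (MVT_segment st (f := g)).
apply: continuous_subspaceT => r.
apply: differentiable_continuous; apply/derivable1_diffP.
by case: (dg r).
Qed.

(** The sum norm is the one dual to a uniform bound on the partial derivatives. *)
Definition l1 x : R := \sum_i `|x i 0|.

Lemma l1_ge0 x : 0 <= l1 x. Proof. exact: sumr_ge0. Qed.

Lemma l1D x y : l1 (x + y) <= l1 x + l1 y.
Proof.
rewrite /l1 -big_split; apply: ler_sum => i _; rewrite mxE; exact: ler_normD.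
Qed.

Lemma l1Z c x : l1 (c *: x) = `|c| * l1 x.
Proof. by rewrite /l1 mulr_sumr; apply: eq_bigr => i _; rewrite mxE normrM. Qed.

Lemma MVT_segment_cV f x v : (forall x, differentiable f x) ->
  exists2 c : R, 0 <= c <= 1 &
    f (x + v) - f x = \sum_i v i 0 * partial i f (x + c *: v).
Proof.
move=> df.
have [c] := @MVT_curve f (cst 1) id (cst 0) (cst 1) 0 1 x v ler01 df
  (fun r => is_derive_cst (1 : R^o) (r : R^o) (1 : R^o)) (fun r => is_derive_id (r : R^o) (1 : R^o)).
rewrite in_itv /= => c01 h; exists c => //.
rewrite /cst !scale1r scale0r addr0 subr0 mulr1 in h; rewrite h.
by apply: eq_bigr => i _; rewrite mul0r mul1r add0r.
Qed.

Lemma lipschitz_partial f M x y : (forall x, differentiable f x) ->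
  (forall i x, `|partial i f x| <= M) -> `|f x - f y| <= M * l1 (x - y).
Proof.
move=> df fM; have [c _] := MVT_segment_cV y (x - y) df.
rewrite subrKC => ->; apply: (le_trans (ler_norm_sum _ _ _)).
rewrite /l1 mulr_sumr; apply: ler_sum => i _.
by rewrite normrM mulrC ler_wpM2r.
Qed.

Lemma taylor1 f M x v : (forall x, differentiable f x) ->
  (forall i x y, `|partial i f x - partial i f y| <= M * l1 (x - y)) ->
  `|f (x + v) - f x - \sum_i v i 0 * partial i f x| <= M * l1 v ^+ 2.
Proof.
move=> df fM; have [c /andP[c0 c1] ->] := MVT_segment_cV x v df.
rewrite -sumrB; apply: (le_trans (ler_norm_sum _ _ _)).
have le i : `|v i 0 * partial i f (x + c *: v) - v i 0 * partial i f x| <=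
    `|v i 0| * (M * l1 v).
  rewrite -mulrBr normrM ler_wpM2l//; apply: (le_trans (fM _ _ _)).
  rewrite addrAC subrr add0r l1Z mulrCA ger0_norm//.
  have M0 : 0 <= M * l1 v.
    by have := fM i v 0; rewrite subr0; apply: le_trans.
  by rewrite ler_piMl.
apply: (@le_trans _ _ (\sum_i `|v i 0| * (M * l1 v))).
  by apply: ler_sum => i _; exact: le.
by rewrite -mulr_suml -/(l1 v) expr2 mulrCA.
Qed.

Lemma growth_partial g M v u : (forall x, differentiable g x) ->
  (forall j x, `|partial j g x| <= M) -> `|g (u + v)| <= `|g v| + M * l1 u.
Proof.
move=> dg gM; rewrite -[g (u + v)](subrKC (g v)) (le_trans (ler_normD _ _))//.
by rewrite lerD2l (le_trans (lipschitz_partial _ _ dg gM))// addrK.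
Qed.

End Calculus.

(** * Affine changes of variables *)

Section Affine.
Context {R : realType} {n : nat}.
Implicit Types f : 'cV[R]_n -> R.

Lemma differentiable_affine f (c : R) v x : differentiable f (c *: x + v) ->
  differentiable (fun x : 'cV[R]_n => f (c *: x + v)) x.
Proof.
move=> df.
have [daff _] : is_diff x ((c \*: (@id 'cV[R]_n)) + cst v) ((c \*: (@id 'cV[R]_n)) + 0).
  exact: is_diffD.
exact: (@differentiable_comp _ _ _ _ ((c \*: (@id 'cV[R]_n)) + cst v) f).
Qed.

(** The chain rule along the curve t |-> (c t) e_j + (c x + v). *)
Lemma partial_affine f c v j x : differentiable f (c *: x + v) ->
  partial j (fun x => f (c *: x + v)) x = c * partial j f (c *: x + v).
Proof.
move=> df; pose phi (t : R) := f ((c * t) *: delta_mx j 0 + 1 *: (c *: x + v)).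
have dphi : is_derive (0 : R) 1 phi (\sum_i (c * (delta_mx j 0 : 'cV[R]_n) i 0 +
    0 * (c *: x + v) i 0) * partial i f ((c * 0) *: delta_mx j 0 + 1 *: (c *: x + v))).
  apply: (@is_derive_curve _ _ f (fun t => c * t) (cst 1)).
  - by rewrite mulr0 scale0r add0r scale1r.
  - by apply: is_derive_eq; rewrite /GRing.scale /= mulr1.
have -> : partial j (fun x => f (c *: x + v)) x = 'D_1 phi 0.
  apply: (congr1 (fun u : R -> R => lim (u @ (0 : R)^'))); apply/funext => t /=.
  rewrite /phi !addr0 !mulr0 !scale0r !add0r !scale1r.
  by rewrite [t *: 1]mulr1 [c *: (_ + x)]scalerDr scalerA addrA.
rewrite derive_val (bigD1 j)//= big1 ?addr0.
  by rewrite mul0r addr0 mxE !eqxx mulr1 mulr0 scale0r add0r scale1r.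
by move=> i ij; rewrite mxE (negbTE ij) mul0r mulr0 addr0 mul0r.
Qed.

Lemma continuous_affine f (c : R) v : (forall x, differentiable f x) ->
  continuous (fun x : 'cV[R]_n => f (c *: x + v)).
Proof.
move=> df x.
apply: differentiable_continuous.
exact: differentiable_affine.
Qed.

Lemma continuous_affineZ f (a c : R) v : (forall x, differentiable f x) ->
  continuous (fun x : 'cV[R]_n => a * f (c *: x + v)).
Proof.
move=> df x.
apply: (@continuous_comp _ _ _ (fun x : 'cV[R]_n => f (c *: x + v)) ( *%R a)).
  exact: continuous_affine.
exact: mulrl_continuous.
Qed.

End Affine.

(** * Gaussian integration by parts *)

Section StandardNormal.
Context {R : realType}.
Local Notation mu := (@lebesgue_measure R).
Local Notation gam := (@normal_prob R 0 1).
Local Notation pdf := (@normal_pdf R 0 1).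

(** The Radon-Nikodym derivative of the normal law has the same integrals as its
    density, hence coincides with it almost everywhere. *)
Lemma ge0_integral_normal_prob (f : R -> \bar R) :
  measurable_fun setT f -> (forall x, 0 <= f x)%E ->
  (\int[gam]_x f x = \int[mu]_x (f x * (pdf x)%:E))%E.
Proof.
move=> mf f0; pose nu : {finite_measure set (measurableTypeR R) -> \bar R} := gam.
have numu : nu `<< mu by exact: normal_prob_dominates.
rewrite -(Radon_Nikodym_SigmaFinite.change_of_variables (nu := nu) (mu := mu))//.
have iRN := Radon_Nikodym_SigmaFinite.f_integrable numu.
have mp : measurable_fun setT (EFin \o pdf).
  by apply/measurable_EFinP; exact: measurable_normal_pdf.
apply: ae_eq_integral => //.
- by apply: emeasurable_funM => //; exact: measurable_int iRN.
- exact: emeasurable_funM.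
- apply: ae_eqe_mul2l; apply: integral_ae_eq => //.
  move=> E _ mE.
  by rewrite -(Radon_Nikodym_SigmaFinite.f_integral numu mE).
Qed.

Lemma integ_normal_prob (f : R -> R) : measurable_fun setT f ->
  mu.-integrable setT (fun x => (f x * pdf x)%:E) -> integ gam f.
Proof.
move=> mf /integrableP[_ ifp]; apply/integrableP; split.
  exact/measurable_EFinP.
rewrite ge0_integral_normal_prob//; last first.
  by apply: measurableT_comp => //; exact/measurable_EFinP.
apply: le_lt_trans ifp; rewrite le_eqVlt; apply/orP; left; apply/eqP.
apply: eq_integral => x _ /=.
by rewrite -EFinM normrM (ger0_norm (normal_pdf_ge0 _ _ _)).
Qed.

Lemma Ex_normal_prob (f : R -> R) : measurable_fun setT f ->
  mu.-integrable setT (fun x => (f x * pdf x)%:E) ->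
  Ex gam f = \int[mu]_x (f x * pdf x).
Proof.
move=> mf ifp; rewrite /Ex /Rintegral; congr fine.
have mf' : measurable_fun setT (EFin \o f) by exact/measurable_EFinP.
rewrite integralE [RHS]integralE; congr (_ - _)%E.
  rewrite ge0_integral_normal_prob//; last exact: measurable_funepos.
  by apply: eq_integral => x _; rewrite !funeposE /= EFinM maxe_pMl
    ?lee_fin ?normal_pdf_ge0// mul0e.
rewrite ge0_integral_normal_prob//; last exact: measurable_funeneg.
by apply: eq_integral => x _; rewrite !funenegE /= -mulNr EFinM maxe_pMl
  ?lee_fin ?normal_pdf_ge0// mul0e.
Qed.

(** Doubling the variance gains a factor exp (x^2 / 4), and
    1 + x^2 <= 5 (1 + x^2 / 4) <= 5 exp (x^2 / 4). *)
Lemma normal_pdf_sqr_le : exists c : R, forall x,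
  (1 + x ^+ 2) * pdf x <= c * normal_pdf 0 (Num.sqrt 2) x.
Proof.
have s2 : Num.sqrt 2 != 0 :> R by rewrite gt_eqF// sqrtr_gt0.
exists (5 * (normal_peak 1 / normal_peak (Num.sqrt 2))) => x.
rewrite !normal_pdfE ?oner_neq0//.
have a0 : 0 < normal_peak 1 :> R by rewrite normal_peak_gt0 ?oner_neq0.
have b0 : 0 < normal_peak (Num.sqrt 2) :> R by rewrite normal_peak_gt0.
rewrite mulrCA.
have -> F : 5 * (normal_peak 1 / normal_peak (Num.sqrt 2)) *
    (normal_peak (Num.sqrt 2) * F) = normal_peak 1 * (5 * F) :> R.
  by field; rewrite gt_eqF.
rewrite ler_pM2l//.
rewrite /normal_fun !subr0 sqr_sqrtr// expr1n.
set y := x ^+ 2; have y0 : 0 <= y by exact: sqr_ge0.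
have -> : - y / (1 *+ 2) = - (y / 2) by field.
have -> : - y / (2 *+ 2) = - (y / 4) by field.
have -> : - (y / 2) = - (y / 4) - (y / 4) by field.
rewrite expRD mulrA ler_wpM2r ?expR_ge0// expRN ler_pdivrMr ?expR_gt0//.
have := expR_ge1Dx (y / 4); lra.
Qed.

Lemma integrable_sqr_pdf :
  mu.-integrable setT (fun x => ((1 + x ^+ 2) * pdf x)%:E).
Proof.
have [c hc] := normal_pdf_sqr_le.
have ip : mu.-integrable setT (fun x => (c * normal_pdf 0 (Num.sqrt 2) x)%:E).
  exact: (integrableZl measurableT c (integrable_normal_pdf 0 (Num.sqrt 2))).
apply: le_integrable ip => //.
  apply/measurable_EFinP; apply: measurable_funM; last exact: measurable_normal_pdf.
  exact: measurable_funD.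
move=> x _ /=; rewrite lee_fin ger0_norm; last first.
  by rewrite mulr_ge0 ?normal_pdf_ge0// addr_ge0// sqr_ge0.
exact: le_trans (hc x) (ler_norm _).
Qed.

Lemma integ_normal_sqr : integ gam (fun x => 1 + x ^+ 2).
Proof.
apply: integ_normal_prob; first exact: measurable_funD.
exact: integrable_sqr_pdf.
Qed.

Lemma is_derive_normal_pdf (x : R) : is_derive x 1 pdf (- x * pdf x).
Proof.
rewrite normal_pdfE ?oner_neq0//.
rewrite (_ : (fun _ => _) = (fun x => normal_peak 1 * expR (- (x ^+ 2) / 2))); last first.
  by apply/funext => y; rewrite /normal_fun subr0 expr1n.
apply: is_derive_eq; rewrite /normal_fun subr0 expr1n /GRing.scale /=.
by set e := expR _; field.
Qed.

Lemma cvg_integral_centered (h : R -> R) : mu.-integrable setT (EFin \o h) ->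
  \int[mu]_(x in `[- n%:R, n%:R]) h x @[n --> \oo] --> \int[mu]_x h x.
Proof.
move=> ih.
have mh : measurable_fun setT (EFin \o h) by exact: measurable_int ih.
pose h_ n := (EFin \o h) \_ `[- (n%:R : R), n%:R].
have mh_ n : measurable_fun setT (h_ n).
  by apply/(measurable_restrictT _ _).1 => //; exact: measurable_funTS.
have hh : {ae mu, forall x, setT x -> h_ ^~ x @ \oo --> (EFin \o h) x}.
  apply: aeW => x _; apply: cvg_near_cst; near=> n.
  rewrite /h_ patchE ifT// inE /= in_itv /= -ler_norml.
  by near: n; exact: nbhs_infty_ger.
have hb : {ae mu, forall x n, setT x -> (`|h_ n x| <= (abse \o (EFin \o h)) x)%E}.
  apply: aeW => x n _; rewrite /h_ patchE; case: ifP => //= _.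
  by rewrite normr0 lee_fin.
have [_ _ hc] := @dominated_convergence _ _ _ mu setT measurableT h_ _ _ mh_ mh hh
  (integrable_abse ih) hb.
apply: fine_cvg.
rewrite fineK; last exact: integrable_fin_num.
apply: cvg_trans hc; apply: near_eq_cvg; near=> n.
by rewrite /h_ [RHS]integral_mkcond.
Unshelve. all: by end_near. Qed.

(** Integration by parts on [-n, n] with pdf' x = - x pdf x. A bounded g' lets g
    grow at most linearly, so the boundary terms are O(1/n) by
    normal_pdf_sqr_le. *)
Lemma normal_ibp (g g' : R -> R) (B : R) :
  (forall x : R, is_derive x 1 g (g' x)) -> continuous g' ->
  (forall x, `|g' x| <= B) ->
  Ex gam (fun x => x * g x) = Ex gam g'.
Proof.
move=> dg cg' g'B.
have cg : continuous g.
  by move=> x; apply: differentiable_continuous; apply/derivable1_diffP; case: (dg x).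
have mg : measurable_fun setT g by exact: continuous_measurable_fun.
have mg' : measurable_fun setT g' by exact: continuous_measurable_fun.
have mp : measurable_fun setT pdf by exact: measurable_normal_pdf.
have cp : continuous pdf by apply: continuous_normal_pdf; exact: oner_neq0.
have B0 : 0 <= B by apply: le_trans (g'B 0).
have gB x : `|g x| <= `|g 0| + B * `|x|.
  have H y z : y <= z -> `|g z - g y| <= B * (z - y).
    move=> yz; have [|c _ ->] := MVT_segment yz (f := g) (df := g').
      exact: continuous_subspaceT.
    by rewrite normrM (ger0_norm (_ : 0 <= z - y)) ?subr_ge0// ler_wpM2r// subr_ge0.
  apply: (@le_trans _ _ (`|g 0| + `|g x - g 0|)).
    by rewrite -[X in `|X| <= _](subrKC (g 0)) ler_normD.
  rewrite lerD2l.
  have [x0|x0] := leP 0 x.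
    by have := H _ _ x0; rewrite subr0 (ger0_norm x0).
  by have := H _ _ (ltW x0); rewrite distrC sub0r (ltr0_norm x0).
have sqr1 (x : R) : `|x| <= 1 + x ^+ 2.
  rewrite -(real_normK (num_real x)).
  by have := sqr_ge0 (`|x| - 1); have := normr_ge0 x; nra.
have ixg : mu.-integrable setT (fun x => (x * g x * pdf x)%:E).
  have := integrableZl measurableT (`|g 0| + B) integrable_sqr_pdf.
  apply: le_integrable => //.
    by apply/measurable_EFinP; apply: measurable_funM => //; exact: measurable_funM.
  move=> x _ /=; rewrite lee_fin; apply: le_trans (ler_norm _).
  rewrite mulrA normrM (ger0_norm (normal_pdf_ge0 _ _ _)).
  rewrite ler_wpM2r ?normal_pdf_ge0// normrM.
  apply: (le_trans (ler_wpM2l (normr_ge0 _) (gB x))).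
  have e : `|x| * `|x| = x ^+ 2 by rewrite -expr2 real_normK// num_real.
  rewrite mulrDr mulrDl lerD//.
    by rewrite mulrC ler_wpM2l.
  by rewrite mulrCA e ler_wpM2l// lerDr.
have ig' : mu.-integrable setT (fun x => (g' x * pdf x)%:E).
  have := integrableZl measurableT B (integrable_normal_pdf (0 : R) 1).
  apply: le_integrable => //.
    by apply/measurable_EFinP; exact: measurable_funM.
  move=> x _ /=; rewrite lee_fin normrM [leRHS]normrM ler_wpM2r//.
  by rewrite (le_trans (g'B x))// ler_norm.
rewrite !Ex_normal_prob//; last exact: measurable_funM.
have key n : \int[mu]_(x in `[- n.+1%:R, n.+1%:R]) (pdf x * g' x) =
   (pdf n.+1%:R * g n.+1%:R - pdf (- n.+1%:R) * g (- n.+1%:R)) -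
   \int[mu]_(x in `[- n.+1%:R, n.+1%:R]) (- x * pdf x * g x).
  apply: (@Rintegration_by_parts _ pdf g (fun x => - x * pdf x) g').
  - by rewrite (lt_trans (y := 0)) ?oppr_lt0// ltr0n.
  - apply: continuous_subspaceT => x; apply: continuousM; last exact: cp.
    by apply: continuousN; exact: cvg_id.
  - split.
    + by move=> x _; case: (is_derive_normal_pdf x).
    + by apply: cvg_at_right_filter; exact: cp.
    + by apply: cvg_at_left_filter; exact: cp.
  - by move=> x _; rewrite derive1E; case: (is_derive_normal_pdf x).
  - exact: continuous_subspaceT.
  - split.
    + by move=> x _; case: (dg x).
    + by apply: cvg_at_right_filter; exact: cg.
    + by apply: cvg_at_left_filter; exact: cg.
  - by move=> x _; rewrite derive1E; case: (dg x).
have keyE n : (pdf n.+1%:R * g n.+1%:R - pdf (- n.+1%:R) * g (- n.+1%:R)) =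
    \int[mu]_(x in `[- n.+1%:R, n.+1%:R]) (g' x * pdf x) -
    \int[mu]_(x in `[- n.+1%:R, n.+1%:R]) (x * g x * pdf x).
  have -> : \int[mu]_(x in `[- n.+1%:R, n.+1%:R]) (x * g x * pdf x) =
      - \int[mu]_(x in `[- n.+1%:R, n.+1%:R]) (- x * pdf x * g x).
    rewrite -[RHS]mulN1r -RintegralZl//.
      by apply: eq_Rintegral => x _; ring.
    apply: (@eq_integrable _ _ _ mu _ (measurable_itv _)
      (fun x => ((-1)%:E * (x * g x * pdf x)%:E)%E)).
      by move=> x _ /=; rewrite -EFinM; congr EFin; ring.
    apply: (integrableS _ _ (@subsetT _ _) (integrableZl measurableT (-1) ixg)).
      exact: measurableT.
    exact: measurable_itv.
  under eq_Rintegral do rewrite mulrC.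
  by rewrite key; ring.
have cvgab : (pdf n.+1%:R * g n.+1%:R - pdf (- n.+1%:R) * g (- n.+1%:R))
    @[n --> \oo] --> \int[mu]_x (g' x * pdf x) - \int[mu]_x (x * g x * pdf x).
  under eq_fun do rewrite keyE.
  apply: (@cvgB _ R^o).
    by have := cvg_integral_centered ig'; rewrite -cvg_shiftS.
  by have := cvg_integral_centered ixg; rewrite -cvg_shiftS.
suff cvg0 : (pdf n.+1%:R * g n.+1%:R - pdf (- n.+1%:R) * g (- n.+1%:R))
    @[n --> \oo] --> (0 : R).
  by apply/esym/eqP; rewrite -subr_eq0; apply/eqP/(cvg_unique _ cvgab cvg0).
have [c hc] := normal_pdf_sqr_le.
pose K := (`|g 0| + B) * (`|c| * normal_peak (Num.sqrt 2)) *+ 2.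
have bound x : 0 < x -> `|pdf x * g x| <= K / x /\ `|pdf (- x) * g (- x)| <= K / x.
  have H y z : 0 < y -> `|z| = y -> `|pdf z * g z| <= K / y.
    move=> y0 zy; rewrite ler_pdivlMr// normrM (ger0_norm (normal_pdf_ge0 _ _ _)).
    have z2 : z ^+ 2 = y ^+ 2 by rewrite -zy real_normK// num_real.
    have s2 : Num.sqrt 2 != 0 :> R by rewrite gt_eqF// sqrtr_gt0.
    have := hc z; rewrite z2.
    have := normal_pdf_ub 0 z s2; have := normal_pdf_ge0 0 (Num.sqrt 2) z.
    have := gB z; rewrite zy /K; have := normal_pdf_ge0 0 1 z.
    set q := pdf z; set q2 := normal_pdf _ _ z; set gz := `|g z|.
    move=> q0 gzB q20 q2ub h.
    have : (1 + y ^+ 2) * q <= `|c| * normal_peak (Num.sqrt 2).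
      apply: (le_trans h); apply: (@le_trans _ _ (`|c| * q2)).
        by rewrite ler_wpM2r// ler_norm.
      by rewrite ler_wpM2l.
    set M := `|c| * _ => hM.
    have gyB : gz * y <= (`|g 0| + B) * (1 + y ^+ 2).
      apply: (@le_trans _ _ ((`|g 0| + B * y) * y)).
        by rewrite ler_wpM2r// ltW.
      by have := normr_ge0 (g 0); have := sqr_ge0 (y - 1); nra.
    rewrite -mulrA (le_trans (ler_wpM2l q0 gyB))// mulrCA mulr2n.
    have GB0 : 0 <= `|g 0| + B by rewrite addr_ge0.
    rewrite [q * _]mulrC (le_trans (ler_wpM2l GB0 hM))// lerDl mulr_ge0//.
    by apply: le_trans hM; rewrite mulr_ge0// addr_ge0// sqr_ge0.
  by move=> x0; split; apply: H => //; rewrite ?normrN gtr0_norm.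
apply/norm_cvg0P.
apply: (@squeeze_cvgr _ _ _ _ (fun=> 0) (fun n => K *+ 2 * harmonic n)).
- apply: nearW => n; rewrite normr_ge0 /=.
  have [b1 b2] := bound n.+1%:R (ltr0Sn _ _).
  rewrite (le_trans (ler_normB _ _))// mulr2n mulrDl.
  exact: lerD.
- exact: cvg_cst.
- rewrite -[X in _ --> X](mulr0 (K *+ 2)).
  by apply: cvgMr; exact: cvg_harmonic.
Qed.

End StandardNormal.

(** * Bounded random variables *)

Section BoundedMeasurable.
Context {d : measure_display} {T : measurableType d} {R : realType}.
Implicit Types U V : T -> R.

(** Boundedness settles integrability once and for all, and it survives all the
    operations below. *)
Definition bm V := measurable_fun setT V /\ exists M, forall w, `|V w| <= M.

Lemma bm_cst c : bm (fun=> c).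
Proof. by split; [exact: measurable_cst|exists `|c|]. Qed.

Lemma bmD U V : bm U -> bm V -> bm (fun w => U w + V w).
Proof.
move=> [mU [a Ua]] [mV [b Vb]]; split; first exact: measurable_funD.
by exists (a + b) => w; rewrite (le_trans (ler_normD _ _))// lerD.
Qed.

Lemma bmM U V : bm U -> bm V -> bm (fun w => U w * V w).
Proof.
move=> [mU [a Ua]] [mV [b Vb]]; split; first exact: measurable_funM.
by exists (a * b) => w; rewrite normrM ler_pM.
Qed.

Lemma bmB U V : bm U -> bm V -> bm (fun w => U w - V w).
Proof.
move=> [mU [a Ua]] [mV [b Vb]]; split; first exact: measurable_funB.
by exists (a + b) => w; rewrite (le_trans (ler_normB _ _))// lerD.
Qed.

Lemma bm_norm V : bm V -> bm (fun w => `|V w|).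
Proof.
move=> [mV [b Vb]]; split; first exact: measurableT_comp.
by exists b => w; rewrite normr_id.
Qed.

Lemma bmX V k : bm V -> bm (fun w => V w ^+ k).
Proof.
move=> bV; elim: k => [|k ih].
  by under [X in bm X]eq_fun do rewrite expr0; exact: bm_cst.
by under [X in bm X]eq_fun do rewrite exprS; exact: bmM.
Qed.

Lemma bm_sum I (r : seq I) (Q : pred I) (F : I -> T -> R) :
  (forall i, Q i -> bm (F i)) -> bm (fun w => \sum_(i <- r | Q i) F i w).
Proof.
move=> bF; elim: r => [|a r ih].
  by under [X in bm X]eq_fun do rewrite big_nil; exact: bm_cst.
under [X in bm X]eq_fun do rewrite big_cons.
by case Qa: (Q a) => //; apply: bmD => //; exact: bF.
Qed.

Lemma bm_prod I (r : seq I) (Q : pred I) (F : I -> T -> R) :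
  (forall i, Q i -> bm (F i)) -> bm (fun w => \prod_(i <- r | Q i) F i w).
Proof.
move=> bF; elim: r => [|a r ih].
  by under [X in bm X]eq_fun do rewrite big_nil; exact: bm_cst.
under [X in bm X]eq_fun do rewrite big_cons.
by case Qa: (Q a) => //; apply: bmM => //; exact: bF.
Qed.

Lemma bm_comp_cV n (g : 'cV[R]_n -> R) (V : 'I_n -> T -> R) a b :
  continuous g -> (forall x, `|g x| <= a + b * l1 x) -> 0 <= b ->
  (forall k, bm (V k)) -> bm (fun w => g (\col_k V k w)).
Proof.
move=> cg gab b0 bV; split.
  by apply: measurable_continuous_cV => // k; case: (bV k).
have /choice[M MP] : forall k, exists M, forall w, `|V k w| <= M.
  by move=> k; case: (bV k).
exists (a + b * \sum_k M k) => w; rewrite (le_trans (gab _))// lerD2l ler_wpM2l//.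
by rewrite /l1; apply: ler_sum => k _; rewrite mxE.
Qed.

Lemma bm_comp_lipschitz n (g : 'cV[R]_n -> R) (V : 'I_n -> T -> R) M :
  (forall x, differentiable g x) -> (forall j x, `|partial j g x| <= M) ->
  (forall k, bm (V k)) -> bm (fun w => g (\col_k V k w)).
Proof.
move=> dg gM; apply: (@bm_comp_cV _ g V `|g 0| `|M|) => //.
  by move=> x; exact: differentiable_continuous.
move=> x; rewrite -[X in g X]addr0 (le_trans (growth_partial 0 x dg gM))//.
by rewrite lerD2l ler_wpM2r ?l1_ge0// ler_norm.
Qed.

Lemma bm_integ (P : probability T R) V : bm V -> integ P V.
Proof. by move=> [mV [M VM]]; exact: integ_bdd mV VM. Qed.

End BoundedMeasurable.

(** * Counting superpositions of graphs *)

Section Superposition.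
Variable N : nat.
Implicit Types (G H : {set edge N}) (e f : edge N) (u : 'I_N)
  (s : seq {set edge N}).

Definition incident u f := (u == f.1) || (u == f.2).

Definition verts G : {set 'I_N} := [set u | [exists f in G, incident u f]].

Lemma vertsP u G : reflect (exists2 f, f \in G & incident u f) (u \in verts G).
Proof.
rewrite inE; apply: (iffP existsP) => [[f /andP[fG uf]]|[f fG uf]]; exists f => //.
by rewrite fG.
Qed.

(** Connectedness is phrased with sets of edges closed under adjacency, because it
    serves to propagate a coincidence of two graphs from one edge to all. *)
Definition connected_graph G := forall H, H != finset.set0 -> H \subset G ->
  (forall f f' u, f \in H -> f' \in G -> incident u f -> incident u f' ->
     f' \in H) -> H = G.

Definition mult s f : nat := count (fun G => f \in G) s.

Definition vmult s u : nat := count (fun G => u \in verts G) s.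

Definition support s : {set 'I_N} := [set u | (0 < vmult s u)%N].

(** In the expectation of a product of monomials in independent centred
    variables, a variable that occurs exactly once makes the product vanish. *)
Definition even_cover s := forall f, mult s f != 1%N.

Lemma mult_le_vmult s f u : incident u f -> (mult s f <= vmult s u)%N.
Proof.
by move=> uf; apply: sub_count => G /= fG; apply/vertsP; exists f.
Qed.

Lemma even_cover_vmult s u : even_cover s -> u \in support s ->
  (2 <= vmult s u)%N.
Proof.
move=> cs; rewrite inE -has_count => /hasP[G Gs /vertsP[f fG uf]].
apply: leq_trans (mult_le_vmult s uf).
have : (0 < mult s f)%N by rewrite -has_count; apply/hasP; exists G.
by have := cs f; case: (mult s f) => [|[]].
Qed.

Lemma sum_vmult s : (\sum_(G <- s) #|verts G| = \sum_u vmult s u)%N.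
Proof.
elim: s => [|G s ih]; first by rewrite big_nil big1.
rewrite big_cons ih -sum1_card big_mkcond -big_split.
by apply: eq_bigr => u _; rewrite /vmult /=; case: (u \in verts G).
Qed.

(** Double counting of the incidences of the graphs with their vertices: an even
    cover meets each vertex of its support at least twice. *)
Lemma card_support s (A : {set 'I_N}) k : even_cover s ->
  (forall u, u \in A -> k + 2 <= vmult s u)%N ->
  (2 * #|support s| + k * #|A| <= \sum_(G <- s) #|verts G|)%N.
Proof.
move=> cs hA; rewrite sum_vmult mulnC [(k * _)%N]mulnC -!sum_nat_const.
rewrite big_mkcond [X in (_ + X)%N]big_mkcond -big_split.
apply: leq_sum => u _ /=; case: ifPn => us; case: ifPn => uA.
- by rewrite addnC hA.
- by rewrite addn0 even_cover_vmult.
- by move: us; rewrite inE; have := hA _ uA; rewrite -leqNgt; lia.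
- by [].
Qed.

Lemma even_cover_vmult_max s u : even_cover s ->
  (\sum_(G <- s) #|verts G| <= 2 * #|support s|)%N -> (vmult s u <= 2)%N.
Proof.
move=> cs h; rewrite leqNgt; apply/negP => u3.
have := @card_support s [set u]%SET 1 cs; rewrite cards1.
have h' : forall v, v \in [set u]%SET -> (1 + 2 <= vmult s v)%N.
  by move=> v; rewrite inE => /eqP ->.
by move=> /(_ h') h2; have := leq_trans h2 h; lia.
Qed.

Lemma incident_exists f : incident f.1 f.
Proof. by rewrite /incident eqxx. Qed.

(** At a vertex u of an edge shared by G1 and G2 the two visits that u may receive
    are used up. A further edge of G1 at u, which must be covered twice, can then
    only belong to G2. *)
Lemma rigid_pair G1 G2 (G3 G4 : {set edge N}) e :
  connected_graph G1 -> e \in G1 -> e \in G2 ->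
  even_cover [:: G1; G2; G3; G4] ->
  (forall u, vmult [:: G1; G2; G3; G4] u <= 2)%N -> G1 \subset G2.
Proof.
move=> c1 e1 e2 cs v2.
suff <- : G1 :&: G2 = G1 by exact: subsetIr.
apply: c1; [|exact: subsetIl|].
  by apply/set0Pn; exists e; rewrite inE e1.
move=> f f' u; rewrite !inE => /andP[f1 f2] f'1 uf uf'; rewrite f'1.
have u1 : u \in verts G1 by apply/vertsP; exists f.
have u2 : u \in verts G2 by apply/vertsP; exists f.
have := v2 u; rewrite /vmult /= u1 u2 => h.
have f'3 : f' \notin G3.
  apply/negP => f'3; have u3 : u \in verts G3 by apply/vertsP; exists f'.
  by move: h; rewrite u3; case: (u \in _).
have f'4 : f' \notin G4.
  apply/negP => f'4; have u4 : u \in verts G4 by apply/vertsP; exists f'.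
  by move: h; rewrite u4; case: (u \in _).
have := cs f'; rewrite /mult /= f'1 (negbTE f'3) (negbTE f'4).
by case: (f' \in G2).
Qed.

(** When no vertex is met three times, connectedness propagates the
   coincidence of the first two graphs along one shared edge. *)
Lemma rigid_quadruple G1 G2 G3 G4 e e' :
  connected_graph G1 -> connected_graph G2 ->
  connected_graph G3 -> connected_graph G4 ->
  e \in G1 -> e \in G2 -> e' \in G3 -> e' \in G4 ->
  even_cover [:: G1; G2; G3; G4] ->
  (\sum_(G <- [:: G1; G2; G3; G4]) #|verts G| <=
     2 * #|support [:: G1; G2; G3; G4]|)%N ->
  [/\ G1 = G2, G3 = G4 & forall f, f \in G1 -> f \notin G3].
Proof.
move=> c1 c2 c3 c4 e1 e2 e3 e4 cs h.
have v2 u := even_cover_vmult_max u cs h.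
have perm (s : seq {set edge N}) : perm_eq s [:: G1; G2; G3; G4] ->
    even_cover s /\ forall u, (vmult s u <= 2)%N.
  move=> sp; split => [f|u]; first by rewrite /mult (permP sp); exact: cs.
  by rewrite /vmult (permP sp); exact: v2.
have p21 : perm_eq [:: G2; G1; G3; G4] [:: G1; G2; G3; G4].
  by rewrite (perm_catCA [:: G2] [:: G1]).
have p34 : perm_eq [:: G3; G4; G1; G2] [:: G1; G2; G3; G4].
  by rewrite (perm_catC [:: G3; G4]).
have p43 : perm_eq [:: G4; G3; G1; G2] [:: G1; G2; G3; G4].
  by apply: perm_trans p34; rewrite (perm_catCA [:: G4] [:: G3]).
have E12 : G1 = G2.
  apply/eqP; rewrite finset.eqEsubset (rigid_pair c1 e1 e2 cs v2).
  by have [cs' v2'] := perm _ p21; rewrite (rigid_pair c2 e2 e1 cs' v2').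
have E34 : G3 = G4.
  apply/eqP; rewrite finset.eqEsubset.
  have [cs' v2'] := perm _ p34; rewrite (rigid_pair c3 e3 e4 cs' v2').
  by have [cs'' v2''] := perm _ p43; rewrite (rigid_pair c4 e4 e3 cs'' v2'').
split => // f f1; apply/negP => f3.
have := v2 f.1; rewrite /vmult /= -E12 -E34.
have -> : f.1 \in verts G1 by apply/vertsP; exists f => //; exact: incident_exists.
by have -> : f.1 \in verts G3 by apply/vertsP; exists f => //; exact: incident_exists.
Qed.

Lemma card_small_subsets v : (0 < N)%N ->
  (#|[set U : {set 'I_N} | (#|U| <= v)%N]%SET| <= v.+1 * N ^ v)%N.
Proof.
move=> N0.
apply: (@leq_trans (\sum_(k < v.+1) #|[set U : {set 'I_N} | #|U| == k]%SET|)%N).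
  rewrite -sum1_card (eq_bigl (fun U : {set 'I_N} => (#|U| <= v)%N)); last first.
    by move=> U; rewrite inE.
  rewrite (partition_big (fun U : {set 'I_N} => inord #|U| : 'I_v.+1) predT)//=.
  apply: leq_sum => k _; rewrite -sum1_card.
  rewrite [X in (X <= _)%N]big_mkcond [X in (_ <= X)%N]big_mkcond.
  apply: leq_sum => U _; rewrite inE; case: ifPn => // /andP[Uv /eqP <-].
  by rewrite inordK ?ltnS ?eqxx.
rewrite -[v.+1 in leqRHS]card_ord -sum_nat_const.
apply: leq_sum => k _; rewrite card_draws card_ord.
apply: (@leq_trans (N ^ k)%N); last by rewrite leq_pexp2l// -ltnS.
have [kN|kN] := leqP k N; last by rewrite bin_small.
apply: (@leq_trans (N ^_ k)%N).
  by rewrite -bin_ffact leq_pmulr// fact_gt0.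
elim: (k : nat) => // j ih; rewrite ffactnSr expnSr; apply: leq_mul => //.
exact: leq_subr.
Qed.

(** Choose the support first: there are O(N^v) of them, and then each graph is one of
    boundedly many sets of pairs of vertices of the support. *)
Lemma card_superpositions r v : (0 < N)%N ->
  (#|[set q : {ffun 'I_r -> {set edge N}} |
       (#|support (codom q)| <= v)%N]%SET| <=
   v.+1 * (2 ^ (v * v)) ^ r * N ^ v)%N.
Proof.
move=> N0; pose inside (U : {set 'I_N}) : {set {set edge N}} := powerset (finset.setX U U).
pose fam U := [set q : {ffun 'I_r -> {set edge N}} | q \in ffun_on (mem (inside U))]%SET.
pose small := [set U : {set 'I_N} | (#|U| <= v)%N]%SET.
apply: (@leq_trans #|(\bigcup_(U in small) fam U)%SET|).
  apply: subset_leq_card; apply/fintype.subsetP => q; rewrite inE => qv.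
  apply/bigcupP; exists (support (codom q)); first by rewrite inE.
  rewrite inE; apply/ffun_onP => k; rewrite powersetE; apply/fintype.subsetP => f fq.
  have inc u : incident u f -> u \in support (codom q).
    move=> uf; rewrite inE -has_count; apply/hasP; exists (q k).
      exact: codom_f.
    by apply/vertsP; exists f.
  by rewrite inE !inc// /incident eqxx ?orbT.
apply: (@leq_trans (\sum_(U in small) #|fam U|)).
  have := @leq_card_setU; elim/big_rec2: _ => [|U m A _ ih]; first by rewrite cards0.
  by move=> h; apply: (leq_trans (h _ _ _)); rewrite leq_add2l ih.
apply: (@leq_trans (\sum_(U in small) (2 ^ (v * v)) ^ r)%N).
  apply: leq_sum => U; rewrite inE => Uv.
  rewrite cardsE card_ffun_on card_ord.
  have -> : #|mem (inside U)| = (2 ^ (#|U| * #|U|))%N.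
    by rewrite -cardsX -card_powerset.
  elim: (r) => // j ih; rewrite !expnS; apply: leq_mul => //.
  by rewrite leq_exp2l// leq_mul.
rewrite sum_nat_const mulnC [leqRHS]mulnAC [leqRHS]mulnC leq_mul2l.
by rewrite card_small_subsets// orbT.
Qed.

End Superposition.

(** * Moments of sums of graph monomials *)

Section GraphMoments.
Context {d : measure_display} {T : measurableType d} {R : realType}.
Variables (P : probability T R) (N : nat) (x : edge N -> T -> R) (K : R).
Hypothesis N_gt0 : (0 < N)%N.
Hypothesis x_bm : forall f, bm (x f).
Hypothesis x_prod : forall k : edge N -> nat,
  (forall f, ~~ is_edge f -> k f = 0%N) ->
  Ex P (fun w => \prod_f x f w ^+ k f) = \prod_f Ex P (fun w => x f w ^+ k f).
Hypothesis x_mean : forall f, is_edge f -> Ex P (x f) = 0.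
Hypothesis K_ge1 : 1 <= K.
Hypothesis x_moment : forall f k, is_edge f -> (k <= 4)%N ->
  `|Ex P (fun w => x f w ^+ k)| <= K.

Implicit Types (G : {set edge N}) (s : seq {set edge N}) (e f : edge N).

Definition monomial G w : R := \prod_(f in G) x f w.

Definition monomials s w : R := \prod_(G <- s) monomial G w.

Definition only_edges s := forall G f, G \in s -> f \in G -> is_edge f.

Lemma integ_monomials s : integ P (monomials s).
Proof. by apply: bm_integ; apply: bm_prod => G _; exact: bm_prod. Qed.

Lemma monomialsE s w : monomials s w = \prod_f x f w ^+ mult s f.
Proof.
elim: s => [|G s ih]; first by rewrite /monomials big_nil big1.
rewrite /monomials big_cons -/(monomials s w) ih /monomial.
rewrite [X in X * _]big_mkcond -big_split; apply: eq_bigr => f _ /=.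
by rewrite /mult /=; case: (f \in G); rewrite ?mul1r// exprS.
Qed.

Lemma monomials_cat s1 s2 w : monomials (s1 ++ s2) w = monomials s1 w * monomials s2 w.
Proof. by rewrite /monomials big_cat. Qed.

Lemma mult_only_edges s : only_edges s ->
  forall f, ~~ is_edge f -> mult s f = 0%N.
Proof.
move=> es f nf; apply/eqP; rewrite -leqn0 leqNgt -has_count.
by apply/negP => /hasP[G Gs /(es _ _ Gs)]; rewrite (negbTE nf).
Qed.

Lemma Ex_monomials s : only_edges s ->
  Ex P (monomials s) = \prod_f Ex P (fun w => x f w ^+ mult s f).
Proof.
move=> es; rewrite -x_prod; last exact: mult_only_edges.
by congr Ex; apply/funext => w; rewrite monomialsE.
Qed.

Lemma Ex_monomials_eq0 s f : only_edges s -> mult s f = 1%N ->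
  Ex P (monomials s) = 0.
Proof.
move=> es sf; rewrite Ex_monomials// (bigD1 f)//= sf.
have ef : is_edge f.
  by apply/negPn/negP => /(mult_only_edges es); rewrite sf.
by under [X in Ex P X]eq_fun do rewrite expr1; rewrite x_mean// mul0r.
Qed.

Lemma sum_mult s : (\sum_f mult s f = \sum_(G <- s) #|G|)%N.
Proof.
elim: s => [|G s ih]; first by rewrite big_nil big1.
rewrite big_cons -ih -sum1_card [X in (X + _)%N]big_mkcond -big_split.
by apply: eq_bigr => f _ /=; case: (f \in G).
Qed.

Lemma Ex_monomials_bound s L : only_edges s -> (size s <= 4)%N ->
  (\sum_(G <- s) #|G| <= L)%N -> `|Ex P (monomials s)| <= K ^+ L.
Proof.
move=> es s4 sL; rewrite Ex_monomials// normr_prod.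
apply: (@le_trans _ _ (\prod_f K ^+ mult s f)).
  apply: ler_prod => f _; rewrite normr_ge0 /=.
  have [ef|nf] := boolP (is_edge f); last first.
    rewrite (mult_only_edges es nf).
    by under [X in Ex P X]eq_fun do rewrite expr0; rewrite Ex_cst normr1 expr0.
  have : (mult s f <= 4)%N by apply: leq_trans s4; exact: count_size.
  case: (mult s f) => [_|k k4].
    by under [X in Ex P X]eq_fun do rewrite expr0; rewrite Ex_cst normr1 expr0.
  by rewrite (le_trans (x_moment ef k4))// ler_eXnr.
by rewrite prodrXr sum_mult ler_weXn2l.
Qed.

Lemma Ex_monomials_disjoint s1 s2 : only_edges s1 -> only_edges s2 ->
  (forall f, mult s1 f = 0%N \/ mult s2 f = 0%N) ->
  Ex P (monomials (s1 ++ s2)) = Ex P (monomials s1) * Ex P (monomials s2).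
Proof.
move=> e1 e2 dis; rewrite !Ex_monomials//; last first.
  by move=> G f; rewrite mem_cat => /orP[]; [exact: e1|exact: e2].
rewrite -big_split; apply: eq_bigr => f _ /=.
have E0 : Ex P (fun w => x f w ^+ 0) = 1.
  by under [X in Ex P X]eq_fun do rewrite expr0; rewrite Ex_cst.
rewrite /mult count_cat -/(mult s1 f) -/(mult s2 f).
by case: (dis f) => ->; rewrite E0 ?mul1r ?mulr1 ?addn0.
Qed.

(** The index set of the expansion of the product of two stars: two graphs
    together with a common edge, which is the one that unpin removes. *)
Definition pinned (F1 F2 : {set {set edge N}})
    (a : edge N * ({set edge N} * {set edge N})) : bool :=
  [&& a.2.1 \in F1, a.2.2 \in F2, a.1 \in a.2.1 & a.1 \in a.2.2].

Definition unpin (a : edge N * ({set edge N} * {set edge N})) : seq {set edge N} :=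
  [:: (a.2.1 :\ a.1)%SET; (a.2.2 :\ a.1)%SET].

Definition four (a b : edge N * ({set edge N} * {set edge N})) :
  seq {set edge N} := [:: a.2.1; a.2.2; b.2.1; b.2.2].

(** As monomials are multilinear, this is the derivative with respect to x e of the
    sum of the monomials of F. *)
Definition star (F : {set {set edge N}}) e w : R :=
  \sum_(G in F | e \in G) monomial (G :\ e)%SET w.

Definition pinned_sum F1 F2 w : R := \sum_e star F1 e w * star F2 e w.

Lemma starM F1 F2 e w : star F1 e w * star F2 e w =
  \sum_(a | pinned F1 F2 a && (a.1 == e)) monomials (unpin a) w.
Proof.
rewrite /star big_distrlr /= pair_big_dep /=.
rewrite [RHS](reindex_onto (fun p => (e, p)) snd) /=; last first.
  by move=> [e' p] /= /andP[_ /eqP ->].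
apply: eq_big => [[G1 G2]|[G1 G2] _] /=; last first.
  by rewrite /monomials !big_cons big_nil mulr1.
by rewrite /pinned /= !eqxx !andbT; case: (G1 \in F1); case: (G2 \in F2); case: (e \in G1).
Qed.

Lemma pinned_sumE F1 F2 w :
  pinned_sum F1 F2 w = \sum_(a | pinned F1 F2 a) monomials (unpin a) w.
Proof.
rewrite [RHS](partition_big fst predT)//=.
by apply: eq_bigr => e _; rewrite starM.
Qed.

(** The exponent 6 accounts for the six edge sets of card_pinned_pairs. *)
Definition count_constant v : nat := (v.+1 * (2 ^ (v * v)) ^ 6)%N.

(** Two pinned pairs are coded by four graphs and two singletons, the pinning
    edges; the latter add no vertex to the support. *)
Lemma card_pinned_pairs F1 F2 v :
  (#|[set ab | [&& pinned F1 F2 ab.1, pinned F1 F2 ab.2 &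
      (#|support (four ab.1 ab.2)| <= v)%N]]%SET| <= count_constant v * N ^ v)%N.
Proof.
apply: leq_trans (card_superpositions 6 v N_gt0).
pose code (ab : (edge N * ({set edge N} * {set edge N})) *
    (edge N * ({set edge N} * {set edge N}))) : {ffun 'I_6 -> {set edge N}} :=
  [ffun k : 'I_6 => nth finset.set0 [:: [set ab.1.1]%SET; [set ab.2.1]%SET;
     ab.1.2.1; ab.1.2.2; ab.2.2.1; ab.2.2.2] k].
have code_inj : injective code.
  move=> [[e [G1 G2]] [e' [G3 G4]]] [[c [H1 H2]] [c' [H3 H4]]] /ffunP E.
  have := E (inord 0); have := E (inord 1); have := E (inord 2).
  have := E (inord 3); have := E (inord 4); have := E (inord 5).
  rewrite !ffunE !inordK//= => -> -> -> -> /finset.set1_inj -> /finset.set1_inj ->.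
  by [].
rewrite -(card_imset _ code_inj); apply: subset_leq_card.
apply/fintype.subsetP => q /imsetP[[a b]]; rewrite inE /= => /and3P[pa pb sv] ->.
rewrite inE; apply: leq_trans sv; apply: subset_leq_card.
apply/fintype.subsetP => u; rewrite !inE -!has_count => /hasP[G /codomP[k ->]].
rewrite ffunE; move: pa pb => /and4P[_ _ a1 _] /and4P[_ _ b1 _].
have sing f (G' : {set edge N}) : f \in G' -> u \in verts [set f]%SET -> u \in verts G'.
  move=> fG /vertsP[f']; rewrite inE => /eqP -> uf.
  by apply/vertsP; exists f.
case: k => -[|[|[|[|[|[|//]]]]]] /= _.
- by move=> /(sing _ _ a1) ->.
- by move=> /(sing _ _ b1) ->; rewrite !orbT.
- by move=> ->.
- by move=> ->; rewrite !orbT.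
- by move=> ->; rewrite !orbT.
- by move=> ->; rewrite !orbT.
Qed.

Definition graph_family (F : {set {set edge N}}) n l := forall G, G \in F ->
  [/\ #|verts G| = n, #|G| = l, forall f, f \in G -> is_edge f &
      connected_graph G].

Lemma only_edges_unpin F1 F2 n1 l1 n2 l2 a :
  graph_family F1 n1 l1 -> graph_family F2 n2 l2 -> pinned F1 F2 a ->
  only_edges (unpin a).
Proof.
move=> f1 f2 /and4P[/f1[_ _ e1 _] /f2[_ _ e2 _] _ _] G f.
rewrite !inE => /orP[] /eqP ->; rewrite inE => /andP[_]; [exact: e1|exact: e2].
Qed.

Lemma only_edges_cat s1 s2 : only_edges s1 -> only_edges s2 ->
  only_edges (s1 ++ s2).
Proof. by move=> e1 e2 G f; rewrite mem_cat => /orP[]; [exact: e1|exact: e2]. Qed.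

Lemma size_unpin F1 F2 n1 l1 n2 l2 a :
  graph_family F1 n1 l1 -> graph_family F2 n2 l2 -> pinned F1 F2 a ->
  (\sum_(G <- unpin a) #|G| <= l1 + l2)%N.
Proof.
move=> f1 f2 /and4P[/f1[_ <- _ _] /f2[_ <- _ _] _ _].
rewrite /unpin !big_cons big_nil addn0.
by apply: leq_add; apply: subset_leq_card; exact: subsetDl.
Qed.

(** A graph edge covered only once survives the removal of the pinning edges,
    because these are covered at least twice. *)
Lemma mult_unpin F1 F2 a b f : pinned F1 F2 a -> pinned F1 F2 b ->
  mult (four a b) f = 1%N -> mult (unpin a ++ unpin b) f = 1%N.
Proof.
move=> /and4P[_ _ a1 a2] /and4P[_ _ b1 b2]; rewrite /four /mult /= !inE.
have [->|fa] := eqVneq f a.1.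
  by rewrite a1 a2; case: (a.1 \in b.2.1); case: (a.1 \in b.2.2).
have [->|fb] := eqVneq f b.1; last by rewrite /=.
by rewrite b1 b2; case: (b.1 \in a.2.1); case: (b.1 \in a.2.2).
Qed.

Lemma sum_verts_four F1 F2 n1 l1 n2 l2 a b :
  graph_family F1 n1 l1 -> graph_family F2 n2 l2 ->
  pinned F1 F2 a -> pinned F1 F2 b ->
  (\sum_(G <- four a b) #|verts G| = 2 * (n1 + n2))%N.
Proof.
move=> f1 f2 /and4P[/f1[v1 _ _ _] /f2[v2 _ _ _] _ _].
move=> /and4P[/f1[v3 _ _ _] /f2[v4 _ _ _] _ _].
by rewrite /four !big_cons big_nil v1 v2 v3 v4; lia.
Qed.

Lemma even_cover_four F1 F2 n1 l1 n2 l2 a b :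
  graph_family F1 n1 l1 -> graph_family F2 n2 l2 ->
  pinned F1 F2 a -> pinned F1 F2 b ->
  Ex P (monomials (unpin a ++ unpin b)) != 0 \/
  Ex P (monomials (unpin a)) * Ex P (monomials (unpin b)) != 0 ->
  even_cover (four a b).
Proof.
move=> f1 f2 pa pb h f; apply/negP => /eqP f4.
have ea := only_edges_unpin f1 f2 pa; have eb := only_edges_unpin f1 f2 pb.
have m1 := mult_unpin pa pb f4.
case: h; first by rewrite (Ex_monomials_eq0 _ m1) ?eqxx//; exact: only_edges_cat.
move: m1; rewrite /mult count_cat -/(mult _ _) -/(mult (unpin b) _).
case E: (mult (unpin a) f) => [|[|//]] E'; last first.
  by rewrite (Ex_monomials_eq0 ea E) mul0r eqxx.
by rewrite (Ex_monomials_eq0 eb (f := f))// mulr0 eqxx.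
Qed.

Definition unpin_cov a b := Ex P (monomials (unpin a ++ unpin b)) -
  Ex P (monomials (unpin a)) * Ex P (monomials (unpin b)).

(** A nonzero covariance requires an even cover, hence at most n1 + n2 vertices.
    With exactly n1 + n2 of them, rigidity makes a and b edge-disjoint, so that
    their monomials are independent and the covariance vanishes: one vertex is
    lost. *)
Lemma unpin_cov_support F1 F2 n1 l1 n2 l2 a b :
  graph_family F1 n1 l1 -> graph_family F2 n2 l2 ->
  pinned F1 F2 a -> pinned F1 F2 b -> unpin_cov a b != 0 ->
  (#|support (four a b)| <= (n1 + n2).-1)%N.
Proof.
move=> f1 f2 pa pb cov0.
have ce : even_cover (four a b).
  apply: (even_cover_four f1 f2 pa pb).
  have [E|] := eqVneq (Ex P (monomials (unpin a ++ unpin b))) 0; last by left.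
  right; apply: contra cov0 => /eqP E'; by rewrite /unpin_cov E E' subrr.
have S := sum_verts_four f1 f2 pa pb.
suff : (2 * #|support (four a b)| < 2 * (n1 + n2))%N by lia.
rewrite ltnNge; apply/negP => h.
have [/f1[_ _ _ c1] /f2[_ _ _ c2] a1 a2] := and4P pa.
have [/f1[_ _ _ c3] /f2[_ _ _ c4] b1 b2] := and4P pb.
have [|E12 E34 dis] := rigid_quadruple c1 c2 c3 c4 a1 a2 b1 b2 ce.
  by rewrite -/(four a b) S.
move: cov0; rewrite /unpin_cov Ex_monomials_disjoint ?subrr ?eqxx//.
- exact: only_edges_unpin f1 f2 pa.
- exact: only_edges_unpin f1 f2 pb.
- move=> f; rewrite /mult /= !inE -E12 -E34.
  have [fa|fa] := boolP (f \in a.2.1); last by left; rewrite !andbF.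
  by right; rewrite (negbTE (dis _ fa)) !andbF.
Qed.

Lemma unpin_cov_bound F1 F2 n1 l1 n2 l2 a b :
  graph_family F1 n1 l1 -> graph_family F2 n2 l2 ->
  pinned F1 F2 a -> pinned F1 F2 b ->
  `|unpin_cov a b| <= K ^+ (2 * (l1 + l2)) *+ 2.
Proof.
move=> f1 f2 pa pb.
have ea := only_edges_unpin f1 f2 pa; have eb := only_edges_unpin f1 f2 pb.
have sa := size_unpin f1 f2 pa; have sb := size_unpin f1 f2 pb.
rewrite (le_trans (ler_normB _ _))// mulr2n lerD//.
  apply: Ex_monomials_bound => //; first exact: only_edges_cat.
  by rewrite big_cat /= mul2n -addnn leq_add.
rewrite normrM mul2n -addnn exprD; apply: ler_pM => //; exact: Ex_monomials_bound.
Qed.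

Lemma integ_pinned_sum F1 F2 : integ P (pinned_sum F1 F2).
Proof.
rewrite (_ : pinned_sum F1 F2 = fun w => \sum_(a | pinned F1 F2 a) monomials (unpin a) w).
  by apply: integ_sum => a; exact: integ_monomials.
by apply/funext => w; exact: pinned_sumE.
Qed.

(** The variance is a sum of covariances over pairs of pinned pairs, and only
    O(N^(n1 + n2 - 1)) of them are nonzero. *)
Lemma variance_pinned_sum F1 F2 n1 l1 n2 l2 :
  graph_family F1 n1 l1 -> graph_family F2 n2 l2 ->
  Ex P (fun w => (pinned_sum F1 F2 w - Ex P (pinned_sum F1 F2)) ^+ 2) <=
  K ^+ (2 * (l1 + l2)) *+ 2 *
  (count_constant (n1 + n2).-1 * N ^ (n1 + n2).-1)%:R.
Proof.
move=> f1 f2.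
have im a : integ P (monomials (unpin a)) by exact: integ_monomials.
pose cm a w := monomials (unpin a) w - Ex P (monomials (unpin a)).
have imm a b : integ P (fun w => monomials (unpin a) w * monomials (unpin b) w).
  under [X in integ P X]eq_fun do rewrite -monomials_cat.
  exact: integ_monomials.
have cmE a b w : cm a w * cm b w =
    monomials (unpin a ++ unpin b) w
    - Ex P (monomials (unpin b)) * monomials (unpin a) w
    - Ex P (monomials (unpin a)) * monomials (unpin b) w
    + Ex P (monomials (unpin a)) * Ex P (monomials (unpin b)).
  by rewrite /cm monomials_cat; ring.
have icm a b : integ P (fun w => cm a w * cm b w).
  under [X in integ P X]eq_fun do rewrite cmE.
  apply: integD; last exact: integ_cst.
  apply: integB; last exact: integZ.
  by apply: integB; [exact: integ_monomials|exact: integZ].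
have Ecm a b : Ex P (fun w => cm a w * cm b w) = unpin_cov a b.
  rewrite /unpin_cov (funext (cmE a b)).
  rewrite ExD ?Ex_cst; last 2 first.
    apply: integB; last exact: integZ.
    by apply: integB; [exact: integ_monomials|exact: integZ].
    exact: integ_cst.
  rewrite ExB; last 2 first.
    by apply: integB; [exact: integ_monomials|exact: integZ].
    exact: integZ.
  rewrite ExB; last 2 first.
    exact: integ_monomials.
    exact: integZ.
  by rewrite !ExZ//; ring.
have -> : (fun w => (pinned_sum F1 F2 w - Ex P (pinned_sum F1 F2)) ^+ 2) =
    (fun w => \sum_(a | pinned F1 F2 a) \sum_(b | pinned F1 F2 b) cm a w * cm b w).
  apply/funext => w; rewrite -big_distrlr /= -expr2; congr (_ ^+ 2).
  rewrite sumrB pinned_sumE -Ex_sum//; congr (_ - Ex P _).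
  by apply/funext => w'; exact: pinned_sumE.
rewrite Ex_sum; last by move=> a; apply: integ_sum => b.
have -> : \sum_(a | pinned F1 F2 a)
     Ex P (fun w => \sum_(b | pinned F1 F2 b) cm a w * cm b w) =
   \sum_(a | pinned F1 F2 a) \sum_(b | pinned F1 F2 b) unpin_cov a b.
  apply: eq_bigr => a _; rewrite Ex_sum//; exact: eq_bigr.
rewrite pair_big_dep /=.
apply: (@le_trans _ _ (\sum_(ab | [&& pinned F1 F2 ab.1, pinned F1 F2 ab.2 &
      (#|support (four ab.1 ab.2)| <= (n1 + n2).-1)%N]) K ^+ (2 * (l1 + l2)) *+ 2)).
  rewrite (bigID (fun ab => (#|support (four ab.1 ab.2)| <= (n1 + n2).-1)%N)) /=.
  rewrite [X in _ + X]big1 ?addr0; last first.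
    move=> [a b] /= /andP[/andP[pa pb] h]; apply/eqP/negPn/negP => c0.
    by move: h; rewrite (unpin_cov_support f1 f2 pa pb c0).
  under eq_bigl do rewrite -andbA.
  apply: ler_sum => -[a b] /= /and3P[pa pb _].
  exact: le_trans (ler_norm _) (unpin_cov_bound f1 f2 pa pb).
rewrite sumr_const -[leLHS]mulr_natr ler_wpM2l//.
  by rewrite mulrn_wge0// exprn_ge0// (le_trans ler01).
rewrite ler_nat; apply: leq_trans (card_pinned_pairs F1 F2 _).
by rewrite cardsE.
Qed.

(** The four graphs of an even cover all contain both endpoints of e, two visits
    more than necessary at two vertices: this lowers the size of the support from
    2n to 2n - 2. *)
Lemma fourth_moment_star F n l : graph_family F n l ->
  \sum_e Ex P (fun w => star F e w ^+ 4) <=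
  K ^+ (2 * (l + l)) * (count_constant (2 * n - 2) * N ^ (2 * n - 2))%:R.
Proof.
move=> fF.
have E4 e : Ex P (fun w => star F e w ^+ 4) =
    \sum_(a | pinned F F a && (a.1 == e)) \sum_(b | pinned F F b && (b.1 == e))
       Ex P (monomials (unpin a ++ unpin b)).
  rewrite (_ : (fun w => _) = fun w =>
    \sum_(a | pinned F F a && (a.1 == e)) \sum_(b | pinned F F b && (b.1 == e))
       monomials (unpin a ++ unpin b) w); last first.
    apply/funext => w; rewrite (_ : 4 = 2 + 2)%N// exprD expr2 starM big_distrlr /=.
    by apply: eq_bigr => a _; apply: eq_bigr => b _; exact/esym/(monomials_cat (unpin a) (unpin b)).
  rewrite Ex_sum; last by move=> a; apply: integ_sum => b; exact: integ_monomials.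
  by apply: eq_bigr => a _; rewrite Ex_sum// => b; exact: integ_monomials.
have -> : \sum_e Ex P (fun w => star F e w ^+ 4) =
   \sum_(ab | [&& pinned F F ab.1, pinned F F ab.2 & ab.1.1 == ab.2.1])
      Ex P (monomials (unpin ab.1 ++ unpin ab.2)).
  rewrite [RHS](partition_big (fun ab => ab.1.1) predT)//=.
  apply: eq_bigr => e _; rewrite E4 pair_big_dep /=.
  apply: eq_bigl => -[a b] /=; case: (pinned F F a); case: (pinned F F b) => //=.
    by have [->|] := eqVneq a.1 e; rewrite ?andbT ?andbF// eq_sym.
  by rewrite andbF.
apply: (@le_trans _ _ (\sum_(ab | [&& pinned F F ab.1, pinned F F ab.2 &
      (#|support (four ab.1 ab.2)| <= 2 * n - 2)%N]) K ^+ (2 * (l + l)))).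
  rewrite [leRHS]big_mkcond [leLHS]big_mkcond; apply: ler_sum => -[a b] _ /=.
  case: ifPn => [/and3P[pa pb /eqP ab]|_]; last first.
    by case: ifP => // _; rewrite exprn_ge0// (le_trans ler01).
  rewrite pa pb /=.
  have ea := only_edges_unpin fF fF pa; have eb := only_edges_unpin fF fF pb.
  have sa := size_unpin fF fF pa; have sb := size_unpin fF fF pb.
  have bnd : `|Ex P (monomials (unpin a ++ unpin b))| <= K ^+ (2 * (l + l)).
    apply: Ex_monomials_bound => //; first exact: only_edges_cat.
    by rewrite big_cat /= mul2n -addnn leq_add.
  case: ifPn => [_|h]; first exact: le_trans (ler_norm _) bnd.
  rewrite le_eqVlt; apply/orP; left; apply/negPn/negP => E0.
  have ce : even_cover (four a b) by apply: (even_cover_four fF fF pa pb); left.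
  have [/fF[_ _ g1 _] _ a1 a2] := and4P pa; have [_ _ b1 b2] := and4P pb.
  have := @card_support _ (four a b) [set a.1.1; a.1.2]%SET 2 ce.
  have ne : a.1.1 != a.1.2.
    by have := g1 _ a1; rewrite /is_edge ltn_neqAle => /andP[].
  have pin u : u \in [set a.1.1; a.1.2]%SET -> (2 + 2 <= vmult (four a b) u)%N.
    rewrite !inE => ua; have ui : incident u a.1 by rewrite /incident.
    apply: leq_trans (mult_le_vmult _ ui).
    by rewrite /mult /= a1 a2 ab b1 b2.
  rewrite cards2 ne => /(_ pin).
  rewrite (sum_verts_four fF fF pa pb) /=.
  by move: h; rewrite -ltnNge; move: #|_| => S; clear; lia.
rewrite sumr_const -[leLHS]mulr_natr ler_wpM2l//.
  by rewrite exprn_ge0// (le_trans ler01).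
rewrite ler_nat; apply: leq_trans (card_pinned_pairs F F _).
by rewrite cardsE.
Qed.

End GraphMoments.

(** * Leave-one-out expansion *)

(** The statistic W i is a sum over e of products of y i e, which depends on the
    coordinate X e alone, and s i e, which depends on the other coordinates; l i
    is the multiplicity with which that sum counts W i. The statistics U e are
    what remains of W when the contribution of X e is removed. *)

Section LeaveOneOut.
Context {d : measure_display} {T : measurableType d} {R : realType}.
Variables (P : probability T R) (E : finType) (n : nat).
Variables (others : E -> set (set T)) (X : E -> T -> R) (psi : 'I_n -> R -> R).
Variables (s : 'I_n -> E -> T -> R) (W : 'I_n -> T -> R) (l : 'I_n -> nat).

Let To e := g_sigma_algebraType (others e).
Let y i e w := psi i (X e w).
Let U e i w := W i w - y i e w * s i e w.
Let Wv w : 'cV[R]_n := \col_k W k w.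
Let Uv e w : 'cV[R]_n := \col_k U e k w.

Hypothesis others_measurable : forall e, others e `<=` measurable.
Hypothesis X_measurable : forall e, measurable_fun setT (X e).
Hypothesis X_indep : forall e (u : R -> R) (V : To e -> R),
  bm u -> bm V -> Ex P (fun w => u (X e w) * V w) =
  Ex P (fun w => u (X e w)) * Ex P (V : T -> R).
Hypothesis psi_bm : forall i, bm (psi i).
(** The first alternative allows for indices e that contribute nothing, whatever
    the mean of y i e. *)
Hypothesis psi_mean : forall i e, s i e = cst 0 \/ Ex P (y i e) = 0.
Hypothesis s_bm : forall i e, bm (s i e : To e -> R).
Hypothesis U_bm : forall i e, bm (U e i : To e -> R).
Hypothesis l_gt0 : forall i, (0 < l i)%N.
Hypothesis W_bm : forall i, bm (W i).
Hypothesis W_decomp : forall i w, (l i)%:R * W i w = \sum_e y i e w * s i e w.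

Let bm_others e (V : T -> R) : bm (V : To e -> R) -> bm V.
Proof.
move=> [mV VM]; split => // _ A mA; rewrite setTI.
have := mV measurableT A mA; rewrite setTI.
exact: (smallest_sub (@sigma_algebra_measurable _ T) (@others_measurable e)).
Qed.

Let y_bm i e : bm (y i e).
Proof.
have [mp [M pM]] := psi_bm i; split; first exact: measurableT_comp.
by exists M => w; exact: pM.
Qed.

Definition tau i j e : R := Ex P (fun w => y i e w * y j e w).

(** The covariance of W i and W j obtained by averaging, for each e in turn, over
    the coordinate X e only. *)
Definition local_cov i j w : R := \sum_e tau i j e * (s i e w * s j e w).

Let s_bmT i e : bm (s i e : T -> R). Proof. exact: (bm_others (s_bm i e)). Qed.

Let mean0 i e (V : To e -> R) : bm V ->
  Ex P (fun w => y i e w * (s i e w * V w)) = 0.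
Proof.
move=> bV; have [s0|y0] := psi_mean i e.
  rewrite -[RHS](Ex_cst P 0); congr Ex; apply/funext => w.
  by rewrite s0 mul0r mulr0.
have := X_indep (psi_bm i) (bmM (s_bm i e) bV).
by rewrite [X in _ = X * _]y0 mul0r.
Qed.

Let pair_indep i j e (V : To e -> R) : bm V ->
  Ex P (fun w => y i e w * y j e w * V w) = tau i j e * Ex P (V : T -> R).
Proof. by move=> bV; exact: (X_indep (bmM (psi_bm i) (psi_bm j)) bV). Qed.

Lemma mean_leave_one_out i : Ex P (W i) = 0.
Proof.
have l0 : (l i)%:R != 0 :> R by rewrite pnatr_eq0 -lt0n.
apply: (mulfI l0); rewrite mulr0 -ExZ; last exact: bm_integ.
transitivity (Ex P (fun w => \sum_e y i e w * (s i e w * 1))).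
  congr Ex; apply/funext => w; rewrite W_decomp.
  by apply: eq_bigr => e _; rewrite mulr1.
rewrite Ex_sum; last first.
  by move=> e; apply: bm_integ; apply: bmM => //; apply: bmM => //; exact: bm_cst.
by rewrite big1// => e _; apply: mean0; exact: bm_cst.
Qed.

(** In each term split W j as U e j plus the contribution of X e: the first part is
    annihilated by the centring of y i e, the second one factorises. *)
Lemma covariance_leave_one_out i j :
  (l i)%:R * Ex P (fun w => W i w * W j w) = Ex P (local_cov i j).
Proof.
rewrite -ExZ; last by apply: bm_integ; exact: bmM.
rewrite [in RHS]/local_cov Ex_sum; last first.
  move=> e; apply: integZ; apply: bm_integ; apply: bmM; exact: s_bmT.
transitivity (Ex P (fun w => \sum_e (y i e w * (s i e w * U e j w) +
    y i e w * y j e w * (s i e w * s j e w)))).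
  congr Ex; apply/funext => w; rewrite mulrA W_decomp mulr_suml.
  by apply: eq_bigr => e _; rewrite /U; ring.
have b1 e : bm (fun w => y i e w * (s i e w * U e j w)).
  apply: bmM => //; apply: bmM => //; exact: (bm_others (U_bm j e)).
have b2 e : bm (fun w => y i e w * y j e w * (s i e w * s j e w)).
  by apply: bmM; apply: bmM.
rewrite Ex_sum; last by move=> e; apply: bm_integ; exact: bmD.
apply: eq_bigr => e _; rewrite ExD; [|exact: bm_integ|exact: bm_integ].
rewrite mean0// add0r pair_indep; last exact: bmM.
by rewrite ExZ//; apply: bm_integ; apply: bmM.
Qed.

(** The first summand comes from the Taylor remainder of g at U e, the second one
    from moving the gradient of g back from U e to W. *)
Definition third_moment_error i : R :=
  \sum_e \sum_j \sum_k
    (Ex P (fun w => `|y i e w * y j e w * y k e w|) +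
       `|tau i j e| * Ex P (fun w => `|y k e w|)) *
    Ex P (fun w => `|s i e w * s j e w * s k e w|).

Variables (g : 'cV[R]_n -> R) (M2 M3 : R).
Hypothesis dg : forall x, differentiable g x.
Hypothesis cdg : forall j, continuous (partial j g).
Hypothesis g2 : forall j x, `|partial j g x| <= M2.
Hypothesis g3 : forall j x x',
  `|partial j g x - partial j g x'| <= M3 * l1 (x - x').

Let M2_ge0 (i : 'I_n) : 0 <= M2. Proof. exact: le_trans (g2 i 0). Qed.

Let g_bm e : bm (fun w : To e => g (Uv e w)).
Proof. exact: (@bm_comp_lipschitz _ (To e) _ _ g (U e) M2). Qed.

Let dg_bm e j : bm (fun w : To e => partial j g (Uv e w)).
Proof.
apply: (@bm_comp_cV _ (To e) _ _ (partial j g) (U e) M2 0) => // x.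
by rewrite mul0r addr0.
Qed.

Let gW_bm : bm (fun w => g (Wv w)).
Proof. exact: (@bm_comp_lipschitz _ T _ _ g W M2). Qed.

Let dgW_bm j : bm (fun w => partial j g (Wv w)).
Proof.
apply: (@bm_comp_cV _ T _ _ (partial j g) W M2 0) => // x.
by rewrite mul0r addr0.
Qed.

Let D e w : 'cV[R]_n := \col_k (y k e w * s k e w).

Let WUD e w : Wv w = Uv e w + D e w.
Proof. by apply/matrixP => k o; rewrite !mxE /U subrK. Qed.

Let l1D_E e w : l1 (D e w) = \sum_k `|y k e w * s k e w|.
Proof. by apply: eq_bigr => k _; rewrite mxE. Qed.

Let yyy i j k e w := `|y i e w * y j e w * y k e w|.
Let sss i j k e w := `|s i e w * s j e w * s k e w|.

(** Expand g at U e, which is independent of X e: the constant term vanishes because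
    y i e is centred, and the linear term produces tau. *)
Let leave_one_out_edge i e :
  `|Ex P (fun w => y i e w * s i e w * g (Wv w)) -
    \sum_j tau i j e * Ex P (fun w => s i e w * s j e w * partial j g (Wv w))| <=
  M3 * \sum_j \sum_k
    (Ex P (yyy i j k e) + `|tau i j e| * Ex P (fun w => `|y k e w|)) *
    Ex P (sss i j k e).
Proof.
pose rem w := y i e w * s i e w * (g (Wv w) - g (Uv e w) -
    \sum_j D e w j 0 * partial j g (Uv e w)) +
  \sum_j tau i j e * (s i e w * s j e w *
    (partial j g (Uv e w) - partial j g (Wv w))).
pose bnd w := \sum_j \sum_k
  (yyy i j k e w * sss i j k e w +
   `|tau i j e| * (`|y k e w| * sss i j k e w)).
have gU_bm : bm (fun w => g (Uv e w) : R) by exact: (bm_others (g_bm e)).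
have dgU_bm j : bm (fun w => partial j g (Uv e w)) by exact: (bm_others (dg_bm e j)).
have ss_bm j : bm (fun w : To e => s i e w * s j e w) by exact: bmM.
have sss_bm j k : bm (sss i j k e : To e -> R).
  by apply: bm_norm; apply: bmM => //; exact: bmM.
have sss_bmT j k : bm (sss i j k e) by exact: (bm_others (sss_bm j k)).
have yyy_bm j k : bm (yyy i j k e).
  by apply: bm_norm; apply: bmM => //; exact: bmM.
have D_bm j : bm (fun w => D e w j 0).
  by under [X in bm X]eq_fun do rewrite mxE; exact: bmM.
have rem_bm : bm rem.
  apply: bmD.
    apply: bmM; first exact: bmM.
    apply: bmB; first exact: bmB.
    by apply: bm_sum => j _; exact: bmM.
  apply: bm_sum => j _; apply: bmM; first exact: bm_cst.
  by apply: bmM; [exact: bmM|exact: bmB].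
have b1_bm j k : bm (fun w => yyy i j k e w * sss i j k e w) by exact: bmM.
have b2_bm j k : bm (fun w => `|y k e w| * sss i j k e w).
  by apply: bmM => //; exact: bm_norm.
have bnd_bm : bm bnd.
  apply: bm_sum => j _; apply: bm_sum => k _; apply: bmD => //.
  by apply: bmM; [exact: bm_cst|].
have -> : Ex P (fun w => y i e w * s i e w * g (Wv w)) -
    \sum_j tau i j e * Ex P (fun w => s i e w * s j e w * partial j g (Wv w)) =
    Ex P rem.
  have c1 : bm (fun w => y i e w * (s i e w * g (Uv e w))).
    by apply: bmM => //; exact: bmM.
  have c2 j : bm (fun w => y i e w * y j e w * (s i e w * s j e w * partial j g (Uv e w))).
    by apply: bmM; [exact: bmM|apply: bmM => //; exact: bmM].
  have c3 j : bm (fun w => s i e w * s j e w * partial j g (Uv e w)).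
    by apply: bmM => //; exact: bmM.
  have c4 j : bm (fun w => s i e w * s j e w * partial j g (Wv w)).
    by apply: bmM => //; exact: bmM.
  have c5 : bm (fun w => y i e w * s i e w * g (Wv w)).
    by apply: bmM => //; exact: bmM.
  have cc c (V : T -> R) : bm V -> bm (fun w => c * V w).
    by move=> bV; apply: bmM => //; exact: bm_cst.
  rewrite (_ : rem = fun w => y i e w * s i e w * g (Wv w)
     - y i e w * (s i e w * g (Uv e w))
     - \sum_j (y i e w * y j e w * (s i e w * s j e w * partial j g (Uv e w))
         - tau i j e * (s i e w * s j e w * partial j g (Uv e w))
         + tau i j e * (s i e w * s j e w * partial j g (Wv w)))).
    have c6 j : bm (fun w => y i e w * y j e w * (s i e w * s j e w * partial j g (Uv e w))
         - tau i j e * (s i e w * s j e w * partial j g (Uv e w))).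
      by apply: bmB => //; exact: cc.
    have c7 j : bm (fun w => y i e w * y j e w * (s i e w * s j e w * partial j g (Uv e w))
         - tau i j e * (s i e w * s j e w * partial j g (Uv e w))
         + tau i j e * (s i e w * s j e w * partial j g (Wv w))).
      by apply: bmD => //; exact: cc.
    rewrite ExB; [|apply: bm_integ; exact: bmB|apply: integ_sum => j; exact: bm_integ].
    rewrite ExB; [|exact: bm_integ|exact: bm_integ].
    rewrite mean0// subr0; congr (_ - _).
    rewrite Ex_sum; last by move=> j; exact: bm_integ.
    apply: eq_bigr => j _; rewrite ExD; [|exact: bm_integ|apply: bm_integ; exact: cc].
    rewrite ExB; [|exact: bm_integ|apply: bm_integ; exact: cc].
    rewrite pair_indep; last by exact: bmM.
    by rewrite (ExZ _ (bm_integ P (c3 j))) (ExZ _ (bm_integ P (c4 j))) subrr add0r.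
  apply/funext => w; rewrite /rem !mulrBr -!addrA; congr (_ + _).
  rewrite mulrA; congr (_ + _).
  rewrite mulr_sumr -[LHS]opprK; congr (- _).
  rewrite opprD opprK -sumrB; apply: eq_bigr => j _.
  by rewrite /D mxE; ring.
have -> : M3 * \sum_j \sum_k
    (Ex P (yyy i j k e) + `|tau i j e| * Ex P (fun w => `|y k e w|)) *
    Ex P (sss i j k e) = Ex P (fun w => M3 * bnd w).
  rewrite ExZ; last exact: bm_integ.
  congr (_ * _); rewrite Ex_sum; last first.
    move=> j; apply: integ_sum => k; apply: bm_integ; apply: bmD => //.
    by apply: bmM; [exact: bm_cst|].
  apply: eq_bigr => j _; rewrite Ex_sum; last first.
    move=> k; apply: bm_integ; apply: bmD => //.
    by apply: bmM; [exact: bm_cst|].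
  apply: eq_bigr => k _; rewrite ExD; last 2 first.
    exact: bm_integ.
    by apply: bm_integ; apply: bmM; [exact: bm_cst|].
  rewrite ExZ; last exact: bm_integ.
  rewrite (X_indep (bm_norm (bmM (bmM (psi_bm i) (psi_bm j)) (psi_bm k))) (sss_bm j k)).
  rewrite (X_indep (bm_norm (psi_bm k)) (sss_bm j k)).
  by rewrite mulrDl mulrA.
apply: Ex_norm_le; [exact: bm_integ|apply: bm_integ; apply: bmM => //; exact: bm_cst|].
move=> w; apply: (le_trans (ler_normD _ _)).
have -> : bnd w = \sum_j \sum_k yyy i j k e w * sss i j k e w +
    \sum_j \sum_k `|tau i j e| * (`|y k e w| * sss i j k e w).
  by rewrite -big_split; apply: eq_bigr => j _; rewrite -big_split.
rewrite [leRHS]mulrDr; apply: lerD.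
  rewrite normrM (WUD e w).
  apply: (le_trans (ler_wpM2l (normr_ge0 _) (taylor1 _ _ dg g3))).
  rewrite mulrCA l1D_E expr2 big_distrlr /=; apply: eq_ler.
  congr (_ * _); rewrite mulr_sumr; apply: eq_bigr => j _; rewrite mulr_sumr.
  by apply: eq_bigr => k _; rewrite /yyy /sss -!normrM; congr (`|_|); ring.
apply: (le_trans (ler_norm_sum _ _ _)); rewrite mulr_sumr; apply: ler_sum => j _.
rewrite !normrM; apply: (@le_trans _ _ (`|tau i j e| * (`|s i e w| * `|s j e w| *
  (M3 * l1 (D e w))))).
  rewrite ler_wpM2l// ler_wpM2l ?mulr_ge0//.
  rewrite (le_trans (g3 _ _ _))// (WUD e w) opprD addNKr -[- D e w]scaleN1r l1Z.
  by rewrite normrN normr1 mul1r.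
rewrite l1D_E; apply: eq_ler.
rewrite !mulr_sumr; apply: eq_bigr => k _.
by rewrite /sss !normrM; ring.
Qed.

(** Summing leave_one_out_edge over e leaves the expectation of local_cov times the
    gradient of g. Replacing local_cov by its mean, which is l i times the
    covariance of W i and W j, costs M2 times its fluctuation. *)
Lemma leave_one_out i :
  `|Ex P (fun w => W i w * g (Wv w)) -
    \sum_j Ex P (fun w => W i w * W j w) * Ex P (fun w => partial j g (Wv w))|
  <= (l i)%:R^-1 *
     (M2 * (\sum_j Ex P (fun w => `|local_cov i j w - Ex P (local_cov i j)|))
      + M3 * third_moment_error i).
Proof.
have l0 : 0 < (l i)%:R :> R by rewrite ltr0n.
have lc_bm j : bm (local_cov i j).
  apply: bm_sum => e _; apply: bmM; first exact: bm_cst.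
  exact: bmM.
rewrite mulrC ler_pdivlMr// -[X in _ * X <= _](gtr0_norm l0) -normrM mulrC mulrBr.
rewrite mulr_sumr; under eq_bigr do rewrite mulrA covariance_leave_one_out.
have -> : (l i)%:R * Ex P (fun w => W i w * g (Wv w)) =
    \sum_e Ex P (fun w => y i e w * s i e w * g (Wv w)).
  rewrite -ExZ; last by apply: bm_integ; exact: bmM.
  rewrite -Ex_sum; last first.
    by move=> e; apply: bm_integ; apply: bmM => //; exact: bmM.
  by congr Ex; apply/funext => w; rewrite mulrA W_decomp mulr_suml.
have E1 j : Ex P (fun w => local_cov i j w * partial j g (Wv w)) =
    \sum_e tau i j e * Ex P (fun w => s i e w * s j e w * partial j g (Wv w)).
  rewrite (_ : (fun w => _) = fun w => \sum_e tau i j e *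
      (s i e w * s j e w * partial j g (Wv w))); last first.
    apply/funext => w; rewrite /local_cov mulr_suml.
    by apply: eq_bigr => e _; rewrite -[LHS]mulrA.
  have c e : bm (fun w => s i e w * s j e w * partial j g (Wv w)).
    by apply: bmM => //; exact: bmM.
  rewrite Ex_sum; last by move=> e; apply: integZ; exact: bm_integ.
  by apply: eq_bigr => e _; rewrite ExZ//; exact: bm_integ.
have E2 j : Ex P (fun w => local_cov i j w * partial j g (Wv w)) -
    Ex P (local_cov i j) * Ex P (fun w => partial j g (Wv w)) =
    Ex P (fun w => (local_cov i j w - Ex P (local_cov i j)) * partial j g (Wv w)).
  rewrite -ExZ; last exact: bm_integ.
  rewrite -ExB; last 2 first.
    by apply: bm_integ; exact: bmM.
    by apply: integZ; exact: bm_integ.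
  by congr Ex; apply/funext => w; rewrite mulrBl.
set A := \sum_e _; set Z := \sum_j _ * _.
have -> : A - Z =
   \sum_e (Ex P (fun w => y i e w * s i e w * g (Wv w)) -
     \sum_j tau i j e * Ex P (fun w => s i e w * s j e w * partial j g (Wv w))) +
   \sum_j Ex P (fun w => (local_cov i j w - Ex P (local_cov i j)) * partial j g (Wv w)).
  rewrite [X in _ = _ + X](_ : _ = \sum_j (\sum_e tau i j e *
      Ex P (fun w => s i e w * s j e w * partial j g (Wv w))) - Z); last first.
    by rewrite -sumrB; apply: eq_bigr => j _; rewrite -E2 E1.
  by rewrite sumrB exchange_big /= addrA subrK.
rewrite addrC; apply: (le_trans (ler_normD _ _)); apply: lerD.
  apply: (le_trans (ler_norm_sum _ _ _)); rewrite mulr_sumr; apply: ler_sum => j _.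
  have cB : bm (fun w => local_cov i j w - Ex P (local_cov i j)).
    by apply: bmB => //; exact: bm_cst.
  rewrite -ExZ; last by apply: bm_integ; exact: bm_norm.
  apply: Ex_norm_le.
  - by apply: bm_integ; exact: bmM.
  - by apply: integZ; apply: bm_integ; exact: bm_norm.
  - by move=> w; rewrite normrM mulrC ler_wpM2r.
apply: (le_trans (ler_norm_sum _ _ _)); rewrite /third_moment_error mulr_sumr.
by apply: ler_sum => e _; exact: leave_one_out_edge.
Qed.

End LeaveOneOut.

(** * Gaussian vectors *)

Lemma l1_mulmx {R : realType} {n : nat} (S : 'M[R]_n) (z : 'cV[R]_n) :
  l1 (S *m z) <= (\sum_i \sum_j `|S i j|) * l1 z.
Proof.
rewrite {1}/l1 mulr_suml; apply: ler_sum => i _; rewrite mxE mulr_suml.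
apply: (le_trans (ler_norm_sum _ _ _)); apply: ler_sum => j _.
rewrite normrM ler_wpM2l// /l1 (bigD1 j)//= lerDl; exact: sumr_ge0.
Qed.

Section GaussianVector.
Context {d : measure_display} {T : measurableType d} {R : realType} {n : nat}.
Variables (P : probability T R) (Z : 'I_n -> {RV P >-> R}).
Hypothesis stdZ : std_normal_vector Z.
Local Notation gam := (@normal_prob R 0 1).

Definition Zv w : 'cV[R]_n := \col_k Z k w.

Let idR : measurableTypeR R -> R := idfun.

Let measurable_idR : measurable_fun setT idR.
Proof. by move=> _ A mA; rewrite setTI. Qed.

HB.instance Definition _ := @isMeasurableFun.Build _ _ _ _ idR measurable_idR.

(** The normal law, moved along the identity to the measurable structure in which
    Z k takes its values. *)
Let gamR : probability R R := distribution gam idR.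

Let law_coord k (A : set R) : measurable A -> distribution P (Z k) A = gamR A.
Proof. by move=> mA; exact: stdZ.2. Qed.

Let integ_gamR h : integ gam h -> integ gamR h.
Proof.
move=> ih; have mh := integ_meas ih.
apply/integrableP; split; first exact/measurable_EFinP.
rewrite ge0_integral_distribution//; first by case/integrableP: ih.
by apply: measurableT_comp => //; exact/measurable_EFinP.
Qed.

Lemma integral_normal_coord k (h : R -> R) : integ gam h ->
  (\int[distribution P (Z k)]_x (h x)%:E = (Ex gam h)%:E)%E.
Proof.
move=> ih; have mh := integ_meas ih.
rewrite (eq_measure_integral gamR); last by move=> A mA _; exact: law_coord.
rewrite (@integral_distribution _ _ _ _ _ gam idR (EFin \o h))//.
  by rewrite /Ex /Rintegral fineK//; exact: integrable_fin_num.
exact/measurable_EFinP.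
Qed.

Lemma integ_normal_coord k (h : R -> R) : integ gam h ->
  integ P (fun w => h (Z k w)).
Proof.
move=> ih; have mh := integ_meas ih.
apply/integrableP; split.
  by apply/measurable_EFinP; exact: measurableT_comp.
rewrite -(@ge0_integral_distribution _ _ _ _ _ P (Z k) (fun x => `|(h x)%:E|%E))//.
  rewrite (eq_measure_integral gamR); last by move=> A mA _; exact: law_coord.
  by case/integrableP: (integ_gamR ih).
by apply: measurableT_comp => //; exact/measurable_EFinP.
Qed.

Lemma integ_sqr_coord k : integ P (fun w => Z k w ^+ 2).
Proof.
apply: (integ_dom (Y := fun w => 1 + Z k w ^+ 2)).
- exact: measurable_funX.
- exact: (integ_normal_coord k integ_normal_sqr).
- by move=> w; rewrite ger0_norm ?sqr_ge0// lerDr.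
Qed.

(** A weight with a finite second moment: functions of quadratic growth in Z are
    integrable by comparison with its square. *)
Definition zrad w : R := 1 + \sum_k `|Z k w|.

Lemma zrad_ge1 w : 1 <= zrad w.
Proof. by rewrite lerDl sumr_ge0. Qed.

Lemma measurable_zrad : measurable_fun setT zrad.
Proof.
apply: measurable_funD => //; apply: measurable_sum => k.
exact: measurableT_comp.
Qed.

Lemma integ_zrad2 : integ P (fun w => zrad w ^+ 2).
Proof.
have h : integ P (fun w => 2 * (1 + n%:R * \sum_k Z k w ^+ 2)).
  apply: integZ; apply: integD; first exact: integ_cst.
  by apply: integZ; apply: integ_sum => k; exact: integ_sqr_coord.
apply: integ_dom h _; first by apply: measurable_funX; exact: measurable_zrad.
move=> w; rewrite ger0_norm ?sqr_ge0//.
have cs : (\sum_k `|Z k w|) ^+ 2 <= n%:R * \sum_k Z k w ^+ 2.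
  rewrite expr2 big_distrlr /=.
  apply: (@le_trans _ _ (\sum_(i < n) \sum_(j < n) 2^-1 * (Z i w ^+ 2 + Z j w ^+ 2))).
    apply: ler_sum => i _; apply: ler_sum => j _.
    rewrite -(real_normK (num_real (Z i w))) -(real_normK (num_real (Z j w))).
    have := sqr_ge0 (`|Z i w| - `|Z j w|); lra.
  have -> : \sum_(i < n) \sum_(j < n) 2^-1 * (Z i w ^+ 2 + Z j w ^+ 2) =
      \sum_(i < n) (n%:R / 2 * Z i w ^+ 2 + 2^-1 * \sum_k Z k w ^+ 2).
    apply: eq_bigr => i _; rewrite -mulr_sumr big_split /= sumr_const card_ord.
    by rewrite -mulr_natl; ring.
  rewrite big_split /= -mulr_sumr sumr_const card_ord -mulr_natl.
  by apply: eq_ler; field.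
rewrite /zrad; set q := \sum_k `|Z k w| in cs *.
have := sqr_ge0 (q - 1); nra.
Qed.

Lemma integ_le_zrad2 (H : T -> R) c : measurable_fun setT H ->
  (forall w, `|H w| <= c * zrad w ^+ 2) -> integ P H.
Proof. by move=> mH Hc; apply: integ_dom Hc => //; apply: integZ; exact: integ_zrad2. Qed.

Variables (g : 'cV[R]_n -> R) (M : R) (S : 'M[R]_n) (c : R) (v0 : 'cV[R]_n).
Hypothesis dg : forall x, differentiable g x.
Hypothesis cdg : forall j, continuous (partial j g).
Hypothesis gM : forall j x, `|partial j g x| <= M.

Let aff z := c *: (S *m z) + v0.

(** With the other coordinates fixed this is normal_ibp in the variable Z k, and
    independence makes it legitimate to integrate over Z k first. *)
Lemma gaussian_ibp_coord k :
  Ex P (fun w => Z k w * g (aff (Zv w))) =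
  c * \sum_j S j k * Ex P (fun w => partial j g (aff (Zv w))).
Proof.
have M0 : 0 <= M by apply: le_trans (gM k 0).
pose T0 := g_sigma_algebraType (cyl (predT : {pred 'I_n}) Z k).
pose th (p : T0 * R) j : R := if j == k then p.2 else Z j p.1.
pose Th p i : R := c * (\sum_j S i j * th p j) + v0 i 0.
pose F1 p := p.2 * g (\col_i Th p i).
pose F2 p := c * \sum_j S j k * partial j g (\col_i Th p i).
have mth j : measurable_fun setT (fun p => th p j).
  rewrite /th; case: eqP => [_|/eqP jk]; first exact: measurable_snd.
  apply: (@measurableT_comp _ _ _ _ _ _ (Z j : T0 -> R)).
    exact: measurable_cyl.
  exact: measurable_fst.
have mTh i : measurable_fun setT (fun p => Th p i).
  apply: measurable_funD => //; apply: measurable_funM => //.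
  by apply: measurable_sum => j; exact: measurable_funM.
have mF1 : measurable_fun setT F1.
  apply: measurable_funM; first exact: measurable_snd.
  apply: measurable_continuous_cV => //.
  by move=> x; exact: differentiable_continuous.
have mF2 : measurable_fun setT F2.
  apply: measurable_funM => //; apply: measurable_sum => j.
  by apply: measurable_funM => //; exact: measurable_continuous_cV.
have ThZ w : \col_i Th (w, Z k w) i = aff (Zv w).
  apply/matrixP => i o; rewrite (ord1 o) /aff !mxE /Th; congr (_ * _ + _).
  apply: eq_bigr => j _; rewrite /th mxE /=.
  by case: eqP => [->|].
have E12 w : (\int[distribution P (Z k)]_x (F1 (w, x))%:E =
              \int[distribution P (Z k)]_x (F2 (w, x))%:E)%E.
  pose u : 'cV[R]_n := \col_i (c * S i k).
  pose v : 'cV[R]_n := \col_i Th (w, 0) i.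
  have Thx x : \col_i Th (w, x) i = x *: u + 1 *: v.
    apply/matrixP => i o; rewrite scale1r !mxE /Th addrA; congr (_ + _).
    rewrite (bigD1 k)//= [X in _ = _ + _ * X](bigD1 k)//= /th eqxx /= mulr0 add0r.
    rewrite mulrDr; congr (_ + _ * _); first by ring.
    by apply: eq_bigr => j /negbTE ->.
  pose G x := g (x *: u + 1 *: v).
  pose G' x := c * \sum_j S j k * partial j g (x *: u + 1 *: v).
  have dG (x : R) : is_derive x 1 G (G' x).
    have := @is_derive_curve _ _ g id (cst 1) 1 0 x u v (dg _)
      (is_derive_id (x : R^o) (1 : R^o)) (is_derive_cst (1 : R^o) (x : R^o) (1 : R^o)).
    rewrite /G /G' mulr_sumr; congr is_derive; apply: eq_bigr => j _.
    by rewrite mxE mul0r addr0 mul1r mulrA.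
  have cline : continuous (fun x : R => x *: u + 1 *: v).
    move=> x; apply: cvgD; last exact: cvg_cst.
    by apply: cvgZr_tmp; exact: cvg_id.
  have cG' : continuous G'.
    move=> x; apply: cvgM; first exact: cvg_cst.
    apply: cvg_big => [|j _]; first exact: add_continuous.
    apply: cvgM; first exact: cvg_cst.
    by apply: continuous_comp; [exact: cline|exact: cdg].
  pose B := `|c| * \sum_j (`|S j k| * M).
  have G'B x : `|G' x| <= B.
    rewrite normrM ler_wpM2l// (le_trans (ler_norm_sum _ _ _))//.
    by apply: ler_sum => j _; rewrite normrM ler_wpM2l.
  have mG : measurable_fun setT G.
    apply: continuous_measurable_fun => x.
    by apply: continuous_comp; [exact: cline|exact: differentiable_continuous].
  have F1E x : F1 (w, x) = x * G x by rewrite /F1 Thx.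
  have F2E x : F2 (w, x) = G' x by rewrite /F2 Thx.
  have iF1 : integ gam (fun x => F1 (w, x)).
    under [X in integ gam X]eq_fun do rewrite F1E.
    apply: (@integ_dom _ (measurableTypeR R) _ gam _
      (fun x => (`|g (1 *: v)| + M * l1 u) * (1 + x ^+ 2))).
    - exact: measurable_funM.
    - by apply: integZ; exact: integ_normal_sqr.
    - move=> x; have := growth_partial (1 *: v) (x *: u) dg gM.
      rewrite -/(G x) l1Z normrM -(real_normK (num_real x)).
      have := normr_ge0 x; have := normr_ge0 (g (1 *: v)).
      have : 0 <= M * l1 u by rewrite mulr_ge0// l1_ge0.
      set p := `|x|; set q := `|g _|; set r := `|G x|; set l := l1 u.
      move=> Ml0 q0 p0; rewrite mulrCA [p * _]mulrC => h.
      have := sqr_ge0 (p - 1); nra.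
  have iF2 : integ gam (fun x => F2 (w, x)).
    under [X in integ gam X]eq_fun do rewrite F2E.
    apply: (@integ_bdd _ (measurableTypeR R) _ gam B) => //.
    exact: continuous_measurable_fun.
  rewrite !integral_normal_coord//; congr EFin.
  transitivity (Ex gam (fun x => x * G x)); first by congr Ex; apply/funext.
  rewrite (normal_ibp dG cG' G'B).
  by congr Ex; apply/funext.
have mcoord (i : 'I_n) : measurable_fun setT (fun w => aff (Zv w) i 0).
  under [X in measurable_fun _ X]eq_fun do rewrite !mxE.
  apply: measurable_funD => //; apply: measurable_funM => //.
  apply: measurable_sum => j; apply: measurable_funM => //.
  under [X in measurable_fun _ X]eq_fun do rewrite mxE.
  exact: measurable_funP.
have aff_col w : aff (Zv w) = \col_i aff (Zv w) i 0.
  by apply/matrixP => i o; rewrite (ord1 o) mxE.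
have l1Zv w : l1 (Zv w) <= zrad w.
  rewrite /l1 /zrad; under eq_bigr do rewrite mxE.
  by rewrite lerDr.
pose s0 := \sum_i \sum_j `|S i j|.
have s00 : 0 <= s0 by apply: sumr_ge0 => i _; exact: sumr_ge0.
have iF1 : integ P (fun w => F1 (w, Z k w)).
  under [X in integ P X]eq_fun do rewrite /F1 ThZ.
  apply: (@integ_le_zrad2 _ (`|g v0| + M * (`|c| * s0))).
    apply: measurable_funM => //.
    under [X in measurable_fun _ X]eq_fun do rewrite aff_col.
    apply: measurable_continuous_cV => //.
    by move=> x; exact: differentiable_continuous.
  move=> w; rewrite normrM expr2.
  have z1 := zrad_ge1 w.
  have zk : `|Z k w| <= zrad w.
    rewrite /zrad (bigD1 k)//= addrCA lerDl addr_ge0//; exact: sumr_ge0.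
  have gz : `|g (aff (Zv w))| <= (`|g v0| + M * (`|c| * s0)) * zrad w.
    apply: (le_trans (growth_partial v0 _ dg gM)); rewrite mulrDl lerD//.
      by rewrite ler_peMr.
    rewrite -!mulrA ler_wpM2l// l1Z ler_wpM2l//.
    by rewrite (le_trans (l1_mulmx _ _))// ler_wpM2l.
  by rewrite mulrCA; apply: ler_pM.
have iF2 : integ P (fun w => F2 (w, Z k w)).
  under [X in integ P X]eq_fun do rewrite /F2 ThZ.
  apply: integZ; apply: integ_sum => j; apply: integZ.
  apply: (@integ_bdd _ _ _ _ M) => //.
  under [X in measurable_fun _ X]eq_fun do rewrite aff_col.
  exact: measurable_continuous_cV.
have fub (F : T0 * R -> R) (mF : measurable_fun setT F)
    (iF : integ P (fun w => F (w, Z k w))) :=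
  indep_fubini (@cyl_measurable _ _ _ _ predT Z k)
   (@cyl_setI _ _ _ _ predT Z k) (@cyl_setT _ _ _ _ predT Z k)
   (fun B A => @cyl_indep _ _ _ P _ predT Z stdZ.1 k B A isT) mF iF.
transitivity (Ex P (fun w => F1 (w, Z k w))).
  by congr Ex; apply/funext => w; rewrite /F1 ThZ.
transitivity (Ex P (fun w => F2 (w, Z k w))).
  rewrite /Ex /Rintegral (fub _ mF1 iF1) (fub _ mF2 iF2); congr fine.
  by apply: eq_integral => w _; exact: E12.
under [X in Ex P X]eq_fun do rewrite /F2 ThZ.
have ip j : integ P (fun w => partial j g (aff (Zv w))).
  apply: (@integ_bdd _ _ _ _ M) => //.
  under [X in measurable_fun _ X]eq_fun do rewrite aff_col.
  exact: measurable_continuous_cV.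
have [iS <-] := Ex_lincomb (fun j => S j k) ip.
by rewrite ExZ.
Qed.

End GaussianVector.

(** * Interpolation between W and the Gaussian vector *)

(** Cutting [a, b] into k pieces makes the quadratic errors add up to O(1/k). This
    bounds increments of an expectation without differentiating under it. *)
Lemma quadratic_increment {R : realType} (phi : R -> R) (a b A K : R) : a <= b ->
  (forall s t, s <= t -> `|phi t - phi s| <= A * (t - s) + K * (t - s) ^+ 2) ->
  `|phi b - phi a| <= A * (b - a).
Proof.
move=> ab h; set L := b - a; have L0 : 0 <= L by rewrite subr_ge0.
apply/ler_addgt0Pr => eps eps0.
pose k := Num.truncn (`|K| * L ^+ 2 / eps).
have kP : `|K| * L ^+ 2 / eps < k.+1%:R by exact: truncnS_gt.
have k0 : 0 < k.+1%:R :> R by [].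
pose p (i : nat) := a + i%:R * (L / k.+1%:R).
have step i : `|phi (p i.+1) - phi (p i)| <=
    A * (L / k.+1%:R) + K * (L / k.+1%:R) ^+ 2.
  have E : p i.+1 - p i = L / k.+1%:R.
    by rewrite /p -natr1; ring.
  by rewrite -E; apply: h; rewrite -subr_ge0 E divr_ge0.
have tel j : `|phi (p j) - phi (p 0%N)| <=
    j%:R * (A * (L / k.+1%:R) + K * (L / k.+1%:R) ^+ 2).
  elim: j => [|j ih]; first by rewrite subrr normr0 mul0r.
  rewrite -[phi (p j.+1)](subrK (phi (p j))) -addrA (le_trans (ler_normD _ _))//.
  by rewrite -natr1 mulrDl mul1r [leRHS]addrC lerD.
have := tel k.+1.
have -> : p 0%N = a by rewrite /p mul0r addr0.
have -> : p k.+1 = b by rewrite /p mulrC divfK ?gt_eqF// /L subrKC.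
move=> /le_trans; apply.
have -> : k.+1%:R * (A * (L / k.+1%:R) + K * (L / k.+1%:R) ^+ 2) =
   A * L + K * L ^+ 2 / k.+1%:R by field; rewrite gt_eqF.
rewrite lerD2l ler_pdivrMr//.
apply: (@le_trans _ _ (`|K| * L ^+ 2)).
  by rewrite ler_wpM2r ?exprn_ge0// ler_norm.
by rewrite [leRHS]mulrC -ler_pdivrMr// ltW.
Qed.

Section SmartPath.
Context {d : measure_display} {T : measurableType d} {R : realType} {n : nat}.
Context {d' : measure_display} {T' : measurableType d'}.
Variables (P : probability T R) (P' : probability T' R).
Variables (Z : 'I_n -> {RV P' >-> R}) (W : 'I_n -> T -> R) (S : 'M[R]_n).
Variables (f : 'cV[R]_n -> R) (M2 Q : R).
Let Wv w : 'cV[R]_n := \col_k W k w.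
Let Yv w' : 'cV[R]_n := S *m Zv Z w'.
Hypothesis stdZ : std_normal_vector Z.
Hypothesis W_bm : forall k, bm (W k).
Hypothesis df : forall x, differentiable f x.
Hypothesis ddf : forall i x, differentiable (partial i f) x.
Hypothesis cddf : forall i j, continuous (partial j (partial i f)).
Hypothesis f2 : forall i j x, `|partial j (partial i f) x| <= M2.
Hypothesis symS : S^T = S.
(** The Stein identity for W up to Q. In the interpolation c is sin t and v is the
    frozen Gaussian part cos t Y. *)
Hypothesis steinW : forall i (c : R) v, `|c| <= 1 ->
  `|Ex P (fun w => W i w * partial i f (c *: Wv w + v)) -
    c * \sum_j (S *m S) i j *
      Ex P (fun w => partial j (partial i f) (c *: Wv w + v))| <= Q.

Let PP := (P \x P')%E.

Let X t (p : T * T') : 'cV[R]_n := sin t *: Wv p.1 + cos t *: Yv p.2.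

Let phi t := Ex PP (fun p => f (X t p)).

Let rho w' := zrad Z w'.

Let S' i k : S i k = S k i. Proof. by rewrite -{1}symS mxE. Qed.

Let rho_ge1 w' : 1 <= rho w'. Proof. exact: zrad_ge1. Qed.

Let l1Z_rho w' : l1 (Zv Z w') <= rho w'.
Proof.
by rewrite /l1 /rho /zrad; under eq_bigr do rewrite mxE; rewrite lerDr.
Qed.

Let kap_ex : exists2 kap : R, 0 <= kap &
  forall w w', l1 (Wv w) + l1 (Yv w') <= kap * rho w'.
Proof.
have /choice[M MP] : forall k, exists M, forall w, `|W k w| <= M.
  by move=> k; case: (W_bm k).
have s0 : 0 <= \sum_i \sum_j `|S i j| by apply: sumr_ge0 => i _; exact: sumr_ge0.
exists (\sum_k `|M k| + \sum_i \sum_j `|S i j|).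
  by rewrite addr_ge0// sumr_ge0.
move=> w w'; rewrite mulrDl lerD//.
  apply: (@le_trans _ _ (\sum_k `|M k|)).
    by apply: ler_sum => k _; rewrite mxE (le_trans (MP k w))// ler_norm.
  by rewrite ler_peMr// sumr_ge0.
by rewrite (le_trans (l1_mulmx _ _))// ler_wpM2l.
Qed.

Let kap : R := s2val (cid2 kap_ex).
Let kap_ge0 : 0 <= kap. Proof. exact: (s2valP (cid2 kap_ex)). Qed.
Let kapP w w' : l1 (Wv w) + l1 (Yv w') <= kap * rho w'.
Proof. exact: (s2valP' (cid2 kap_ex)). Qed.

Let rho_ge0 w' : 0 <= rho w'. Proof. exact: le_trans (rho_ge1 w'). Qed.

Let l1W_kap w w' : l1 (Wv w) <= kap * rho w'.
Proof. by apply: le_trans (kapP w w'); rewrite lerDl l1_ge0. Qed.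

Let l1Y_kap (w : T) w' : l1 (Yv w') <= kap * rho w'.
Proof. by apply: le_trans (kapP w w'); rewrite lerDr l1_ge0. Qed.

Let M2_ge0 (i : 'I_n) : 0 <= M2. Proof. exact: le_trans (f2 i i 0). Qed.

Let M2_norm i j x : `|partial j (partial i f) x| <= `|M2|.
Proof. exact: le_trans (f2 i j x) (ler_norm _). Qed.

Let G0 : R := \sum_i `|partial i f 0|.

Let grad_growth i x : `|partial i f x| <= G0 + `|M2| * l1 x.
Proof.
rewrite -[X in partial i f X]addr0 (le_trans (growth_partial _ _ (ddf i) (M2_norm i)))//.
by rewrite lerD2r /G0 (bigD1 i)//= lerDl; exact: sumr_ge0.
Qed.

Let G0_ge0 : 0 <= G0. Proof. exact: sumr_ge0. Qed.

Let coord_le_l1 (x : 'cV[R]_n) i : `|x i 0| <= l1 x.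
Proof. by rewrite /l1 (bigD1 i)//= lerDl; exact: sumr_ge0. Qed.

Let f_growth x : `|f x| <= `|f 0| + l1 x * (G0 + `|M2| * l1 x).
Proof.
have [c /andP[c0 c1]] := MVT_segment_cV 0 x df; rewrite add0r => E.
rewrite -[f x](subrKC (f 0)) (le_trans (ler_normD _ _))// lerD2l E.
rewrite (le_trans (ler_norm_sum _ _ _))// {1}/l1 mulr_suml.
apply: ler_sum => i _; rewrite normrM ler_wpM2l// add0r.
rewrite (le_trans (grad_growth _ _))// lerD2l ler_wpM2l// l1Z ger0_norm//.
by rewrite ler_piMl// l1_ge0.
Qed.

Let sin_le1 t : `|sin t| <= 1 :> R.
Proof. by rewrite ler_norml sin_geN1 sin_le1. Qed.

Let cos_le1 t : `|cos t| <= 1 :> R.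
Proof. by rewrite ler_norml cos_geN1 cos_le1. Qed.

Let l1X t p : l1 (X t p) <= kap * rho p.2.
Proof.
rewrite (le_trans (l1D _ _))// !l1Z (le_trans _ (kapP p.1 p.2))//.
by rewrite lerD// ler_piMl// l1_ge0.
Qed.

Let mY i : measurable_fun setT (fun w' => Yv w' i 0).
Proof.
under [X in measurable_fun _ X]eq_fun do rewrite mxE.
apply: measurable_sum => j; apply: measurable_funM => //.
under [X in measurable_fun _ X]eq_fun do rewrite mxE.
exact: measurable_funP.
Qed.

Let mW i : measurable_fun setT (W i). Proof. by case: (W_bm i). Qed.

Let mX t (h : 'cV[R]_n -> R) : continuous h ->
  measurable_fun setT (fun p => h (X t p)).
Proof.
move=> ch.
rewrite (_ : (fun p => _) = fun p : T * T' => h (\col_i (sin t * W i p.1 + cos t * Yv p.2 i 0))).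
  apply: measurable_continuous_cV => // i.
  apply: measurable_funD; apply: measurable_funM => //.
    exact: (measurableT_comp (mW i) measurable_fst).
  exact: (measurableT_comp (mY i) measurable_snd).
apply/funext => p; congr h; apply/matrixP => i o.
by rewrite (ord1 o) /X !mxE; congr (_ + _ * _); rewrite !mxE.
Qed.

Let mW1 i : measurable_fun setT (fun p : T * T' => W i p.1).
Proof. exact: (measurableT_comp (mW i) measurable_fst). Qed.

Let mY2 i : measurable_fun setT (fun p : T * T' => Yv p.2 i 0).
Proof. exact: (measurableT_comp (mY i) measurable_snd). Qed.

Let cf : continuous f. Proof. by move=> x; exact: differentiable_continuous. Qed.

Let cdf i : continuous (partial i f).
Proof. by move=> x; exact: differentiable_continuous. Qed.

Let integ_rho : integ PP (fun p => rho p.2 ^+ 2).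
Proof.
have mr : measurable_fun setT (fun p : T * T' => (rho p.2 ^+ 2)%:E).
  apply/measurable_EFinP; apply: measurable_funX.
  exact: (measurableT_comp (measurable_zrad Z) measurable_snd).
apply/(integrable12ltyP P P' mr).
have /integrableP[_ i2] := integ_zrad2 stdZ.
under eq_integral do rewrite /=.
rewrite integral_cst//= probability_setT mule1.
exact: i2.
Qed.

Let integ_PP (H : T * T' -> R) C : measurable_fun setT H ->
  (forall p, `|H p| <= C * rho p.2 ^+ 2) -> integ PP H.
Proof. by move=> mH HC; apply: integ_dom HC => //; exact: integZ. Qed.

Let sec1 (H : T * T' -> R) C w : measurable_fun setT H ->
  (forall p, `|H p| <= C * rho p.2 ^+ 2) -> integ P' (fun w' => H (w, w')).
Proof.
move=> mH HC; apply: (integ_le_zrad2 stdZ (c := C)); last by move=> w'; exact: (HC (w, w')).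
exact: (measurableT_comp mH (measurable_pair1 w)).
Qed.

Let sec2 (H : T * T' -> R) C w' : measurable_fun setT H ->
  (forall p, `|H p| <= C * rho p.2 ^+ 2) -> integ P (fun w => H (w, w')).
Proof.
move=> mH HC; apply: (@integ_bdd _ _ _ _ (C * rho w' ^+ 2)); last by move=> w; exact: (HC (w, w')).
exact: (measurableT_comp mH (measurable_pair2 w')).
Qed.

Let Ex12 (H : T * T' -> R) C : measurable_fun setT H ->
  (forall p, `|H p| <= C * rho p.2 ^+ 2) ->
  integ P (fun w => Ex P' (fun w' => H (w, w'))) /\
  Ex PP H = Ex P (fun w => Ex P' (fun w' => H (w, w'))).
Proof.
move=> mH HC; have iH := integ_PP mH HC.
have E w : (\int[P']_w' (H (w, w'))%:E = (Ex P' (fun w' => H (w, w')))%:E)%E.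
  by rewrite /Ex /Rintegral fineK//; apply: integrable_fin_num => //; exact: (sec1 w mH HC).
split.
  rewrite /integ (_ : EFin \o _ = fun w => \int[P']_w' (H (w, w'))%:E)%E.
    exact: (integrable_fubini_F iH).
  by apply/funext => w; exact/esym/E.
rewrite {1}/Ex /Rintegral -(integral12_prod_meas1 iH); congr fine.
by apply: eq_integral => w _; exact: E.
Qed.

Let Ex21 (H : T * T' -> R) C : measurable_fun setT H ->
  (forall p, `|H p| <= C * rho p.2 ^+ 2) ->
  integ P' (fun w' => Ex P (fun w => H (w, w'))) /\
  Ex PP H = Ex P' (fun w' => Ex P (fun w => H (w, w'))).
Proof.
move=> mH HC; have iH := integ_PP mH HC.
have E w' : (\int[P]_w (H (w, w'))%:E = (Ex P (fun w => H (w, w')))%:E)%E.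
  by rewrite /Ex /Rintegral fineK//; apply: integrable_fin_num => //; exact: (sec2 w' mH HC).
split.
  apply: (integ_le_zrad2 stdZ (c := C)).
    apply/measurable_EFinP.
    rewrite (_ : EFin \o _ = fun w' => \int[P]_w (H (w, w'))%:E)%E.
      exact: (measurable_fubini_G iH).
    by apply/funext => w'; exact/esym/E.
  move=> w'; rewrite -[leRHS](Ex_cst P); apply: Ex_norm_le.
  - exact: (sec2 w' mH HC).
  - exact: integ_cst.
  - by move=> w; exact: (HC (w, w')).
rewrite {1}/Ex /Rintegral -(integral21_prod_meas1 iH); congr fine.
by apply: eq_integral => w' _; exact: E.
Qed.

Let stein_gauss i (c : R) v :
  Ex P' (fun w' => Yv w' i 0 * partial i f (c *: Yv w' + v)) =
  c * \sum_j (S *m S) i j *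
      Ex P' (fun w' => partial j (partial i f) (c *: Yv w' + v)).
Proof.
have iZ k : integ P' (fun w' => Z k w' * partial i f (c *: Yv w' + v)).
  have Ycol w' : c *: Yv w' + v = \col_j (c * Yv w' j 0 + v j 0).
    by apply/matrixP => j o; rewrite (ord1 o) !mxE; congr (_ * _ + _); rewrite !mxE.
  apply: (integ_le_zrad2 stdZ (c := G0 + `|M2| * (`|c| * kap + l1 v))).
    apply: measurable_funM; first exact: measurable_funP.
    under [X in measurable_fun _ X]eq_fun do rewrite Ycol.
    apply: measurable_continuous_cV => // j.
    by apply: measurable_funD => //; exact: measurable_funM.
  move=> w'; rewrite normrM expr2 mulrA [leRHS]mulrC.
  have zk : `|Z k w'| <= rho w'.
    by apply: le_trans (l1Z_rho w'); have := coord_le_l1 (Zv Z w') k; rewrite mxE.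
  apply: ler_pM => //; apply: (le_trans (grad_growth _ _)).
  rewrite mulrDl lerD//; first by rewrite ler_peMr// rho_ge1.
  rewrite -mulrA ler_wpM2l// mulrDl (le_trans (l1D _ _))// lerD//.
    by rewrite l1Z -mulrA ler_wpM2l// (l1Y_kap point).
  by rewrite ler_peMr ?l1_ge0.
rewrite (_ : (fun w' => _) = fun w' => \sum_k S i k * (Z k w' * partial i f (c *: Yv w' + v))); last first.
  apply/funext => w'; rewrite {1}/Yv mxE mulr_suml; apply: eq_bigr => k _.
  by rewrite mxE mulrA.
rewrite Ex_sum; last by move=> k; exact: integZ.
under eq_bigr do rewrite ExZ// (gaussian_ibp_coord stdZ S c v (ddf i) (@cddf i) (f2 i)).
rewrite mulr_sumr.
transitivity (\sum_k \sum_j c * (S i k * S k j *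
   Ex P' (fun w' => partial j (partial i f) (c *: Yv w' + v)))).
  apply: eq_bigr => k _; rewrite !mulr_sumr; apply: eq_bigr => j _.
  by rewrite (S' j k); ring.
rewrite exchange_big /=; apply: eq_bigr => j _.
by rewrite mxE mulr_suml mulr_sumr.
Qed.

(** The derivative of t |-> f (X t p). *)
Let velocity t p : R :=
  \sum_i (cos t * W i p.1 - sin t * Yv p.2 i 0) * partial i f (X t p).

Let speed_le (s : R) p i : `|cos s * W i p.1 - sin s * Yv p.2 i 0| <=
  `|Wv p.1 i 0| + `|Yv p.2 i 0|.
Proof.
rewrite [Wv _ _ _]mxE (le_trans (ler_normB _ _))// !normrM.
by rewrite lerD// ler_piMl.
Qed.

Let sum_radius p : \sum_i (`|Wv p.1 i 0| + `|Yv p.2 i 0|) <= kap * rho p.2.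
Proof. by rewrite big_split; exact: kapP. Qed.

Let lip_sin (s t : R) : s <= t -> `|sin t - sin s| <= t - s.
Proof.
move=> st; have [|c _ ->] := MVT_segment st (f := sin) (df := cos).
  by apply: continuous_subspaceT => x; exact: continuous_sin.
by rewrite normrM [X in _ * X]ger0_norm ?subr_ge0// ler_piMl// subr_ge0.
Qed.

Let lip_cos (s t : R) : s <= t -> `|cos t - cos s| <= t - s.
Proof.
move=> st; have [|c _ ->] := MVT_segment st (f := cos) (df := fun x => - sin x).
  by apply: continuous_subspaceT => x; exact: continuous_cos.
by rewrite normrM normrN [X in _ * X]ger0_norm ?subr_ge0// ler_piMl// subr_ge0.
Qed.

Let gradX_le i t p : `|partial i f (X t p)| <= (G0 + `|M2| * kap) * rho p.2.
Proof.
rewrite (le_trans (grad_growth _ _))// mulrDl lerD//.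
  by rewrite ler_peMr.
by rewrite -mulrA ler_wpM2l.
Qed.

Let C1 : R := kap * (G0 + `|M2| * kap *+ 2).

Let velocity_lip (s c : R) p : s <= c ->
  `|velocity c p - velocity s p| <= (c - s) * (C1 * rho p.2 ^+ 2).
Proof.
move=> sc; have cs0 : 0 <= c - s by rewrite subr_ge0.
have dX : l1 (X c p - X s p) <= (c - s) * (kap * rho p.2).
  rewrite (_ : X c p - X s p = (sin c - sin s) *: Wv p.1 + (cos c - cos s) *: Yv p.2).
    rewrite (le_trans (l1D _ _))// !l1Z.
    apply: (@le_trans _ _ ((c - s) * (l1 (Wv p.1) + l1 (Yv p.2)))).
      by rewrite mulrDr lerD// ler_wpM2r ?l1_ge0// ?lip_sin ?lip_cos.
    by rewrite ler_wpM2l.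
  by rewrite /X !scalerBl opprD addrACA.
rewrite /velocity -sumrB (le_trans (ler_norm_sum _ _ _))//.
apply: (@le_trans _ _ (\sum_i (`|Wv p.1 i 0| + `|Yv p.2 i 0|) *
   ((c - s) * ((G0 + `|M2| * kap *+ 2) * rho p.2)))); last first.
  rewrite -mulr_suml (le_trans (ler_wpM2r _ (sum_radius p)))//.
    by rewrite mulr_ge0// mulr_ge0// addr_ge0// mulrn_wge0// mulr_ge0.
  by apply: eq_ler; rewrite /C1; ring.
apply: ler_sum => i _.
set a := fun t => cos t * W i p.1 - sin t * Yv p.2 i 0.
rewrite (_ : _ - _ = (a c - a s) * partial i f (X c p) +
    a s * (partial i f (X c p) - partial i f (X s p))); last by rewrite /a; ring.
rewrite (le_trans (ler_normD _ _))// !normrM.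
set r := `|Wv _ _ _| + _.
have r0 : 0 <= r by rewrite addr_ge0.
have ha : `|a c - a s| <= (c - s) * r.
  rewrite (_ : a c - a s = (cos c - cos s) * W i p.1 - (sin c - sin s) * Yv p.2 i 0).
    rewrite (le_trans (ler_normB _ _))// !normrM mulrDr [Wv _ _ _]mxE.
    by rewrite lerD// ler_wpM2r// ?lip_sin ?lip_cos.
  by rewrite /a; ring.
have hd : `|partial i f (X c p) - partial i f (X s p)| <=
    (c - s) * (`|M2| * (kap * rho p.2)).
  rewrite (le_trans (lipschitz_partial _ _ (ddf i) (M2_norm i)))// mulrCA.
  by rewrite ler_wpM2l.
apply: (@le_trans _ _ ((c - s) * r * ((G0 + `|M2| * kap) * rho p.2) +
   r * ((c - s) * (`|M2| * (kap * rho p.2))))).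
  by apply: lerD; apply: ler_pM => //; exact: speed_le.
by apply: eq_ler; ring.
Qed.

Let increment (s t : R) p : s <= t ->
  `|f (X t p) - f (X s p) - (t - s) * velocity s p| <=
  C1 * (t - s) ^+ 2 * rho p.2 ^+ 2.
Proof.
move=> st; have ts0 : 0 <= t - s by rewrite subr_ge0.
have [c] := @MVT_curve _ _ f sin cos cos (fun x => - sin x) s t (Wv p.1) (Yv p.2) st df
  (@is_derive_sin R) (@is_derive_cos R).
rewrite in_itv /= => /andP[sc ct] ->.
rewrite (_ : \sum_i _ = velocity c p); last first.
  by apply: eq_bigr => i _; rewrite [Wv _ _ _]mxE mulNr.
rewrite [velocity c p * _]mulrC -mulrBr normrM ger0_norm//.
rewrite (le_trans (ler_wpM2l ts0 (velocity_lip p sc)))//.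
have C1r : 0 <= C1 * rho p.2 ^+ 2.
  by rewrite mulr_ge0 ?sqr_ge0// mulr_ge0// addr_ge0// mulrn_wge0// mulr_ge0.
apply: (@le_trans _ _ ((t - s) * ((t - s) * (C1 * rho p.2 ^+ 2)))).
  by rewrite ler_wpM2l// ler_wpM2r// lerB.
by apply: eq_ler; ring.
Qed.

Let C2 : R := kap * (G0 + `|M2| * kap).

Let WX_le i t p : `|W i p.1 * partial i f (X t p)| <= C2 * rho p.2 ^+ 2.
Proof.
rewrite normrM /C2 expr2 mulrACA; apply: ler_pM => //.
by apply: le_trans (l1W_kap p.1 p.2); have := coord_le_l1 (Wv p.1) i; rewrite mxE.
Qed.

Let YX_le i t p : `|Yv p.2 i 0 * partial i f (X t p)| <= C2 * rho p.2 ^+ 2.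
Proof.
rewrite normrM /C2 expr2 mulrACA; apply: ler_pM => //.
by apply: le_trans (l1Y_kap p.1 p.2); exact: coord_le_l1.
Qed.

Let HX_le i j t p : `|partial j (partial i f) (X t p)| <= `|M2| * rho p.2 ^+ 2.
Proof.
rewrite (le_trans (M2_norm i j _))// ler_peMr// expr_ge1//; exact: le_trans (rho_ge1 _).
Qed.

Let fX_le t p : `|f (X t p)| <= (`|f 0| + C2) * rho p.2 ^+ 2.
Proof.
have r2 : 1 <= rho p.2 ^+ 2 by rewrite expr_ge1.
rewrite (le_trans (f_growth _))// mulrDl lerD//; first by rewrite ler_peMr.
rewrite /C2 expr2 mulrACA; apply: ler_pM => //; first exact: l1_ge0.
  by rewrite addr_ge0// mulr_ge0// l1_ge0.
rewrite mulrDl lerD//; first by rewrite ler_peMr.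
by rewrite -mulrA ler_wpM2l.
Qed.

(** Integrating by parts in W and in Y produces the same second-order term
    sin t cos t (S S)_ij d_ij f with opposite signs. *)
Let Ex_velocity t : `|Ex PP (velocity t)| <= n%:R * Q.
Proof.
pose hess i := \sum_j (S *m S) i j * Ex PP (fun p => partial j (partial i f) (X t p)).
have mWX i : measurable_fun setT (fun p => W i p.1 * partial i f (X t p)).
  by apply: measurable_funM => //; exact: mX.
have mYX i : measurable_fun setT (fun p => Yv p.2 i 0 * partial i f (X t p)).
  by apply: measurable_funM => //; exact: mX.
have mHX i j : measurable_fun setT (fun p => partial j (partial i f) (X t p)).
  by apply: mX; exact: cddf.
have EW i : `|Ex PP (fun p => W i p.1 * partial i f (X t p)) - sin t * hess i| <= Q.
  have [i1 ->] := Ex21 (mWX i) (WX_le i t).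
  have i2 j := (Ex21 (mHX i j) (HX_le i j t)).1.
  rewrite /hess; under eq_bigr do rewrite (Ex21 (mHX i _) (HX_le i _ t)).2.
  have [i3 <-] := Ex_lincomb ((S *m S) i) i2.
  rewrite -ExZ// -ExB//; last exact: integZ.
  rewrite -[leRHS](Ex_cst P'); apply: Ex_norm_le.
  - by apply: integB => //; exact: integZ.
  - exact: integ_cst.
  - move=> w'; exact: (steinW i (cos t *: Yv w') (sin_le1 t)).
have EY i : Ex PP (fun p => Yv p.2 i 0 * partial i f (X t p)) = cos t * hess i.
  have [i1 ->] := Ex12 (mYX i) (YX_le i t).
  have i2 j := (Ex12 (mHX i j) (HX_le i j t)).1.
  rewrite /hess; under [in RHS]eq_bigr do rewrite (Ex12 (mHX i _) (HX_le i _ t)).2.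
  have [i3 <-] := Ex_lincomb ((S *m S) i) i2.
  rewrite -ExZ//; congr Ex; apply/funext => w.
  have XE w' : cos t *: Yv w' + sin t *: Wv w = X t (w, w') by rewrite addrC.
  apply: (etrans _ (etrans (stein_gauss i (cos t) (sin t *: Wv w)) _)).
    apply: (f_equal (Ex P')); apply/funext => w'.
    exact: (f_equal (fun z => Yv w' i 0 * partial i f z) (esym (XE w'))).
  apply: (f_equal (fun z => cos t * z)); apply: eq_bigr => j _.
  apply: (f_equal (fun z => (S *m S) i j * z)); apply: (f_equal (Ex P')).
  apply/funext => w'; exact: (f_equal (partial j (partial i f)) (XE w')).
have -> : Ex PP (velocity t) = \sum_i cos t *
    (Ex PP (fun p => W i p.1 * partial i f (X t p)) - sin t * hess i).
  rewrite (_ : velocity t = fun p => \sum_i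
      (cos t * (W i p.1 * partial i f (X t p)) - sin t * (Yv p.2 i 0 * partial i f (X t p)))).
    rewrite Ex_sum.
      apply: eq_bigr => i _; rewrite ExB.
      - rewrite !ExZ ?EY; first by ring.
        + exact: (integ_PP (mYX i) (YX_le i t)).
        + exact: (integ_PP (mWX i) (WX_le i t)).
      - apply: integZ; exact: (integ_PP (mWX i) (WX_le i t)).
      - apply: integZ; exact: (integ_PP (mYX i) (YX_le i t)).
    move=> i; apply: integB; apply: integZ.
      exact: (integ_PP (mWX i) (WX_le i t)).
    exact: (integ_PP (mYX i) (YX_le i t)).
  by apply/funext => p; apply: eq_bigr => i _; ring.
rewrite (le_trans (ler_norm_sum _ _ _))// mulr_natl -[n in _ *+ n]card_ord -sumr_const.
apply: ler_sum => i _; rewrite normrM; apply: le_trans (EW i).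
by rewrite ler_piMl.
Qed.

(** Along the path sin t W + cos t Y the two integrations by parts cancel, so
    that only the error of the first one remains in the derivative. *)
Lemma smart_path_bound :
  integ P (fun w => f (Wv w)) /\ integ P' (fun w' => f (Yv w')) /\
  `|Ex P (fun w => f (Wv w)) - Ex P' (fun w' => f (Yv w'))| <= 2 * (n%:R * Q).
Proof.
have mf t : measurable_fun setT (fun p => f (X t p)) by exact: mX.
have X1 p : X (pi / 2) p = Wv p.1.
  by rewrite /X sin_pihalf cos_pihalf scale1r scale0r addr0.
have X0 p : X 0 p = Yv p.2.
  by rewrite /X sin0 cos0 scale1r scale0r add0r.
have iW : integ P (fun w => f (Wv w)).
  have := sec2 point (mf (pi / 2)) (fX_le (pi / 2)).
  by under [X in integ P X]eq_fun do rewrite X1.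
have iY : integ P' (fun w' => f (Yv w')).
  have := sec1 point (mf 0) (fX_le 0).
  by under [X in integ P' X]eq_fun do rewrite X0.
split=> //; split=> //.
have -> : Ex P (fun w => f (Wv w)) = phi (pi / 2).
  rewrite /phi (Ex12 (mf _) (fX_le _)).2; congr Ex; apply/funext => w.
  rewrite -[LHS](Ex_cst P'); congr Ex; apply/funext => w'.
  by rewrite X1.
have -> : Ex P' (fun w' => f (Yv w')) = phi 0.
  rewrite /phi (Ex21 (mf _) (fX_le _)).2; congr Ex; apply/funext => w'.
  rewrite -[LHS](Ex_cst P); congr Ex; apply/funext => w.
  by rewrite X0.
have ifX t : integ PP (fun p => f (X t p)) by exact: (integ_PP (mf t) (fX_le t)).
have ivel t : integ PP (velocity t).
  apply: integ_sum => i.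
  rewrite (_ : (fun p => _) = fun p =>
      (cos t * (W i p.1 * partial i f (X t p)) - sin t * (Yv p.2 i 0 * partial i f (X t p)))).
    apply: integB; apply: integZ.
      by apply: (integ_PP _ (WX_le i t)); apply: measurable_funM => //; exact: mX.
    by apply: (integ_PP _ (YX_le i t)); apply: measurable_funM => //; exact: mX.
  by apply/funext => p; ring.
have nQ0 : 0 <= n%:R * Q by apply: le_trans (Ex_velocity 0).
have pi0 : 0 <= pi / 2 :> R by rewrite divr_ge0// pi_ge0.
apply: (@le_trans _ _ (n%:R * Q * (pi / 2 - 0))); last first.
  by rewrite subr0 mulrC ler_wpM2r// ltW// pihalf_lt2.
apply: (@quadratic_increment _ phi 0 (pi / 2) (n%:R * Q)
  (C1 * Ex PP (fun p => rho p.2 ^+ 2)) pi0) => s t st.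
have ts0 : 0 <= t - s by rewrite subr_ge0.
have -> : phi t - phi s = (t - s) * Ex PP (velocity s) +
    Ex PP (fun p => f (X t p) - f (X s p) - (t - s) * velocity s p).
  rewrite ExB; [|exact: integB|exact: integZ].
  by rewrite ExB// ExZ// subrKC.
rewrite (le_trans (ler_normD _ _))// lerD//.
  by rewrite normrM (ger0_norm ts0) mulrC ler_wpM2r.
rewrite mulrAC -ExZ//; apply: Ex_norm_le.
- by apply: integB; [exact: integB|exact: integZ].
- exact: integZ.
- by move=> p; exact: increment.
Qed.

End SmartPath.

(** * Paths and loops as connected graphs *)

Section Trails.
Variable N : nat.
Implicit Types (u a b : 'I_N) (f : edge N) (q : nat -> 'I_N) (p : seq 'I_N).

Lemma incident_mk_edge u a b : incident u (mk_edge a b) = (u == a) || (u == b).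
Proof. by rewrite /mk_edge /incident; case: ifP => //= _; rewrite orbC. Qed.

Lemma is_edge_mk_edge a b : a != b -> is_edge (mk_edge a b).
Proof.
rewrite /mk_edge /is_edge => ab; case: ifPn => //=; rewrite -leqNgt => ba.
by rewrite ltn_neqAle ba andbT eq_sym.
Qed.

Lemma mk_edge_eq a b a' b' : mk_edge a b = mk_edge a' b' ->
  (a = a' /\ b = b') \/ (a = b' /\ b = a').
Proof.
rewrite /mk_edge; case: ifP => _; case: ifP => _ [-> ->]; by [left|right].
Qed.

(** Paths and loops are both treated as the edges of a walk q of k steps; for a loop
    the walk is periodic. *)
Definition trail_edges q k : {set edge N} :=
  [set mk_edge (q i) (q i.+1) | i : 'I_k]%SET.

Lemma trail_edgesP f q k :
  reflect (exists2 i, (i < k)%N & f = mk_edge (q i) (q i.+1)) (f \in trail_edges q k).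
Proof.
apply: (iffP imsetP) => [[i _ ->]|[i ik ->]]; first by exists i.
by exists (Ordinal ik).
Qed.

(** Consecutive edges of a walk share a vertex, so a closed set of edges spreads in
    both directions from any of its members. *)
Lemma connected_trail q k : connected_graph (trail_edges q k).
Proof.
move=> H /set0Pn[f fH] /fintype.subsetP HG cl; apply/eqP.
rewrite finset.eqEsubset; apply/andP; split; apply/fintype.subsetP => // g.
pose e i := mk_edge (q i) (q i.+1).
have eG i : (i < k)%N -> e i \in trail_edges q k by move=> ik; apply/trail_edgesP; exists i.
have up i : (i.+1 < k)%N -> e i \in H -> e i.+1 \in H.
  move=> ik ei; apply: (cl (e i) _ (q i.+1)) => //; first exact: eG.
    by rewrite incident_mk_edge eqxx orbT.
  by rewrite incident_mk_edge eqxx.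
have down i : (i.+1 < k)%N -> e i.+1 \in H -> e i \in H.
  move=> ik ei; apply: (cl (e i.+1) _ (q i.+1)) => //; first by apply: eG; lia.
    by rewrite incident_mk_edge eqxx.
  by rewrite incident_mk_edge eqxx orbT.
have /trail_edgesP[i ik fE] := HG _ fH; rewrite {}fE -/(e i) in fH.
have e0 : e 0%N \in H.
  by elim: i ik fH => // i ih ik ei; apply: ih; [lia|exact: down].
case/trail_edgesP => j jk ->; rewrite -/(e j).
by elim: j jk => // j ih jk; apply: up => //; apply: ih; lia.
Qed.

Lemma verts_trail q k : (0 < k)%N ->
  verts (trail_edges q k) = [set q i | i : 'I_k.+1]%SET.
Proof.
move=> k0; apply/setP => u; apply/vertsP/imsetP.
  move=> [f /trail_edgesP[i ik ->]]; rewrite incident_mk_edge.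
  case/orP => /eqP ->; first by exists (inord i) => //; rewrite inordK//; lia.
  by exists (inord i.+1) => //; rewrite inordK.
move=> [[i /= ik] _ ->]; have [il|il] := ltnP i k.
  by exists (mk_edge (q i) (q i.+1)); [apply/trail_edgesP; exists i|rewrite incident_mk_edge eqxx].
have ii : (i.-1.+1 = i)%N by lia.
exists (mk_edge (q i.-1) (q i.-1.+1)); last by rewrite incident_mk_edge ii eqxx orbT.
by apply/trail_edgesP; exists i.-1 => //; lia.
Qed.

Lemma card_trail q k :
  (forall i j, (i < k)%N -> (j < k)%N ->
     mk_edge (q i) (q i.+1) = mk_edge (q j) (q j.+1) -> i = j) ->
  #|trail_edges q k| = k.
Proof.
move=> inj; rewrite card_imset ?card_ord// => i j ij.
by apply: val_inj; apply: (inj _ _ (ltn_ord i) (ltn_ord j)).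
Qed.

Lemma only_edges_trail q k : (forall i, (i < k)%N -> q i != q i.+1) ->
  forall f, f \in trail_edges q k -> is_edge f.
Proof. by move=> h f /trail_edgesP[i ik ->]; apply: is_edge_mk_edge; exact: h. Qed.

Lemma path_edges_trail x0 p : path_edges p = trail_edges (nth x0 p) (size p).-1.
Proof.
apply/setP => f; rewrite inE; apply/mapP/trail_edgesP.
  move=> [[a b] /(nthP (x0, x0))[i]]; rewrite size_zip size_behead => ip.
  have /andP[_ ip'] : (i < size p)%N && (i < (size p).-1)%N by rewrite -leq_min.
  rewrite nth_zip_cond size_zip size_behead ip => -[<- <-] ->.
  by exists i => //=; rewrite nth_behead.
move=> [i ip ->]; exists (nth x0 p i, nth x0 p i.+1) => //.
have ip' : (i < size p)%N := leq_trans ip (leq_pred _).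
have iz : (i < size (zip p (behead p)))%N.
  by rewrite size_zip size_behead leq_min ip ip'.
apply/(nthP (x0, x0)); exists i => //.
by rewrite nth_zip_cond iz nth_behead.
Qed.

Lemma nth_rot1 x0 p i : (i < size p)%N ->
  nth x0 (rot 1 p) i = nth x0 p (i.+1 %% size p).
Proof.
case: p => // a p; rewrite rot1_cons nth_rcons /= ltnS => ip.
have [il|il] := ltnP i (size p); first by rewrite modn_small.
have -> : i = size p by lia.
by rewrite eqxx modnn.
Qed.

Lemma loop_edges_trail x0 p :
  loop_edges p = trail_edges (fun i => nth x0 p (i %% size p)) (size p).
Proof.
apply/setP => f; rewrite inE; apply/mapP/trail_edgesP.
  move=> [[a b] /(nthP (x0, x0))[i]]; rewrite size_zip size_rot minnn => ip.
  rewrite nth_zip ?size_rot// => -[<- <-] ->; exists i => //=.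
  by rewrite modn_small// nth_rot1.
move=> [i ip ->]; exists (nth x0 p (i %% size p), nth x0 p (i.+1 %% size p)) => //.
apply/(nthP (x0, x0)); exists i; first by rewrite size_zip size_rot minnn.
by rewrite nth_zip ?size_rot// nth_rot1// (modn_small ip).
Qed.

Lemma path_family l : (0 < l)%N ->
  graph_family [set G | @is_path N l G]%SET l.+1 l.
Proof.
move=> l0 G; rewrite inE => /existsP[p /andP[up /eqP ->]].
have x0 : 'I_N := tnth p ord0.
rewrite (path_edges_trail x0) size_tuple /=.
have inj i j : (i <= l)%N -> (j <= l)%N -> nth x0 p i = nth x0 p j -> i = j.
  move=> il jl /eqP; rewrite nth_uniq ?size_tuple// => /eqP //.
split.
- rewrite verts_trail// card_imset ?card_ord// => i j /inj ij.
  by apply: val_inj; apply: ij; rewrite -ltnS.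
- apply: card_trail => i j il jl /mk_edge_eq[[/inj-> //]|[/inj h1 /inj h2]]; [lia|lia|].
  by have := h1 _ _; have := h2 _ _; lia.
- apply: only_edges_trail => i il; apply/eqP => /inj h; have := h _ _; lia.
- exact: connected_trail.
Qed.

(** The bound on l matters: a closed walk of length two uses its edge twice. *)
Lemma loop_family l : (2 < l)%N ->
  graph_family [set G | @is_loop N l G]%SET l l.
Proof.
move=> l2 G; rewrite inE => /existsP[p /andP[up /eqP ->]].
have l0 : (0 < l)%N by lia.
have x0 : 'I_N := tnth p (Ordinal l0).
rewrite (loop_edges_trail x0) size_tuple /=.
set q := fun i => nth x0 p (i %% l).
have inj i j : q i = q j -> i = j %[mod l].
  by move=> /eqP; rewrite nth_uniq ?size_tuple ?ltn_pmod// => /eqP.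
have next i : (i < l)%N -> (i.+1 %% l)%N = if (i.+1 == l)%N then 0%N else i.+1.
  by move=> il; case: eqP => [->|ne]; rewrite ?modnn// modn_small//; lia.
split.
- rewrite verts_trail//.
  have -> : [set q i | i : 'I_l.+1]%SET = [set q i | i : 'I_l]%SET.
    apply/setP => u; apply/imsetP/imsetP => -[i _ ->].
      exists (Ordinal (ltn_pmod i l0)) => //=.
      by rewrite /q modn_mod.
    by exists (widen_ord (leqnSn l) i).
  rewrite card_imset ?card_ord// => i j /inj.
  by rewrite !modn_small// => ij; exact: val_inj.
- apply: card_trail => i j il jl /mk_edge_eq[[/inj + _]|[/inj + /inj]].
    by rewrite !modn_small.
  rewrite !next// !modn_small//; case: eqP; case: eqP; lia.
- apply: only_edges_trail => i il; apply/eqP => /inj.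
  by rewrite next// modn_small//; case: eqP; lia.
- exact: connected_trail.
Qed.

End Trails.

(** * The normalised couplings *)

Section Tanh.
Context {R : realType}.
Implicit Types x y : R.

Lemma expR_sum_gt0 x : 0 < expR x + expR (- x).
Proof. by rewrite addr_gt0// expR_gt0. Qed.

Lemma tanhN x : tanh (- x) = - tanh x.
Proof. by rewrite /tanh opprK -mulNr opprB; congr (_ / _); exact: addrC. Qed.

Lemma tanh0 : tanh 0 = 0 :> R.
Proof. by rewrite /tanh oppr0 subrr mul0r. Qed.

Lemma tanh_le1 x : `|tanh x| <= 1.
Proof.
have e1 := expR_gt0 x; have e2 := expR_gt0 (- x).
rewrite /tanh normrM normfV (gtr0_norm (expR_sum_gt0 x)).
rewrite ler_pdivrMr ?expR_sum_gt0// mul1r ler_norml; apply/andP; split; lra.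
Qed.

Lemma tanh_ge0 x : 0 <= x -> 0 <= tanh x.
Proof.
move=> x0; rewrite divr_ge0 ?(ltW (expR_sum_gt0 x))// subr_ge0 ler_expR.
by rewrite ge0_cp.
Qed.

(** Up to a factor two, g is x cosh x - sinh x, whose derivative x sinh x is
    nonnegative on the half-line. *)
Lemma tanh_le_id x : 0 <= x -> tanh x <= x.
Proof.
move=> x0; rewrite /tanh ler_pdivrMr ?expR_sum_gt0// -subr_ge0.
pose g y := y * (expR y + expR (- y)) - (expR y - expR (- y)).
have dg (y : R) : is_derive y 1 g (y * (expR y - expR (- y))).
  by rewrite /g; apply: is_derive_eq; rewrite /GRing.scale /=; ring.
have [|c] := MVT_segment x0 (f := g) (df := fun y => y * (expR y - expR (- y))).
  apply: continuous_subspaceT => y.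
  by apply: differentiable_continuous; apply/derivable1_diffP; case: (dg y).
rewrite in_itv /= => /andP[c0 _].
have -> : g 0 = 0 by rewrite /g oppr0; ring.
rewrite !subr0 /g => ->; apply: mulr_ge0 => //; apply: mulr_ge0 => //.
by rewrite subr_ge0 ler_expR ge0_cp.
Qed.

Lemma tanh_le_norm x : `|tanh x| <= `|x|.
Proof.
have [x0|/ltW x0] := leP 0 x.
  by rewrite !ger0_norm ?tanh_ge0// tanh_le_id.
rewrite -normrN -tanhN -[`|x|]normrN.
by rewrite !ger0_norm ?tanh_ge0 ?oppr_ge0// tanh_le_id// oppr_ge0.
Qed.

Lemma continuous_tanh : continuous (@tanh R).
Proof.
have cN : continuous (@expR R \o -%R).
  by move=> y; apply: continuous_comp; [exact: opp_continuous|exact: continuous_expR].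
move=> x; apply: (@cvgM _ _ (nbhs x) _ (fun y => expR y - expR (- y))
   (fun y => (expR y + expR (- y))^-1)).
  by apply: (@cvgB _ R^o); [exact: continuous_expR|exact: cN].
apply: cvgV; first by rewrite gt_eqF// expR_sum_gt0.
by apply: (@cvgD _ R^o); [exact: continuous_expR|exact: cN].
Qed.

End Tanh.

Section Coupling.
Context {R : realType}.
Variables (mu : probability R R) (beta r : R).
Hypothesis beta01 : 0 < beta < 1.
Hypothesis r_gt0 : 0 < r.
Hypothesis sym_mu : symmetric_law mu.
Hypothesis mu6 : ('E_mu[fun x : R => (x ^+ 6)%R] < +oo)%E.

(** With r = sqrt N this is sqrt N times the variable omega of an edge, scaled so that
    its moments are bounded uniformly in N. *)
Definition chi t := r * tanh (beta * t / r).

Lemma chi_bm : bm chi.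
Proof.
split.
  apply: measurable_funM => //; apply: continuous_measurable_fun => t.
  apply: (@continuous_comp _ _ _ (fun t => beta * t / r) (@tanh R)).
    by apply: cvgM; [apply: cvgM; [exact: cvg_cst|exact: cvg_id]|exact: cvg_cst].
  exact: continuous_tanh.
exists r => t; rewrite normrM (gtr0_norm r_gt0) ler_piMr ?tanh_le1//.
exact: ltW.
Qed.

Lemma chi_le t : `|chi t| <= `|t|.
Proof.
have [b0 b1] := andP beta01.
rewrite normrM (gtr0_norm r_gt0).
apply: (@le_trans _ _ (r * `|beta * t / r|)).
  by rewrite ler_wpM2l ?(ltW r_gt0)// tanh_le_norm.
rewrite !normrM normfV (gtr0_norm r_gt0) (gtr0_norm b0) mulrC divfK ?gt_eqF//.
by rewrite ler_piMl// ltW.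
Qed.

Lemma chiN t : chi (- t) = - chi t.
Proof. by rewrite /chi mulrN mulNr tanhN mulrN. Qed.

(** The summand 1 makes this constant dominate the lower moments as well. *)
Definition mom6 : R := 1 + Ex mu (fun t => t ^+ 6).

Lemma mu6_integ : integ mu (fun t => t ^+ 6).
Proof.
apply/integrableP; split; first by apply/measurable_EFinP; exact: measurable_funX.
move: mu6; rewrite unlock; apply: le_lt_trans; rewrite le_eqVlt; apply/orP; left.
apply/eqP; apply: eq_integral => t _ /=.
by rewrite ger0_norm// exprn_even_ge0.
Qed.

Lemma mom6_ge1 : 1 <= mom6.
Proof. by rewrite lerDl; apply: Ex_ge0 => t; rewrite exprn_even_ge0. Qed.

Lemma pow_le_six (a : R) k : (k <= 6)%N -> `|a| ^+ k <= 1 + a ^+ 6.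
Proof.
move=> k6; rewrite -[a ^+ 6]ger0_norm ?exprn_even_ge0// normrX.
have [a1|a1] := leP `|a| 1.
  by apply: (@le_trans _ _ 1); [exact: exprn_ile1|rewrite lerDl exprn_ge0].
apply: (@le_trans _ _ (`|a| ^+ 6)); first by rewrite ler_weXn2l// ltW.
by rewrite lerDr.
Qed.

Lemma chi_moment k : (k <= 6)%N -> Ex mu (fun t => `|chi t| ^+ k) <= mom6.
Proof.
move=> k6; rewrite /mom6 -{1}(Ex_cst mu 1) -ExD; [|exact: integ_cst|exact: mu6_integ].
apply: Ex_le.
- by apply: bm_integ; apply: bmX; apply: bm_norm; exact: chi_bm.
- by apply: integD; [exact: integ_cst|exact: mu6_integ].
- move=> t; apply: le_trans (pow_le_six t k6).
  by rewrite lerXn2r ?nnegrE ?chi_le.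
Qed.

Let oppR : R -> R := fun t => - t.

Let measurable_oppR : measurable_fun setT oppR.
Proof. exact: oppr_measurable. Qed.

HB.instance Definition _ := @isMeasurableFun.Build _ _ _ _ oppR measurable_oppR.

Lemma odd_mean (u : R -> R) : bm u -> (forall t, u (- t) = - u t) -> Ex mu u = 0.
Proof.
move=> bu uN.
have E : Ex mu u = Ex mu (fun t : R => u (- t)).
  rewrite /Ex /Rintegral; congr fine.
  have mu' : measurable_fun setT (EFin \o u) by apply/measurable_EFinP; case: bu.
  have buN : bm (fun t : R => u (- t)).
    have [m1 [M uM]] := bu; split; first exact: measurableT_comp.
    by exists M => t.
  rewrite -[RHS](@integral_distribution _ _ _ _ _ mu oppR (EFin \o u))//.
    by apply: eq_measure_integral => A mA _; exact/esym/sym_mu.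
  exact: (bm_integ mu buN).
have : Ex mu u = - Ex mu u.
  rewrite {1}E -[RHS]mulN1r -ExZ; last exact: bm_integ.
  by congr Ex; apply/funext => t; rewrite uN mulN1r.
by move=> h; lra.
Qed.

Lemma chi_mean : Ex mu chi = 0.
Proof. by apply: odd_mean; [exact: chi_bm|exact: chiN]. Qed.

Lemma chi_mean3 : Ex mu (fun t => chi t ^+ 3) = 0.
Proof.
apply: odd_mean; first by apply: bmX; exact: chi_bm.
by move=> t; rewrite chiN exprNn -signr_odd /= expr1 mulN1r.
Qed.

End Coupling.

(** * The spin glass statistics *)

Section Model.
Context {d : measure_display} {T : measurableType d} {R : realType}.
Variables (P : probability T R) (J : nat -> nat -> {RV P >-> R}).
Variables (mu : probability R R) (beta h : R) (m N : nat).
Hypothesis m_ge3 : (3 <= m)%N.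
Hypothesis beta01 : 0 < beta < 1.
Hypothesis sym_mu : symmetric_law mu.
Hypothesis mu6 : ('E_mu[fun x : R => (x ^+ 6)%R] < +oo)%E.
Hypothesis N_gt0 : (0 < N)%N.
Hypothesis indJ : mutually_independent P (fun e : nat * nat => (e.1 < e.2)%N)
    (fun e => J e.1 e.2 : T -> R).
Hypothesis lawJ : forall i j, (i < j)%N -> has_law (J i j) mu.

Implicit Types (e f : edge N) (k : 'I_(2 * m).-1).

Let r : R := Num.sqrt N%:R.

Let r_gt0 : 0 < r. Proof. by rewrite sqrtr_gt0 ltr0n. Qed.

Let r2 : r ^+ 2 = N%:R. Proof. by rewrite sqr_sqrtr. Qed.

Let ch := chi beta r.

Let ch_bm : bm ch. Proof. exact: chi_bm. Qed.

Lemma Ex_law i j (u : R -> R) : (i < j)%N -> bm u ->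
  Ex P (fun w => u (J i j w)) = Ex mu u.
Proof.
move=> ij bu; rewrite /Ex /Rintegral; congr fine.
have mu' : measurable_fun setT (EFin \o u) by apply/measurable_EFinP; case: bu.
rewrite -[LHS](@integral_distribution _ _ _ _ _ P (J i j) (EFin \o u))//.
  by apply: eq_measure_integral => A mA _; exact: lawJ.
have buJ : bm (fun w => u (J i j w)).
  have [m1 [M uM]] := bu; split; first exact: measurableT_comp.
  by exists M => w.
exact: (bm_integ P buJ).
Qed.

(** Zero for the pairs that are not edges, so that sums may run over all pairs. *)
Definition coupling e w : R := if is_edge e then J e.1 e.2 w else 0.

Definition spin e w : R := ch (coupling e w).

Definition mom2 : R := Ex mu (fun t => ch t ^+ 2).

Definition is_square k := ((m - 2) + m <= k)%N.

Definition family k : {set {set edge N}} :=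
  if (k < m - 2)%N then [set G | @is_loop N (k + 3) G]%SET
  else [set G | @is_path N (k - (m - 2)).+1 G]%SET.

Definition len k : nat :=
  if (k < m - 2)%N then (k + 3)%N
  else if (k < (m - 2) + m)%N then (k - (m - 2)).+1 else 1%N.

Definition nvert k : nat :=
  if (k < m - 2)%N then (k + 3)%N
  else if (k < (m - 2) + m)%N then (k - (m - 2)).+2 else 2%N.

(** The statistics are written in terms of the spins, whose moments do not depend
    on N up to constants; weight k collects all the powers of N. *)
Definition weight k : R :=
  if (k < m - 2)%N then r ^- len k
  else if (k < (m - 2) + m)%N then tanh h ^+ 2 * r ^- len k else N%:R^-1.

Definition factor k t : R := if is_square k then ch t ^+ 2 - mom2 else ch t.

(** The coefficient of factor k (coupling e) in stat k, with multiplicity len k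
    (see stat_decomp). It does not involve the coupling of e. *)
Definition cofactor k e w : R :=
  if is_square k then weight k * (is_edge e)%:R
  else weight k * star spin (family k) e w.

Definition stat k w : R := Wvec J beta h N m w k 0.

Lemma coupling_edge e w : is_edge e -> coupling e w = J e.1 e.2 w.
Proof. by rewrite /coupling => ->. Qed.

Lemma spin_omega e w : is_edge e -> spin e w = r * omega J beta N e.1 e.2 w.
Proof. by move=> ee; rewrite /spin coupling_edge. Qed.

Lemma omega_spin e w : is_edge e -> omega J beta N e.1 e.2 w = r^-1 * spin e w.
Proof. by move=> ee; rewrite spin_omega// mulKf// gt_eqF. Qed.

Lemma family_ok k : ~~ is_square k -> graph_family (family k) (nvert k) (len k).
Proof.
rewrite /is_square -ltnNge => kQ; rewrite /family /nvert /len kQ.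
case: ifP => _; first by apply: loop_family; lia.
exact: path_family.
Qed.

Lemma len_gt0 k : (0 < len k)%N.
Proof. by rewrite /len; case: ifP => _; [lia|case: ifP]. Qed.

Lemma omega_set_spin (G : {set edge N}) w : (forall f, f \in G -> is_edge f) ->
  omega_set J beta G w = r ^- #|G| * monomial spin G w.
Proof.
move=> Ge; rewrite /omega_set /monomial -exprVn -prodr_const -big_split.
by apply: eq_bigr => f fG; rewrite omega_spin// Ge.
Qed.

Lemma stat_graph k w : ~~ is_square k ->
  stat k w = weight k * \sum_(G in family k) monomial spin G w.
Proof.
move=> kQ; have ok := family_ok kQ; move: (kQ); rewrite /is_square -ltnNge => kQ'.
have red (G : {set edge N}) : G \in family k ->
    omega_set J beta G w = r ^- len k * monomial spin G w.
  by move=> /ok[_ <- Ge _]; exact: omega_set_spin.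
rewrite /stat mxE; move: red; rewrite /weight /family kQ'; case: ifP => _ red.
  rewrite /Lstat mulr_sumr; apply: eq_big => [G|G lG]; first by rewrite inE.
  by rewrite red// inE.
rewrite /Pstat -mulrA; congr (_ * _); rewrite mulr_sumr.
apply: eq_big => [G|G lG]; first by rewrite inE.
by rewrite red// inE.
Qed.

Lemma mom2_zeta2 : mom2 = N%:R * zeta2 J beta N.
Proof.
rewrite /zeta2 unlock -[fine _]/(Ex P (fun w => omega J beta N 0 1 w ^+ 2)).
rewrite /mom2 -(Ex_law (i := 0%N) (j := 1%N))//; last exact: bmX.
rewrite -ExZ; last first.
  apply: bm_integ; apply: bmX; rewrite /omega -/r.
  have [m1 [M uM]] := ch_bm; split.
    have : measurable_fun setT (fun w => r^-1 * ch (J 0%N 1%N w)).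
      by apply: measurable_funM => //; exact: measurableT_comp.
    by apply: eq_measurable_fun => w _; rewrite /ch /chi mulKf// gt_eqF.
  by exists 1 => w; exact: tanh_le1.
by congr Ex; apply/funext => w; rewrite -r2 -exprMn.
Qed.

Lemma stat_square k w : is_square k ->
  stat k w = weight k * \sum_(e | is_edge e) (spin e w ^+ 2 - mom2).
Proof.
rewrite /is_square => kQ; rewrite /stat mxE /weight.
rewrite ifN -?leqNgt; last by lia.
rewrite ifN -?leqNgt// ifN -?leqNgt; last by lia.
rewrite ifN -?leqNgt// /Qstat mulr_sumr; apply: eq_bigr => e ee.
rewrite spin_omega// mom2_zeta2 [(r * _) ^+ 2]exprMn r2 -mulrBr mulKf//.
by rewrite pnatr_eq0 -lt0n.
Qed.

(** A loop has as many vertices as edges. A path has one vertex more, which is paid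
    for by tanh h ^ 4 = O(1/N): the scaling of h enters only here. *)
Lemma weight_le rho k : (tanh h ^+ 2) ^+ 2 <= rho / N%:R -> 0 <= rho ->
  weight k ^+ 2 <= (1 + rho) * N%:R ^- nvert k.
Proof.
move=> h4 rho0; have N0 : 0 < N%:R :> R by rewrite ltr0n.
have rl l : (r ^- l) ^+ 2 = N%:R ^- l by rewrite exprVn -exprM mulnC exprM r2.
have Nl l : 0 <= N%:R ^- l :> R by rewrite invr_ge0 exprn_ge0.
rewrite /weight /nvert /len; case: (k < m - 2)%N.
  by rewrite rl ler_peMl// lerDl.
case: (k < m - 2 + m)%N; last by rewrite exprVn ler_peMl// lerDl.
rewrite exprMn rl [in leRHS]exprS invfM mulrA ler_wpM2r//.
by rewrite (le_trans h4)// ler_wpM2r ?invr_ge0// lerDr.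
Qed.

Let K : R := mom6 mu.

Let XX (ij : nat * nat) : {mfun T >-> R} := J ij.1 ij.2.

Let DD : {pred nat * nat} := fun ij => (ij.1 < ij.2)%N.

Let vpair e : nat * nat := (e.1 : nat, e.2 : nat).

Let vpair_inj : injective vpair.
Proof. by move=> [a b] [a' b'] [/val_inj -> /val_inj ->]. Qed.

(** The events that concern the other edges. For a pair that is not an edge the
    coupling is constant, hence independent of everything. *)
Definition others e : set (set T) :=
  if is_edge e then cyl DD XX (vpair e) else measurable.

Lemma others_measurable e : others e `<=` measurable.
Proof.
by rewrite /others; case: ifP => _ //; exact: cyl_measurable.
Qed.

Lemma coupling_measurable e : measurable_fun setT (coupling e).
Proof.
rewrite (_ : coupling e = if is_edge e then (J e.1 e.2 : T -> R) else cst 0).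
  by case: ifP => _; [exact: measurable_funP|exact: measurable_cst].
by apply/funext => w; rewrite /coupling; case: ifP.
Qed.

Lemma coupling_indep e (u : R -> R) (V : g_sigma_algebraType (others e) -> R) :
  bm u -> bm V -> Ex P (fun w => u (coupling e w) * V w) =
  Ex P (fun w => u (coupling e w)) * Ex P (V : T -> R).
Proof.
move: V; rewrite /coupling /others; case: ifPn => ee V bu bV.
  have [mu' [a ua]] := bu; have [mV [b Vb]] := bV.
  exact: (@Ex_indep_mul _ _ _ P _ DD XX indJ (vpair e) u V a b).
have bVT : bm (V : T -> R).
  have [mV Vb] := bV; split => // _ A mA; rewrite setTI.
  have := mV measurableT A mA; rewrite setTI.
  exact: (smallest_sub (@sigma_algebra_measurable _ T) (@subset_refl _ _)).
by rewrite Ex_cst ExZ//; exact: bm_integ.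
Qed.

Lemma measurable_ch (d0 : measure_display) (T0 : measurableType d0) (V : T0 -> R) :
  measurable_fun setT V -> bm (fun w => ch (V w)).
Proof.
move=> mV; have [m1 [M uM]] := ch_bm; split; first exact: measurableT_comp.
by exists M => w.
Qed.

Lemma spin_bm e : bm (spin e).
Proof. exact: measurable_ch (coupling_measurable e). Qed.

Lemma spin_non_edge e : ~~ is_edge e -> spin e = cst 0.
Proof.
move=> ne; apply/funext => w; rewrite /spin /coupling (negbTE ne) /ch /chi.
by rewrite mulr0 mul0r tanh0 mulr0.
Qed.

Lemma spin_others e f : f != e ->
  bm (spin f : g_sigma_algebraType (others e) -> R).
Proof.
move=> fe; have [ef|nf] := boolP (is_edge f); last first.
  by rewrite spin_non_edge//; exact: bm_cst.
rewrite (_ : spin f = fun w => ch (J f.1 f.2 w)); last first.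
  by apply/funext => w; rewrite /spin coupling_edge.
apply: measurable_ch; rewrite /others; case: ifPn => ee.
  apply: (@measurable_cyl _ _ _ _ DD XX (vpair e) (vpair f)) => //.
move=> _ A mA; rewrite setTI; apply: sub_sigma_algebra.
by rewrite -[X in measurable X]setTI; exact: measurable_funP.
Qed.

Lemma Ex_spin e (u : R -> R) : is_edge e -> bm u ->
  Ex P (fun w => u (coupling e w)) = Ex mu u.
Proof.
move=> ee bu; rewrite -(Ex_law ee bu); congr Ex; apply/funext => w.
by rewrite coupling_edge.
Qed.

Lemma ch_moment (k : nat) : (k <= 6)%N -> `|Ex mu (fun t => ch t ^+ k)| <= K.
Proof.
move=> k6; apply: le_trans (chi_moment beta01 r_gt0 mu6 k6).
apply: Ex_norm_le.
- by apply: bm_integ; exact: bmX.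
- by apply: bm_integ; apply: bmX; exact: bm_norm.
- by move=> t; rewrite normrX.
Qed.

Lemma spin_mean e : is_edge e -> Ex P (spin e) = 0.
Proof. by move=> ee; rewrite (Ex_spin (u := ch) ee)// chi_mean. Qed.

Lemma spin_moment e (k : nat) : is_edge e -> (k <= 4)%N ->
  `|Ex P (fun w => spin e w ^+ k)| <= K.
Proof.
move=> ee k4; rewrite (Ex_spin (u := fun t => ch t ^+ k) ee); last exact: bmX.
by apply: ch_moment; lia.
Qed.

Lemma spin_prod (k : edge N -> nat) : (forall f, ~~ is_edge f -> k f = 0%N) ->
  Ex P (fun w => \prod_f spin f w ^+ k f) =
  \prod_f Ex P (fun w => spin f w ^+ k f).
Proof.
move=> k0.
(* The exponents, transported to the pairs of integers that index the couplings J. *)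
pose k' (ij : nat * nat) := (\sum_(f : edge N | vpair f == ij) k f)%N.
have k'E f : k' (vpair f) = k f.
  rewrite /k'; apply: big_pred1 => f'.
  by apply/eqP/eqP => [/vpair_inj|->].
pose s := [seq vpair f | f <- enum (edge N) & is_edge f].
have us : uniq s by rewrite map_inj_uniq// filter_uniq// enum_uniq.
have sD : {subset s <= DD} by move=> ij /mapP[f]; rewrite mem_filter => /andP[ef _] ->.
have := @Ex_indep_prod _ _ _ P _ DD XX indJ s (fun ij t => ch t ^+ k' ij)
  (fun ij => r ^+ k' ij) us sD.
have m1 ij : measurable_fun setT (fun t => ch t ^+ k' ij).
  by case: (bmX (k' ij) ch_bm).
have b1 ij t : `|ch t ^+ k' ij| <= r ^+ k' ij.
  rewrite normrX lerXn2r ?nnegrE ?(ltW r_gt0)//.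
  by rewrite /ch /chi normrM (gtr0_norm r_gt0) ler_piMr ?tanh_le1// ltW.
move=> /(_ m1 b1); rewrite big_map big_filter big_enum_cond /=.
have one f : ~~ is_edge f -> Ex P (fun w => spin f w ^+ k f) = 1.
  by move=> nf; rewrite k0// -[RHS](Ex_cst P); congr Ex; apply/funext.
have -> : \prod_f Ex P (fun w => spin f w ^+ k f) =
    \prod_(f | is_edge f) Ex P (fun w => spin f w ^+ k f).
  by apply/esym/big_rmcond => f; exact: one.
have -> : (fun w => \prod_(ij <- s) ch (XX ij w) ^+ k' ij) =
    (fun w => \prod_f spin f w ^+ k f).
  apply/funext => w; rewrite big_map big_filter big_enum_cond /=.
  rewrite -(@big_rmcond _ _ _ _ _ (@is_edge N)); last by move=> f nf; rewrite k0.
  by apply: eq_bigr => f ef; rewrite k'E /spin coupling_edge.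
move=> ->; apply: eq_bigr => f ef; congr Ex; apply/funext => w.
by rewrite k'E /spin coupling_edge.
Qed.

Let y k e w := factor k (coupling e w).

Lemma factor_bm k : bm (factor k).
Proof.
rewrite /factor; case: (is_square k); last exact: ch_bm.
by apply: bmB; [exact: bmX|exact: bm_cst].
Qed.

Lemma monomial_rem (G : {set edge N}) e w : e \in G ->
  monomial spin G w = spin e w * monomial spin (G :\ e)%SET w.
Proof. by move=> eG; rewrite /monomial (big_setD1 e). Qed.

Lemma star_non_edge k e w : ~~ is_square k -> ~~ is_edge e ->
  star spin (family k) e w = 0.
Proof.
move=> kQ ne; rewrite /star big1// => G /andP[/(family_ok kQ)[_ _ Ge _]] /Ge.
by rewrite (negbTE ne).
Qed.

Lemma cofactor_non_edge k e : ~~ is_edge e -> cofactor k e = cst 0.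
Proof.
move=> ne; apply/funext => w; rewrite /cofactor (negbTE ne).
have [kQ|kQ] := boolP (is_square k); first by rewrite mulr0.
by rewrite star_non_edge// mulr0.
Qed.

Lemma stat_decomp k w :
  (len k)%:R * stat k w = \sum_e factor k (coupling e w) * cofactor k e w.
Proof.
have [kQ|kQ] := boolP (is_square k).
  rewrite stat_square// /cofactor /factor kQ.
  have -> : len k = 1%N.
    move: kQ; rewrite /is_square /len => kQ; rewrite !ifN -?leqNgt//.
    by move: m_ge3 kQ; clear; lia.
  rewrite mul1r mulr_sumr [LHS]big_mkcond; apply: eq_bigr => e _.
  case: (is_edge e); first by rewrite mulr1 mulrC.
  by rewrite !mulr0.
rewrite stat_graph// mulrCA mulr_sumr.
rewrite (eq_bigr (fun e => weight k * \sum_(G in family k | e \in G) monomial spin G w)).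
  rewrite -[RHS]mulr_sumr; congr (_ * _).
  rewrite [RHS](exchange_big_dep (fun G => G \in family k)) /=; last by move=> e G _ /andP[].
  apply: eq_bigr => G GF; have [_ <- _ _] := family_ok kQ GF.
  rewrite (eq_bigl (fun e => e \in G)); last by move=> e; rewrite GF.
  by rewrite sumr_const mulr_natl.
move=> e _; rewrite /cofactor /factor (negbTE kQ) mulrCA; congr (_ * _).
rewrite /star mulr_sumr; apply: eq_bigr => G /andP[_ eG].
by rewrite (monomial_rem w eG).
Qed.

Lemma monomial_others e (G : {set edge N}) : e \notin G ->
  bm (monomial spin G : g_sigma_algebraType (others e) -> R).
Proof.
move=> eG; apply: bm_prod => f fG; apply: spin_others.
by apply: contraNneq eG => <-.
Qed.

Lemma cofactor_others k e :
  bm (cofactor k e : g_sigma_algebraType (others e) -> R).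
Proof.
rewrite /cofactor; case: (is_square k); first exact: bm_cst.
apply: bmM; first exact: bm_cst.
by apply: bm_sum => G _; apply: monomial_others; rewrite !inE eqxx.
Qed.

Lemma rest_others k e : bm ((fun w => stat k w - factor k (coupling e w) * cofactor k e w)
   : g_sigma_algebraType (others e) -> R).
Proof.
have [kQ|kQ] := boolP (is_square k).
  rewrite (_ : (fun w => _) = fun w => weight k *
      \sum_(f | is_edge f && (f != e)) (spin f w ^+ 2 - mom2)).
    apply: bmM; first exact: bm_cst.
    apply: bm_sum => f /andP[_ fe]; apply: bmB; last exact: bm_cst.
    by apply: bmX; exact: spin_others.
  apply/funext => w; rewrite stat_square// /cofactor /factor kQ.
  have [ee|ne] := boolP (is_edge e).
    by rewrite (bigD1 e)//= mulrDr mulr1 [_ * weight k]mulrC addrAC subrr add0r.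
  rewrite !mulr0 subr0; congr (_ * _); apply: eq_bigl => f.
  by have [->|] := eqVneq f e; rewrite ?andbT// (negbTE ne).
rewrite (_ : (fun w => _) = fun w => weight k *
    \sum_(G in family k | e \notin G) monomial spin G w).
  apply: bmM; first exact: bm_cst.
  by apply: bm_sum => G /andP[_ eG]; exact: monomial_others.
apply/funext => w; rewrite stat_graph// /cofactor /factor (negbTE kQ) mulrCA -mulrBr.
congr (_ * _); rewrite (bigID (fun G : {set edge N} => e \in G)) /=.
rewrite [X in _ - X](_ : _ = \sum_(G in family k | e \in G) monomial spin G w).
  by rewrite addrAC subrr add0r.
rewrite /star mulr_sumr; apply: eq_bigr => G /andP[_ eG].
by rewrite (monomial_rem w eG).
Qed.

Lemma mom2_ge0 : 0 <= mom2. Proof. by apply: Ex_ge0 => t; exact: sqr_ge0. Qed.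

Lemma mom2_le : mom2 <= K.
Proof. exact: le_trans (ler_norm _) (@ch_moment 2 isT). Qed.

Lemma factor_mean k e :
  cofactor k e = cst 0 \/ Ex P (fun w => factor k (coupling e w)) = 0.
Proof.
have [ee|ne] := boolP (is_edge e); last by left; exact: cofactor_non_edge.
right; rewrite (Ex_spin ee (factor_bm k)) /factor.
case: (is_square k); last by rewrite chi_mean.
rewrite ExB; [|by apply: bm_integ; exact: bmX|exact: integ_cst].
by rewrite Ex_cst subrr.
Qed.

Lemma stat_bm k : bm (stat k).
Proof.
have [kQ|kQ] := boolP (is_square k).
  rewrite (funext (fun w => stat_square w kQ)).
  apply: bmM; first exact: bm_cst.
  apply: bm_sum => f _; apply: bmB; last exact: bm_cst.
  by apply: bmX; exact: spin_bm.
rewrite (funext (fun w => stat_graph w kQ)).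
apply: bmM; first exact: bm_cst.
by apply: bm_sum => G _; apply: bm_prod => f _; exact: spin_bm.
Qed.

Lemma stat_mean k : Ex P (stat k) = 0.
Proof.
exact: (mean_leave_one_out (P := P) (others := others) (X := coupling) (psi := factor)
  (s := cofactor) (W := stat) (l := len) others_measurable coupling_measurable
  coupling_indep factor_bm factor_mean cofactor_others len_gt0 stat_bm stat_decomp).
Qed.

Let loc := local_cov P coupling factor cofactor.

Let tau_ := tau P coupling factor.

Lemma stat_cov i j : (len i)%:R * Ex P (fun w => stat i w * stat j w) = Ex P (loc i j).
Proof.
exact: (covariance_leave_one_out (P := P) (others := others) (X := coupling) (psi := factor)
  (s := cofactor) (W := stat) (l := len) others_measurable coupling_measurable
  coupling_indep factor_bm factor_mean cofactor_others rest_others stat_bm stat_decomp).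
Qed.

Lemma tau_edge i j e : is_edge e ->
  tau_ i j e = Ex mu (fun t => factor i t * factor j t).
Proof.
move=> ee; rewrite -(Ex_spin ee)//.
by apply: bmM; exact: factor_bm.
Qed.

Lemma tau_graph i j e : is_edge e -> ~~ is_square i -> ~~ is_square j ->
  tau_ i j e = mom2.
Proof.
move=> ee iQ jQ; rewrite tau_edge// /mom2; congr Ex; apply/funext => t.
by rewrite /factor (negbTE iQ) (negbTE jQ) expr2.
Qed.

(** The law of a coupling is symmetric, so its odd moments vanish: the statistic Q
    decouples from the graph statistics. *)
Lemma tau_mixed i j e : is_edge e -> is_square i != is_square j ->
  tau_ i j e = 0.
Proof.
move=> ee ij; rewrite tau_edge//.
have -> : (fun t => factor i t * factor j t) = fun t => ch t ^+ 3 - mom2 * ch t.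
  apply/funext => t; rewrite /factor; move: ij.
  by case: (is_square i); case: (is_square j) => // _; ring.
rewrite ExB; [|by apply: bm_integ; exact: bmX|by apply: integZ; exact: bm_integ].
rewrite ExZ; last exact: bm_integ.
by rewrite (chi_mean3 beta r_gt0 sym_mu) (chi_mean beta r_gt0 sym_mu) mulr0 subrr.
Qed.

Lemma loc_graph i j w : ~~ is_square i -> ~~ is_square j ->
  loc i j w = mom2 * weight i * weight j * pinned_sum spin (family i) (family j) w.
Proof.
move=> iQ jQ; rewrite /loc /local_cov /pinned_sum mulr_sumr; apply: eq_bigr => e _.
have [ee|ne] := boolP (is_edge e).
  by rewrite -/(tau_ i j e) tau_graph// /cofactor (negbTE iQ) (negbTE jQ); ring.
by rewrite cofactor_non_edge// star_non_edge// !mul0r !mulr0.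
Qed.

Lemma loc_mixed i j w : is_square i != is_square j -> loc i j w = 0.
Proof.
move=> ij; rewrite /loc /local_cov big1// => e _.
have [ee|ne] := boolP (is_edge e); first by rewrite -/(tau_ i j e) tau_mixed// mul0r.
by rewrite cofactor_non_edge// mul0r mulr0.
Qed.

(** The cofactors of Q are deterministic. *)
Lemma loc_square i j : is_square i -> is_square j ->
  exists c, loc i j = cst c.
Proof.
move=> iQ jQ; exists (\sum_e tau_ i j e * ((weight i * (is_edge e)%:R) * (weight j * (is_edge e)%:R))).
by apply/funext => w; rewrite /loc /local_cov /cofactor iQ jQ.
Qed.

(** The numbers of vertices and of edges tell apart the loops and the paths of all
    lengths. *)
Lemma graph_distinct i j (G1 G2 : {set edge N}) :
  ~~ is_square i -> ~~ is_square j -> i != j ->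
  G1 \in family i -> G2 \in family j -> G1 != G2.
Proof.
move=> iQ jQ ij /(family_ok iQ)[v1 l1 _ _] /(family_ok jQ)[v2 l2 _ _].
apply: contraNneq ij => G12; apply/eqP/val_inj => /=.
move: v1 l1 v2 l2 iQ jQ; rewrite G12 /is_square -!ltnNge => -> -> vv ll iQ jQ.
move: vv ll; rewrite /nvert /len iQ jQ.
by case: ltnP => h1; case: ltnP => h2; move: h1 h2 iQ jQ; clear; lia.
Qed.

Lemma Ex_pinned_distinct i j : ~~ is_square i -> ~~ is_square j -> i != j ->
  Ex P (pinned_sum spin (family i) (family j)) = 0.
Proof.
move=> iQ jQ ij; rewrite (funext (pinned_sumE spin (family i) (family j))).
rewrite Ex_sum; last by move=> a; exact: (integ_monomials P spin_bm).
rewrite big1// => a pa; have [F1 F2 a1 a2] := and4P pa.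
have oe := only_edges_unpin (family_ok iQ) (family_ok jQ) pa.
have /eqP := graph_distinct iQ jQ ij F1 F2.
have [|/fintype.subsetPn[f f1 f2]] := boolP (a.2.1 \subset a.2.2).
  move=> s12; have [|/fintype.subsetPn[f f2 f1]] := boolP (a.2.2 \subset a.2.1).
    by move=> s21; case; apply/eqP; rewrite finset.eqEsubset s12.
  move=> _; apply: (Ex_monomials_eq0 spin_prod spin_mean oe (f := f)).
  have fa : f != a.1 by apply: contraNneq f1 => ->.
  by rewrite /mult /= !inE fa f2 (negbTE f1).
move=> _; apply: (Ex_monomials_eq0 spin_prod spin_mean oe (f := f)).
have fa : f != a.1 by apply: contraNneq f2 => ->.
by rewrite /mult /= !inE fa f1 (negbTE f2).
Qed.

(** Two different graphs have an edge that belongs to only one of them, and whose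
    spin is centred. *)
Lemma stat_uncorrelated i j : i != j -> Ex P (fun w => stat i w * stat j w) = 0.
Proof.
move=> ij; have l0 : (len i)%:R != 0 :> R by rewrite pnatr_eq0 -lt0n len_gt0.
apply: (mulfI l0); rewrite mulr0 stat_cov.
have [iQ|iQ] := boolP (is_square i); have [jQ|jQ] := boolP (is_square j).
- exfalso; move/eqP: ij; apply; apply: val_inj => /=; move: iQ jQ; rewrite /is_square.
  by move: (ltn_ord i) (ltn_ord j) m_ge3; clear; lia.
- rewrite -[RHS](Ex_cst P 0); congr Ex; apply/funext => w.
  by rewrite loc_mixed// iQ (negbTE jQ).
- rewrite -[RHS](Ex_cst P 0); congr Ex; apply/funext => w.
  by rewrite loc_mixed// jQ (negbTE iQ).
- rewrite (funext (fun w => loc_graph w iQ jQ)) ExZ ?Ex_pinned_distinct ?mulr0//.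
    exact: (integ_pinned_sum P spin_bm).
Qed.

Variable rho : R.
Hypothesis rho_ge0 : 0 <= rho.
Hypothesis h_small : (tanh h ^+ 2) ^+ 2 <= rho / N%:R.

Let K_ge1 : 1 <= K. Proof. exact: mom6_ge1. Qed.

Let K_ge0 : 0 <= K. Proof. exact: le_trans K_ge1. Qed.

Let N_gt0R : 0 < N%:R :> R. Proof. by rewrite ltr0n. Qed.

Let cm : nat := count_constant (2 * m).+1.

Lemma count_constant_le v v' : (v <= v')%N ->
  (count_constant v <= count_constant v')%N.
Proof.
move=> vv; rewrite /count_constant; apply: leq_mul => //.
by rewrite leq_exp2r// leq_exp2l// leq_mul.
Qed.

Lemma nvert_bounds k : (2 <= nvert k <= m.+1)%N.
Proof.
rewrite /nvert; move: m_ge3; case: (ltnP k (m - 2)); first by clear; lia.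
by case: (ltnP k (m - 2 + m)); clear; lia.
Qed.

Lemma len_le k : (len k <= m)%N.
Proof.
rewrite /len; move: m_ge3; case: (ltnP k (m - 2)); first by clear; lia.
by case: (ltnP k (m - 2 + m)); clear; lia.
Qed.

Definition fourth_constant : R := (1 + rho) ^+ 2 * (K ^+ (4 * m) * cm%:R).

Let K_pow a b : (a <= b)%N -> K ^+ a <= K ^+ b.
Proof. by move=> ab; rewrite ler_weXn2l. Qed.

Let NX_split a b c : (a + b = c)%N -> N%:R ^- c * N%:R ^+ a = N%:R ^- b :> R.
Proof.
move=> <-; have N0 : N%:R != 0 :> R by rewrite gt_eqF.
by rewrite exprD invfM mulrAC mulVf ?mul1r// expf_neq0.
Qed.

(** The squared weights N^(-2 nvert) against the N^(2 nvert - 2) quadruples of graphs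
    counted in fourth_moment_star; for Q the weight 1/N is summed over N^2 pairs. *)
Lemma cofactor_fourth k :
  \sum_e Ex P (fun w => cofactor k e w ^+ 4) <= fourth_constant * N%:R ^- 2.
Proof.
have [nk2 nkm] := andP (nvert_bounds k).
have w2 := weight_le k h_small rho_ge0.
have w4 : weight k ^+ 4 <= (1 + rho) ^+ 2 * N%:R ^- (2 * nvert k).
  rewrite (_ : 4 = 2 * 2)%N// exprM mulnC [N%:R ^+ (_ * _)]exprM -exprVn -exprMn.
  by rewrite lerXn2r// nnegrE ?sqr_ge0// mulr_ge0// ?addr_ge0// invr_ge0 exprn_ge0.
have [kQ|kQ] := boolP (is_square k).
  have n2 : nvert k = 2%N.
    move: kQ; rewrite /is_square /nvert => kQ; rewrite !ifN -?leqNgt//.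
    by move: m_ge3 kQ; clear; lia.
  apply: (@le_trans _ _ (\sum_(e : edge N) weight k ^+ 4)).
    apply: ler_sum => e _; rewrite -[leRHS](Ex_cst P); apply: Ex_le.
    - by rewrite /cofactor kQ; exact: integ_cst.
    - exact: integ_cst.
    - move=> w; rewrite /cofactor kQ; case: (is_edge e); first by rewrite mulr1.
      by rewrite mulr0 expr0n /= exprn_even_ge0.
  rewrite sumr_const card_prod card_ord -[leLHS]mulr_natr.
  rewrite (_ : (N * N)%:R = N%:R ^+ 2 :> R); last by rewrite natrM expr2.
  apply: (le_trans (ler_wpM2r _ w4)); first exact: exprn_ge0.
  rewrite n2 -mulrA (@NX_split 2 2 (2 * 2) erefl) /fourth_constant.
  rewrite ler_wpM2r ?invr_ge0 ?exprn_ge0// ler_peMr ?sqr_ge0//.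
  rewrite -[X in X <= _]mulr1; apply: ler_pM => //; first exact: exprn_ege1.
  by rewrite ler1n /cm /count_constant muln_gt0 /= !expn_gt0.
have fm := fourth_moment_star N_gt0 spin_bm spin_prod
  spin_mean K_ge1 spin_moment (family_ok kQ).
have E e : Ex P (fun w => cofactor k e w ^+ 4) =
    weight k ^+ 4 * Ex P (fun w => star spin (family k) e w ^+ 4).
  rewrite -ExZ; last first.
    apply: bm_integ; apply: bmX; apply: bm_sum => G _.
    by apply: bm_prod => f _; exact: spin_bm.
  by congr Ex; apply/funext => w; rewrite /cofactor (negbTE kQ) exprMn.
under eq_bigr do rewrite E.
rewrite -mulr_sumr.
apply: (@le_trans _ _ ((1 + rho) ^+ 2 * N%:R ^- (2 * nvert k) *
  (K ^+ (4 * m) * (cm * N ^ (2 * nvert k - 2))%:R))).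
  apply: ler_pM => //; first by rewrite exprn_even_ge0.
    by apply: sumr_ge0 => e _; apply: Ex_ge0 => w; rewrite exprn_even_ge0.
  apply: (le_trans fm); apply: ler_pM => //.
  - by rewrite exprn_ge0// (le_trans ler01).
  - by apply: K_pow; move: (len_le k); clear; lia.
  - rewrite ler_nat leq_mul2r; apply/orP; right; apply: count_constant_le.
    by move: nkm; clear; lia.
rewrite natrM natrX /fourth_constant; apply: eq_ler.
rewrite -(@NX_split (2 * nvert k - 2) 2 (2 * nvert k)); last by move: nk2; clear; lia.
by ring.
Qed.

Definition variance_constant : R :=
  K ^+ 2 * (1 + rho) ^+ 2 * (K ^+ (4 * m) *+ 2 * cm%:R).

Lemma variance_constant_ge0 : 0 <= variance_constant.
Proof.
apply: mulr_ge0; first by apply: mulr_ge0; exact: sqr_ge0.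
by apply: mulr_ge0 => //; apply: mulrn_wge0; exact: exprn_ge0.
Qed.

(** The weights N^(- nvert i - nvert j) are beaten by the count of
    variance_pinned_sum up to a factor 1/N. *)
Lemma loc_variance i j : ~~ is_square i -> ~~ is_square j ->
  Ex P (fun w => (loc i j w - Ex P (loc i j)) ^+ 2) <= variance_constant / N%:R.
Proof.
move=> iQ jQ.
have ip := integ_pinned_sum P spin_bm (family i) (family j).
have [ni2 nim] := andP (nvert_bounds i); have [nj2 njm] := andP (nvert_bounds j).
pose c := mom2 * weight i * weight j.
have locE : loc i j = fun w => c * pinned_sum spin (family i) (family j) w.
  by apply/funext => w; exact: loc_graph.
have star_bm k e : bm (star spin (family k) e).
  by apply: bm_sum => G _; apply: bm_prod => f _; exact: spin_bm.
have ps_bm : bm (pinned_sum spin (family i) (family j)).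
  by apply: bm_sum => e _; exact: bmM.
rewrite locE ExZ//.
set Y := pinned_sum spin (family i) (family j) in ip ps_bm *.
rewrite (_ : (fun w => _) = fun w => c ^+ 2 * (Y w - Ex P Y) ^+ 2); last first.
  by apply/funext => w; ring.
rewrite ExZ; last by apply: bm_integ; apply: bmX; apply: bmB => //; exact: bm_cst.
have vp := variance_pinned_sum N_gt0 spin_bm spin_prod
  spin_mean K_ge1 spin_moment (family_ok iQ) (family_ok jQ).
have c2 : c ^+ 2 <= K ^+ 2 * ((1 + rho) * N%:R ^- nvert i) * ((1 + rho) * N%:R ^- nvert j).
  have sq (a : R) : 0 <= a ^+ 2 by exact: sqr_ge0.
  rewrite /c !exprMn; apply: ler_pM; [by apply: mulr_ge0| by []| |exact: weight_le].
  apply: ler_pM; [by []|by []| |exact: weight_le].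
  by rewrite lerXn2r ?nnegrE ?mom2_le ?mom2_ge0// (le_trans ler01).
apply: (@le_trans _ _ (K ^+ 2 * ((1 + rho) * N%:R ^- nvert i) *
   ((1 + rho) * N%:R ^- nvert j) *
   (K ^+ (4 * m) *+ 2 * (cm * N ^ (nvert i + nvert j).-1)%:R))).
  apply: ler_pM => //; first exact: sqr_ge0.
    by apply: Ex_ge0 => w; exact: sqr_ge0.
  apply: (le_trans vp); apply: ler_pM => //.
  - by rewrite mulrn_wge0// exprn_ge0// (le_trans ler01).
  - rewrite !mulr2n; apply: lerD; apply: K_pow; move: (len_le i) (len_le j); clear; lia.
  - rewrite ler_nat leq_mul2r; apply/orP; right; apply: count_constant_le.
    by move: nim njm; clear; lia.
rewrite natrM natrX /variance_constant; apply: eq_ler.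
have h1 := @NX_split (nvert i + nvert j).-1 1 (nvert i + nvert j)
  ltac:(move: ni2; clear; lia).
rewrite expr1 in h1; rewrite -h1 exprD invfM.
by ring.
Qed.

Lemma cofactor_bm k e : bm (cofactor k e).
Proof.
rewrite /cofactor; case: (is_square k); first exact: bm_cst.
apply: bmM; first exact: bm_cst.
by apply: bm_sum => G _; apply: bm_prod => f _; exact: spin_bm.
Qed.

Lemma loc_deviation i j :
  Ex P (fun w => `|loc i j w - Ex P (loc i j)|) <= (1 + variance_constant) / r.
Proof.
have vc0 := variance_constant_ge0.
have rhs0 : 0 <= (1 + variance_constant) / r.
  by rewrite divr_ge0// ?addr_ge0// ltW.
have triv c : loc i j = cst c -> Ex P (fun w => `|loc i j w - Ex P (loc i j)|) <=
    (1 + variance_constant) / r.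
  move=> ->; rewrite Ex_cst (_ : (fun w => _) = cst 0) ?Ex_cst//.
  by apply/funext => w; rewrite subrr normr0.
have [iQ|iQ] := boolP (is_square i); have [jQ|jQ] := boolP (is_square j).
- by have [c /triv] := loc_square iQ jQ.
- by apply: (triv 0); apply/funext => w; rewrite loc_mixed// iQ (negbTE jQ).
- by apply: (triv 0); apply/funext => w; rewrite loc_mixed// jQ (negbTE iQ).
have lv := loc_variance iQ jQ.
have lbm : bm (loc i j).
  apply: bm_sum => e _; apply: bmM; first exact: bm_cst.
  by apply: bmM; exact: cofactor_bm.
have dbm : bm (fun w => loc i j w - Ex P (loc i j)).
  by apply: bmB => //; exact: bm_cst.
set Y := fun w => loc i j w - Ex P (loc i j) in lv dbm *.
(* The weight r = sqrt N balances the two terms, as Y has variance O(1/N). *)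
apply: (@le_trans _ _ (Ex P (fun w => r^-1 + r * Y w ^+ 2))).
  apply: Ex_le; [apply: bm_integ; exact: bm_norm|apply: bm_integ; apply: bmD|].
  - exact: bm_cst.
  - by apply: bmM; [exact: bm_cst|exact: bmX].
  - move=> w; rewrite -(real_normK (num_real (Y w))).
    rewrite -(ler_pM2l r_gt0) mulrDr divff ?gt_eqF// mulrA -expr2 -exprMn.
    set q := r * `|Y w|; have q0 : 0 <= q by rewrite mulr_ge0// ltW.
    by have := sqr_ge0 (q - 1); nra.
rewrite ExD; [|exact: integ_cst|apply: integZ; apply: bm_integ; exact: bmX].
rewrite Ex_cst ExZ; last by apply: bm_integ; exact: bmX.
rewrite mulrDl mul1r lerD2l.
apply: (le_trans (ler_wpM2l (ltW r_gt0) lv)).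
by rewrite -r2 expr2 invfM mulrCA mulVKf ?gt_eqF.
Qed.

Definition cube_constant : R := K + K ^+ 3.

(** For Q the factor is quadratic in the coupling: this is where the sixth moment is
    used. *)
Lemma factor_cube k e : is_edge e ->
  Ex P (fun w => `|factor k (coupling e w)| ^+ 3) <= cube_constant.
Proof.
move=> ee; have fbm : bm (fun t => `|factor k t| ^+ 3).
  by apply: bmX; apply: bm_norm; exact: factor_bm.
rewrite (Ex_spin (u := fun t => `|factor k t| ^+ 3) ee fbm).
have mom (q : nat) : (q <= 6)%N -> Ex mu (fun t => `|ch t| ^+ q) <= K.
  by move=> q6; exact: (chi_moment beta01 r_gt0 mu6 q6).
have chq q : integ mu (fun t => `|ch t| ^+ q).
  by apply: bm_integ; apply: bmX; exact: bm_norm.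
case kQ: (is_square k); last first.
  apply: le_trans (_ : K <= _); last by rewrite lerDl exprn_ge0.
  apply: le_trans (mom 3 isT); apply: eq_ler.
  by congr Ex; apply/funext => t; rewrite /factor kQ.
apply: (@le_trans _ _ (Ex mu (fun t => `|ch t| ^+ 6 + mom2 ^+ 3))).
  apply: Ex_le; [exact: bm_integ|by apply: integD => //; exact: integ_cst|].
  move=> t; rewrite /factor kQ -(real_normK (num_real (ch t))).
  rewrite (exprM _ 2 3); set a := `|ch t| ^+ 2.
  have a0 : 0 <= a by exact: exprn_ge0.
  have [az|/ltW az] := leP mom2 a.
    rewrite ger0_norm ?subr_ge0//; apply: (@le_trans _ _ (a ^+ 3)).
      by rewrite lerXn2r ?nnegrE ?subr_ge0// gerBl mom2_ge0.
    by rewrite lerDl exprn_ge0// mom2_ge0.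
  rewrite distrC ger0_norm ?subr_ge0//; apply: (@le_trans _ _ (mom2 ^+ 3)).
    by rewrite lerXn2r ?nnegrE ?subr_ge0 ?gerBl// mom2_ge0.
  by rewrite lerDr exprn_ge0.
rewrite ExD//; last exact: integ_cst.
rewrite Ex_cst; apply: lerD; first exact: mom.
by rewrite lerXn2r ?nnegrE ?mom2_ge0 ?mom2_le.
Qed.

Let amgm3 (a b c : R) : 0 <= a -> 0 <= b -> 0 <= c ->
  a * b * c <= a ^+ 3 + b ^+ 3 + c ^+ 3.
Proof.
move=> a0 b0 c0; have abc : 0 <= a * b * c by rewrite !mulr_ge0.
have := mulr_ge0 (addr_ge0 (addr_ge0 a0 b0) c0)
  (addr_ge0 (addr_ge0 (sqr_ge0 (a - b)) (sqr_ge0 (b - c))) (sqr_ge0 (c - a))).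
by move: abc; rewrite !exprS !expr0; nra.
Qed.

Definition coefficient_constant : R :=
  3 * cube_constant + (2 * cube_constant + 1) * (cube_constant + 2).

Let cube_constant_ge0 : 0 <= cube_constant.
Proof.
by rewrite addr_ge0 ?exprn_ge0.
Qed.

Let coefficient_constant_ge0 : 0 <= coefficient_constant.
Proof. apply: addr_ge0; first exact: mulr_ge0.
by apply: mulr_ge0; apply: addr_ge0 => //; exact: mulr_ge0. Qed.

Lemma third_coefficient i j k e : is_edge e ->
  Ex P (fun w => `|factor i (coupling e w) * factor j (coupling e w) *
                   factor k (coupling e w)|) +
  `|tau_ i j e| * Ex P (fun w => `|factor k (coupling e w)|) <= coefficient_constant.
Proof.
move=> ee.
have fb a : bm (fun w => factor a (coupling e w)).
  have [m1 [M uM]] := factor_bm a; split; last by exists M => w.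
  by apply: measurableT_comp => //; exact: coupling_measurable.
have f3 a : integ P (fun w => `|factor a (coupling e w)| ^+ 3).
  by apply: bm_integ; apply: bmX; exact: bm_norm.
have f1 a : integ P (fun w => `|factor a (coupling e w)|).
  by apply: bm_integ; exact: bm_norm.
have ff : bm (fun w => factor i (coupling e w) * factor j (coupling e w)) by exact: bmM.
have c3 a := factor_cube a ee.
have ic c := integ_cst P c.
apply: lerD.
  apply: le_trans (_ : Ex P (fun w => `|factor i (coupling e w)| ^+ 3 +
    `|factor j (coupling e w)| ^+ 3 + `|factor k (coupling e w)| ^+ 3) <= _).
    apply: Ex_le; first by apply: bm_integ; apply: bm_norm; exact: bmM.
      by apply: integD => //; exact: integD.
    by move=> w; rewrite !normrM amgm3.
  rewrite !ExD//; last exact: integD.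
  by have := c3 i; have := c3 j; have := c3 k; lra.
apply: ler_pM => //; first by apply: Ex_ge0 => w.
  apply: (@le_trans _ _ (Ex P (fun w => `|factor i (coupling e w)| ^+ 3 +
    `|factor j (coupling e w)| ^+ 3 + 1))).
    apply: Ex_norm_le; first exact: bm_integ.
      by apply: integD => //; exact: integD.
    move=> w; have := @amgm3 `|factor i (coupling e w)| `|factor j (coupling e w)| 1.
    by rewrite mulr1 expr1n normrM; apply.
  rewrite !ExD//; last exact: integD.
  by rewrite Ex_cst; have := c3 i; have := c3 j; lra.
apply: (@le_trans _ _ (Ex P (fun w => `|factor k (coupling e w)| ^+ 3 + 2))).
  apply: Ex_le => //; first exact: integD.
  move=> w; have := @amgm3 `|factor k (coupling e w)| 1 1.
  by rewrite !mulr1 expr1n -addrA; apply.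
by rewrite ExD// Ex_cst lerD2r.
Qed.

(** Interpolation with the fourth moments: |a|^3 is at most N a^4 if N |a| >= 1, and
    at most N^-3 otherwise; the N^2 terms of the second kind add up to 1/N. *)
Lemma cofactor_cube k :
  \sum_e Ex P (fun w => `|cofactor k e w| ^+ 3) <= (fourth_constant + 1) / N%:R.
Proof.
have N0 : N%:R != 0 :> R by rewrite gt_eqF.
apply: (@le_trans _ _ (\sum_(e : edge N)
    (N%:R * Ex P (fun w => cofactor k e w ^+ 4) + N%:R ^- 3))).
  apply: ler_sum => e _; rewrite -ExZ; last by apply: bm_integ; apply: bmX; exact: cofactor_bm.
  rewrite -[in leRHS](Ex_cst P (N%:R ^- 3)) -ExD; [|
    by apply: integZ; apply: bm_integ; apply: bmX; exact: cofactor_bm|exact: integ_cst].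
  apply: Ex_le.
  - by apply: bm_integ; apply: bmX; apply: bm_norm; exact: cofactor_bm.
  - apply: integD; last exact: integ_cst.
    by apply: integZ; apply: bm_integ; apply: bmX; exact: cofactor_bm.
  move=> w; rewrite (_ : cofactor k e w ^+ 4 = `|cofactor k e w| ^+ 4); last first.
    by rewrite -normrX ger0_norm ?exprn_even_ge0.
  set a := `|cofactor k e w|; have a0 : 0 <= a by exact: normr_ge0.
  have [a1|a1] := leP 1 (N%:R * a).
    apply: (@le_trans _ _ (N%:R * a ^+ 4)); last by rewrite lerDl invr_ge0 exprn_ge0.
    by rewrite [in leRHS]exprS mulrA ler_peMl// exprn_ge0.
  apply: (@le_trans _ _ (N%:R ^- 3)).
    rewrite -exprVn lerXn2r ?nnegrE ?invr_ge0//.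
    by rewrite -[leRHS]mulr1 ler_pdivlMl// ltW.
  by rewrite lerDr mulr_ge0// exprn_ge0.
rewrite big_split /= -mulr_sumr sumr_const card_prod card_ord -[X in _ + X]mulr_natr.
apply: (@le_trans _ _ (N%:R * (fourth_constant * N%:R ^- 2) +
  N%:R ^- 3 * (N * N)%:R)).
  by rewrite lerD2r ler_wpM2l// cofactor_fourth.
apply: eq_ler.
by rewrite natrM !exprS expr0 mulr1; field.
Qed.

Let n : nat := (2 * m).-1.

Definition third_constant : R :=
  n%:R ^+ 2 * (coefficient_constant * (3 * (fourth_constant + 1))).

Lemma third_moment_error_le i :
  third_moment_error P coupling factor cofactor i <= third_constant / N%:R.
Proof.
have s3 k e : integ P (fun w => `|cofactor k e w| ^+ 3).
  by apply: bm_integ; apply: bmX; apply: bm_norm; exact: cofactor_bm.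
pose A k e := Ex P (fun w => `|cofactor k e w| ^+ 3).
apply: (@le_trans _ _ (\sum_(e : edge N) \sum_(j < n) \sum_(k < n)
    coefficient_constant * (A i e + A j e + A k e))).
  apply: ler_sum => e _; apply: ler_sum => j _; apply: ler_sum => k _.
  have [ee|ne] := boolP (is_edge e); last first.
    rewrite [X in _ * X](_ : _ = 0) ?mulr0; last first.
      rewrite -[RHS](Ex_cst P 0); congr Ex; apply/funext => w.
      by rewrite cofactor_non_edge// !mul0r normr0.
    by rewrite mulr_ge0// !addr_ge0//; apply: Ex_ge0 => w; exact: exprn_ge0.
  apply: ler_pM.
  - apply: addr_ge0; first by apply: Ex_ge0 => w.
    by apply: mulr_ge0 => //; apply: Ex_ge0 => w.
  - by apply: Ex_ge0 => w.
  - exact: third_coefficient.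
  - rewrite /A -!ExD//; last exact: integD.
    apply: Ex_le.
    + apply: bm_integ; apply: bm_norm; apply: bmM; last exact: cofactor_bm.
      by apply: bmM; exact: cofactor_bm.
    + by apply: integD => //; exact: integD.
    + by move=> w; rewrite !normrM amgm3.
rewrite exchange_big; under eq_bigr do rewrite exchange_big.
apply: (@le_trans _ _ (\sum_(j < n) \sum_(k < n)
   coefficient_constant * (3 * (fourth_constant + 1)) / N%:R)).
  apply: ler_sum => j _; apply: ler_sum => k _.
  rewrite -mulr_sumr -[leRHS]mulrA ler_wpM2l// !big_split /=.
  rewrite (_ : 3 * _ / _ = (fourth_constant + 1) / N%:R +
    (fourth_constant + 1) / N%:R + (fourth_constant + 1) / N%:R); last by ring.
  by apply: lerD; [apply: lerD|]; exact: cofactor_cube.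
rewrite !sumr_const !card_ord -[leLHS]mulr_natr -[X in X * _]mulr_natr.
by rewrite /third_constant; apply: eq_ler; ring.
Qed.

Definition stein_error M2 M3 : R :=
  M2 * (n%:R * ((1 + variance_constant) / r)) + M3 * (third_constant / N%:R).

(** This is leave_one_out for the function x |-> d_i f (c x + v); each of its
    derivatives brings out a factor c, which is at most 1 in absolute value. *)
Lemma stein_bound (f : 'cV[R]_n -> R) M2 M3 c v i : times_differentiable 3 f ->
  (forall j k x, `|partial j (partial k f) x| <= M2) ->
  (forall j k l x, `|partial j (partial k (partial l f)) x| <= M3) -> `|c| <= 1 ->
  `|Ex P (fun w => stat i w * partial i f (c *: (\col_k stat k w) + v)) -
    c * \sum_j Ex P (fun w => stat i w * stat j w) *
      Ex P (fun w => partial j (partial i f) (c *: (\col_k stat k w) + v))|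
  <= stein_error M2 M3.
Proof.
move=> [_ /(_ i)[d1 d2]] f2 f3 c1.
have M2_ge0 : 0 <= M2 by exact: le_trans (f2 i i 0).
have M3_ge0 : 0 <= M3 by exact: le_trans (f3 i i i 0).
pose g x := partial i f (c *: x + v).
have gE j x : partial j g x = c * partial j (partial i f) (c *: x + v).
  by rewrite /g partial_affine.
have dg x : differentiable g x by exact: differentiable_affine.
have dij j x : differentiable (partial j (partial i f)) x by case: (d2 j).
have cdg j : continuous (partial j g).
  by rewrite (funext (gE j)); exact: continuous_affineZ.
have g2 j x : `|partial j g x| <= M2.
  by rewrite gE normrM (le_trans _ (f2 j i (c *: x + v)))// ler_piMl.
have g3 j x x' : `|partial j g x - partial j g x'| <= M3 * l1 (x - x').
  rewrite !gE -mulrBr normrM.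
  apply: (@le_trans _ _ (1 * (M3 * l1 ((c *: x + v) - (c *: x' + v))))).
    by apply: ler_pM => //; apply: lipschitz_partial => // k y.
  rewrite mul1r ler_wpM2l// opprD addrACA subrr addr0 -scalerBr l1Z.
  by rewrite ler_piMl// l1_ge0.
have h_bm j : bm (fun w => partial j (partial i f) (c *: (\col_k stat k w) + v)).
  apply: (@bm_comp_cV _ _ _ _ (fun x => partial j (partial i f) (c *: x + v)) stat M2 0).
  - exact: continuous_affine.
  - by move=> x; rewrite mul0r addr0.
  - by [].
  - exact: stat_bm.
have loo := leave_one_out (P := P) (others := others) (X := coupling) (psi := factor)
  (s := cofactor) (W := stat) (l := len) others_measurable coupling_measurable
  coupling_indep factor_bm factor_mean cofactor_others rest_others len_gt0 stat_bm
  stat_decomp dg cdg g2 g3 i.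
rewrite mulr_sumr.
rewrite (eq_bigr (fun j => Ex P (fun w => stat i w * stat j w) *
    Ex P (fun w => partial j g (\col_k stat k w)))); last first.
  move=> j _; rewrite mulrCA; congr (_ * _); rewrite -ExZ; last exact: bm_integ.
  by congr Ex; apply/funext => w; rewrite gE.
apply: (le_trans loo).
set A := (X in _ * X <= _).
have A_ge0 : 0 <= A.
  rewrite /A; apply: addr_ge0; apply: mulr_ge0 => //.
    by apply: sumr_ge0 => j _; apply: Ex_ge0 => w.
  apply: sumr_ge0 => e _; apply: sumr_ge0 => j _; apply: sumr_ge0 => k _.
  apply: mulr_ge0; last by apply: Ex_ge0 => w.
  apply: addr_ge0; first by apply: Ex_ge0 => w.
  by apply: mulr_ge0 => //; apply: Ex_ge0 => w.
apply: (@le_trans _ _ A).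
  by rewrite ler_piMl// invf_le1 ?ltr0n ?len_gt0// ler1n len_gt0.
rewrite /A /stein_error; apply: lerD; apply: ler_wpM2l => //.
  rewrite mulr_natl -[X in _ *+ X]card_ord -sumr_const.
  by apply: ler_sum => j _; exact: loc_deviation.
exact: third_moment_error_le.
Qed.

End Model.

(** * The normal approximation *)

(** A nonnegative diagonal matrix has a diagonal positive semidefinite root, so the
    choice made by sqrt_mx is among genuine roots. *)
Lemma sqrt_mx_diag {R : realType} {n : nat} (A : 'M[R]_n) :
  is_diag_mx A -> (forall i, 0 <= A i i) ->
  (sqrt_mx A)^T = sqrt_mx A /\ sqrt_mx A *m sqrt_mx A = A.
Proof.
move=> /diag_mxP[a ->] A0.
have a0 i : 0 <= a 0 i by have := A0 i; rewrite mxE eqxx.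
suff : exists S : 'M[R]_n, is_psd S /\ S *m S = diag_mx a.
  by move=> /(xgetPex 0)[[]].
exists (diag_mx (\row_i Num.sqrt (a 0 i))); split; last first.
  by rewrite mulmx_diag; congr diag_mx; apply/rowP => i; rewrite !mxE -expr2 sqr_sqrtr.
split; first exact: tr_diag_mx.
move=> x; rewrite -mulmxA mul_diag_mx mxE; apply: sumr_ge0 => i _.
by rewrite !mxE mulrCA mulr_ge0 ?sqrtr_ge0// -expr2 sqr_ge0.
Qed.

Lemma second_moment_mxE {d} {T : measurableType d} {R : realType}
    (P : probability T R) n (W : T -> 'cV[R]_n) i j :
  second_moment_mx P W i j = Ex P (fun w => W w i 0 * W w j 0).
Proof. by rewrite mxE unlock. Qed.

Section Norms.
Context {R : realType} {n : nat}.
Variable f : 'cV[R]_n -> R.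

Lemma norm2P : (0 < n)%N -> norm2 f = +oo%E \/ exists M : R,
  [/\ 0 <= M, norm2 f = M%:E & forall j i x, `|partial j (partial i f) x| <= M].
Proof.
move=> n0; pose i0 := Ordinal n0.
have ub i j x : (`|partial j (partial i f) x|%:E <= norm2 f)%E.
  by apply: ereal_sup_ubound; exists i, j, x.
case E: (norm2 f) => [M| |]; [right|by left|].
- have le i j x : `|partial j (partial i f) x| <= M.
    by have := ub i j x; rewrite E lee_fin.
  exists M; split; [exact: le_trans (normr_ge0 _) (le i0 i0 0)|by []|].
  by move=> j i x; exact: le.
- by have := ub i0 i0 0; rewrite E leeNy_eq.
Qed.

Lemma norm3P : (0 < n)%N -> norm3 f = +oo%E \/ exists M : R,
  [/\ 0 <= M, norm3 f = M%:E &
      forall k j i x, `|partial k (partial j (partial i f)) x| <= M].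
Proof.
move=> n0; pose i0 := Ordinal n0.
have ub i j k x : (`|partial k (partial j (partial i f)) x|%:E <= norm3 f)%E.
  by apply: ereal_sup_ubound; exists i, j, k, x.
case E: (norm3 f) => [M| |]; [right|by left|].
- have le i j k x : `|partial k (partial j (partial i f)) x| <= M.
    by have := ub i j k x; rewrite E lee_fin.
  exists M; split; [exact: le_trans (normr_ge0 _) (le i0 i0 i0 0)|by []|].
  by move=> k j i x; exact: le.
- by have := ub i0 i0 i0 0; rewrite E leeNy_eq.
Qed.

End Norms.

Section Rates.
Context {R : realType}.
Variable N : nat.
Hypothesis N_gt0 : (0 < N)%N.

Let N1 : 1 <= N%:R :> R. Proof. by rewrite ler1n. Qed.

Lemma rate_sqrt : (Num.sqrt N%:R)^-1 = N%:R `^ (- 2^-1) :> R.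
Proof. by rewrite powRN powR12_sqrt. Qed.

Lemma rate_inv : N%:R^-1 <= N%:R `^ (- 4^-1) :> R.
Proof. by rewrite -powR_inv1// ler_powR// lerN2; lra. Qed.

(** tanh h ^ 4 <= h ^ 4 = rho^4 N^(-4 alpha), and 4 alpha >= 1. *)
Lemma small_field (rho alpha : R) : 0 < rho -> 4^-1 <= alpha ->
  (tanh (rho * N%:R `^ (- alpha)) ^+ 2) ^+ 2 <= rho ^+ 4 / N%:R.
Proof.
move=> rho0 al; set h := rho * _.
have h0 : 0 <= h by rewrite mulr_ge0 ?powR_ge0// ltW.
rewrite -exprM (_ : tanh h ^+ (2 * 2) = `|tanh h| ^+ 4); last first.
  by rewrite -normrX ger0_norm ?exprn_even_ge0.
apply: (@le_trans _ _ (h ^+ 4)).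
  by rewrite lerXn2r ?nnegrE// -[leRHS]ger0_norm// tanh_le_norm.
rewrite exprMn ler_wpM2l ?exprn_ge0 ?(ltW rho0)//.
rewrite -powR_mulrn ?powR_ge0// -powRrM -powR_inv1// ler_powR//.
by rewrite mulNr lerN2; lra.
Qed.

End Rates.

Theorem theorem5p1 (R : realType) (m : nat) (beta rho : R)
    (mu : probability R R) :
  (3 <= m)%N -> 0 < beta < 1 -> 0 < rho ->
  symmetric_law mu ->
  ('V_mu[fun x : R => x] = 1)%E ->
  ('E_mu[fun x : R => (x ^+ 6)%R] < +oo)%E ->
  exists2 C : R, 0 < C &
  forall (N : nat) (alpha : R) (d : measure_display) (T : measurableType d)
    (P : probability T R) (J : nat -> nat -> {RV P >-> R}),
  (0 < N)%N -> 4^-1 <= alpha ->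
  mutually_independent P (fun e : nat * nat => (e.1 < e.2)%N)
    (fun e => J e.1 e.2 : T -> R) ->
  (forall i j, (i < j)%N -> has_law (J i j) mu) ->
  let W := Wvec J beta (rho * N%:R `^ (- alpha)) N m in
  let Sigma := second_moment_mx P W in
  [/\ forall k, ('E_P[fun w => W w k ord0] = 0)%E,
      is_diag_mx Sigma &
      forall (d' : measure_display) (T' : measurableType d')
        (P' : probability T' R) (Z : 'I_(2 * m).-1 -> {RV P' >-> R})
        (f : 'cV[R]_(2 * m).-1 -> R),
      std_normal_vector Z -> times_differentiable 3 f ->
      (`| 'E_P[fun w => f (W w)]
          - 'E_P'[fun w => f (sqrt_mx Sigma *m \col_k Z k w)] | <=
       C%:E * (norm2 f * (N%:R `^ (- 2^-1))%:E
               + norm3 f * (N%:R `^ (- 4^-1))%:E))%E].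
Proof.
move=> m3 beta01 rho0 sym_mu _ mu6.
set n := (2 * m).-1; have n0 : (0 < n)%N by move: m3; rewrite /n; clear; lia.
pose a : R := n%:R * (1 + variance_constant mu m (rho ^+ 4)).
pose b : R := third_constant mu m (rho ^+ 4).
have rho4 : 0 <= rho ^+ 4 by rewrite exprn_ge0// ltW.
have a0 : 0 <= a by rewrite mulr_ge0// addr_ge0// variance_constant_ge0.
(* The factor 2 n comes from smart_path_bound; a and b are the coefficients of M2 and
   M3 in stein_error. The summand 1 keeps the constant positive. *)
exists (2 * (n%:R * (a + `|b|)) + 1).
  by rewrite ltr_wpDl// !mulr_ge0// addr_ge0.
set C := (X in X%:E); have C0 : 0 < C by rewrite ltr_wpDl// !mulr_ge0// addr_ge0.
move=> N alpha d T P J N_gt0 al indJ lawJ W Sigma.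
have h_small := small_field N_gt0 rho0 al.
set h := rho * _ in h_small.
pose S k := stat J beta h N (m := m) k.
have S_bm k : bm (S k) by exact: (stat_bm h m3 beta01 mu6 N_gt0 lawJ k).
have WS w : W w = \col_k S k w by apply/colP => k; rewrite [RHS]mxE.
have SigmaE i j : Sigma i j = Ex P (fun w => S i w * S j w).
  by rewrite second_moment_mxE.
have diagS : is_diag_mx Sigma.
  apply/is_diag_mxP => i j ij; rewrite SigmaE.
  exact: (stat_uncorrelated h m3 beta01 sym_mu mu6 N_gt0 indJ lawJ).
split=> //.
  move=> k; rewrite Ex_expectation; last exact: (bm_integ P (S_bm k)).
  by congr (_%:E); exact: (stat_mean h m3 beta01 sym_mu mu6 N_gt0 indJ lawJ k).
move=> d' T' P' Z f stdZ f3.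
have N12 : 0 < N%:R `^ (- 2^-1) :> R by rewrite powR_gt0 ?ltr0n.
have N14 : 0 < N%:R `^ (- 4^-1) :> R by rewrite powR_gt0 ?ltr0n.
have Nn2 : (0%:E < (N%:R `^ (- 2^-1))%:E :> \bar R)%E by rewrite lte_fin.
have Nn4 : (0%:E < (N%:R `^ (- 4^-1))%:E :> \bar R)%E by rewrite lte_fin.
(* With an infinite norm the right-hand side is infinite. *)
have [f2|[M2 [M20 fM2 M2P]]] := norm2P f n0.
  have [f3'|[M3 [M30 fM3 M3P]]] := norm3P f n0.
    by rewrite f2 f3' !gt0_mulye// addye// gt0_muley ?leey ?lte_fin.
  by rewrite f2 fM3 gt0_mulye// addye// gt0_muley ?leey ?lte_fin.
have [f3'|[M3 [M30 fM3 M3P]]] := norm3P f n0.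
  by rewrite fM2 f3' gt0_mulye// addey// gt0_muley ?leey ?lte_fin.
have [|symS sqS] := sqrt_mx_diag diagS.
  by move=> i; rewrite SigmaE; apply: Ex_ge0 => w; rewrite -expr2 sqr_ge0.
have [d1 d2] := f3.
have stein i c v : `|c| <= 1 ->
    `|Ex P (fun w => S i w * partial i f (c *: (\col_k S k w) + v)) -
      c * \sum_j (sqrt_mx Sigma *m sqrt_mx Sigma) i j *
        Ex P (fun w => partial j (partial i f) (c *: (\col_k S k w) + v))| <=
    stein_error mu m N (rho ^+ 4) M2 M3.
  move=> c1; rewrite sqS.
  under [X in c * X]eq_bigr do rewrite SigmaE.
  exact: (stein_bound m3 beta01 sym_mu mu6 N_gt0 indJ lawJ rho4 h_small v i f3 M2P M3P c1).
have cddf i j : continuous (partial j (partial i f)).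
  by move=> x; apply: differentiable_continuous; case: ((d2 i).2 j).
have [iW [iY bound]] := smart_path_bound stdZ S_bm d1 (fun i => (d2 i).1) cddf
  (fun i j => M2P j i) symS stein.
rewrite (_ : (fun w => f (W w)) = fun w => f (\col_k S k w)); last first.
  by apply/funext => w; rewrite WS.
rewrite (Ex_expectation iW) (Ex_expectation iY) fM2 fM3.
rewrite [leRHS](_ : _ = (C * (M2 * N%:R `^ (- 2^-1) + M3 * N%:R `^ (- 4^-1)))%:E)//.
rewrite -EFinB abse_EFin lee_fin.
apply: (le_trans bound); rewrite /stein_error rate_sqrt -/n -/b.
set x := N%:R `^ (- 2^-1) in N12 *; set y := N%:R `^ (- 4^-1) in N14 *.
have -> : n%:R * ((1 + variance_constant mu m (rho ^+ 4)) * x) = a * x.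
  by rewrite /a mulrA.
apply: (@le_trans _ _ (2 * (n%:R * (M2 * (a * x) + M3 * (`|b| * y))))).
  rewrite ler_wpM2l// ler_wpM2l// lerD2l ler_wpM2l//.
  apply: (@le_trans _ _ (`|b| / N%:R)); first by rewrite ler_wpM2r ?invr_ge0// ler_norm.
  by rewrite ler_wpM2l// rate_inv.
have nR : 0 <= n%:R :> R by [].
have Mx : 0 <= M2 * x by rewrite mulr_ge0// ltW.
have My : 0 <= M3 * y by rewrite mulr_ge0// ltW.
have -> : 2 * (n%:R * (M2 * (a * x) + M3 * (`|b| * y))) =
  (2 * (n%:R * a)) * (M2 * x) + (2 * (n%:R * `|b|)) * (M3 * y) by ring.
rewrite mulrDr; apply: lerD; apply: ler_wpM2r => //; rewrite /C mulrDr mulrDr.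
  by rewrite -addrA lerDl addr_ge0// !mulr_ge0.
rewrite addrAC lerDr; apply: addr_ge0 => //; apply: mulr_ge0 => //.
exact: mulr_ge0.
Qed.
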